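(* Let $\eta>0$ and let $k,\ell$ be integers with $2\le \ell<k/2$. Then there exists $n_0$ such that every $k$-graph $H$ on $n\ge n_0$ vertices with $(k-\ell)\mid n$ and $$\delta_\ell(H)\ge\left(\max\left\{(1/2)^{\frac{k-\ell}{\ell}},\,t(k,\ell,\ell)\right\}+\eta\right)\binom{n}{k-\ell}$$ contains a Hamilton $\ell$-cycle. That is, $h_\ell^\ell(k)\le\max\left\{(1/2)^{\frac{k-\ell}{\ell}},\,t(k,\ell,\ell)\right\}$.
   Context: A $k$-graph $H=(V,E)$ ($k\ge 2$) has a vertex set $V$ and an edge set $E\subseteq\binom{V}{k}$. For $S\in\binom{V}{d}$, $\deg_H(S)$ is the number of $T\in\binom{V}{k-d}$ with $S\cup T\in E$, and the minimum $d$-degree $\delta_d(H)$ is the minimum of $\deg_H(S)$ over all $S\in\binom{V}{d}$. For $1\le \ell<k$, a $k$-graph is an $\ell$-cycle if there is a cyclic ordering of its vertices such that every edge consists of $k$ consecutive vertices and any two consecutive edges (in the natural order of the edges) share exactly $\ell$ vertices. A $k$-graph on $n$ vertices contains a Hamilton $\ell$-cycle if it contains an $\ell$-cycle as a spanning subhypergraph; this forces $(k-\ell)\mid n$. For $(k-\ell)\mid n$ and $1\le d\le k-1$, $h_d^\ell(k,n)$ denotes the smallest integer $h$ such that every $n$-vertex $k$-graph $H$ with $\delta_d(H)\ge h$ contains a Hamilton $\ell$-cycle, and $h_d^\ell(k):=\limsup_{n\to\infty} h_d^\ell(k,n)/\binom{n}{k-d}$, where $n$ ranges over multiples of $k-\ell$.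 For $k>b\ge 0$, $Y_{k,b}$ is the $k$-graph consisting of two edges that intersect in exactly $b$ vertices. For $k$-graphs $F$ and $H$, an $F$-tiling in $H$ is a subgraph of $H$ consisting of vertex-disjoint copies of $F$. For $k\ge 3$, $1\le\ell<k/2$, $1\le d\le k-1$ and $\varepsilon>0$, $t_d^\ell(k,n,\varepsilon)$ denotes the minimum $t$ such that every $k$-graph $H$ on $n$ vertices with $\delta_d(H)\ge t$ contains a $Y_{k,2\ell}$-tiling covering all but at most $\varepsilon n$ vertices of $H$, and $$t(k,d,\ell):=\limsup_{\varepsilon\to 0}\,\limsup_{n\to\infty}\frac{t_d^\ell(k,n,\varepsilon)}{\binom{n}{k-d}}.$$ *)

(* Defs.v *)
From HB Require Import structures.
From mathcomp Require Import all_boot all_order all_algebra.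
From mathcomp Require Import all_classical all_reals all_analysis.

Set Implicit Arguments.
Unset Strict Implicit.
Unset Printing Implicit Defensive.

Import Order.TTheory GRing.Theory Num.Theory.
Import numFieldNormedType.Exports.

Local Open Scope ring_scope.

(* A k-graph whose vertex set is the whole finite type V. *)
Record kgraph (k : nat) (V : finType) := KGraph {
  edges : {set {set V}};
  edges_uniform : forall e : {set V}, e \in edges -> #|e| = k
}.

Section Degree.
Variables (k : nat) (V : finType) (H : kgraph k V).

Definition deg (S : {set V}) : nat :=
  #|[set T : {set V} | (#|T| == k - #|S|)%N && (S :|: T \in edges H)]|.

(* Every d-set has degree at most 'C(#|V|, k - d), so the default value of the
   minimum only matters when V has fewer than d elements. *)
Definition min_degree (d : nat) : nat :=
  \big[minn/'C(#|V|, k - d)]_(S : {set V} | #|S| == d) deg S.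

Lemma min_degree_le (d : nat) : (min_degree d <= 'C(#|V|, k - d))%N.
Proof.
apply: (big_rec (fun m => (m <= 'C(#|V|, k - d))%N)) => // S m _ le_m.
by rewrite geq_min le_m orbT.
Qed.

End Degree.

Section Cycle.
Variables (k : nat) (V : finType).

(* The k consecutive vertices starting at position i of the cyclic order s. *)
Definition window (s : seq V) (i : nat) : {set V} := [set x in take k (rot i s)].

(* The list s is the cyclic order of the vertices, and p lists the starting
   positions of the edges in their natural order; [cycle] also compares the
   last edge with the first.  Without the requirement of at least three edges,
   an edgeless k-graph, or one with two edges sharing l vertices and the other
   vertices isolated, would qualify.  When 1 <= l < k / 2, the conditions force the
   starting positions to be k - l apart all around the cycle. *)
Definition is_lcycle (l : nat) (C : kgraph k V) : Prop :=
  exists (s : seq V) (p : seq nat),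
    [/\ uniq s, forall x : V, x \in s,
        [/\ sorted ltn p, all (fun i => i < size s)%N p & (2 < size p)%N],
        edges C = [set:: map (window s) p] &
        cycle (fun i j => #|window s i :&: window s j| == l) p].

Definition has_hamilton_cycle (l : nat) (H : kgraph k V) : Prop :=
  exists C : kgraph k V, is_lcycle l C /\ edges C \subset edges H.

End Cycle.

Section Tiling.
Variables (k : nat) (U V : finType) (F : kgraph k U) (H : kgraph k V).

Definition is_copy (phi : {ffun U -> V}) : Prop :=
  injective phi /\ forall e : {set U}, e \in edges F -> phi @: e \in edges H.

Definition is_tiling (T : {set {ffun U -> V}}) : Prop :=
  (forall phi, phi \in T -> is_copy phi) /\
  (forall phi psi, phi \in T -> psi \in T -> phi != psi ->
     [disjoint phi @: [set: U] & psi @: [set: U]]).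

Definition covered (T : {set {ffun U -> V}}) : {set V} :=
  \bigcup_(phi in T) phi @: [set: U].

End Tiling.

Section Y.
Variables k b : nat.

Definition Y_edge1 : {set 'I_(k + (k - b))} := [set i : 'I_(k + (k - b)) | (i < k)%N].
Definition Y_edge2 : {set 'I_(k + (k - b))} := [set i : 'I_(k + (k - b)) | (k - b <= i)%N].

Lemma card_ord_lt (m n : nat) :
  (m <= n)%N -> #|[set i : 'I_n | (i < m)%N]| = m.
Proof.
move=> le_mn; rewrite cardsE -sum1_card.
by rewrite -(big_ord_widen n (fun=> 1%N) le_mn) sum1_card card_ord.
Qed.

Lemma Y_uniform (e : {set 'I_(k + (k - b))}) :
  e \in [set Y_edge1; Y_edge2] -> #|e| = k.
Proof.
rewrite !inE => /orP[] /eqP ->; first by rewrite card_ord_lt // leq_addr.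
have -> : Y_edge2 = ~: [set i : 'I_(k + (k - b)) | (i < k - b)%N].
  by apply/setP => i; rewrite !inE leqNgt.
by rewrite cardsCs finset.setCK card_ord_lt ?leq_addl // card_ord addnK.
Qed.

(* For b < k: the common vertices of the two edges are those numbered
   k - b, ..., k - 1. *)
Definition Y : kgraph k 'I_(k + (k - b)) := KGraph Y_uniform.

Lemma card_Y_edgeI : (b < k)%N -> #|Y_edge1 :&: Y_edge2| = b.
Proof.
move=> lt_bk; have c1 : #|Y_edge1| = k by apply: Y_uniform; rewrite !inE eqxx.
have c2 : #|Y_edge2| = k by apply: Y_uniform; rewrite !inE eqxx orbT.
have := cardsUI Y_edge1 Y_edge2; rewrite c1 c2.
have -> : Y_edge1 :|: Y_edge2 = [set: 'I_(k + (k - b))].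
  apply/setP => i; rewrite !inE; case: (ltnP i k) => //= le_ki.
  by rewrite (leq_trans (leq_subr b k) le_ki).
rewrite cardsT card_ord -addnA => /addnI h.
by apply: (@addnI (k - b)%N); rewrite h subnK // ltnW.
Qed.

End Y.

Section Thresholds.

Definition forces (k d n : nat) (Q : forall V : finType, kgraph k V -> Prop)
    (t : nat) : Prop :=
  forall (V : finType) (H : kgraph k V),
    #|V| = n -> (t <= min_degree H d)%N -> Q V H.

Lemma forces_exists (k d n : nat) (Q : forall V : finType, kgraph k V -> Prop) :
  exists t, `[< forces d n Q t >].
Proof.
exists 'C(n, k - d).+1; apply/asboolP => V H <- lt_deg.
by have := leq_trans lt_deg (min_degree_le H d); rewrite ltnn.
Qed.

Definition threshold (k d n : nat) (Q : forall V : finType, kgraph k V -> Prop)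
    : nat :=
  ex_minn (forces_exists d n Q).

Definition hamilton_threshold (d l k n : nat) : nat :=
  threshold d n (fun (V : finType) (H : kgraph k V) => has_hamilton_cycle l H).

Context {R : realType}.

Definition almost_tiled (l k : nat) (eps : R) (V : finType) (H : kgraph k V)
    : Prop :=
  exists T : {set {ffun 'I_(k + (k - 2 * l)) -> V}},
    is_tiling (Y k (2 * l)) H T /\
    (#|~: covered T|)%:R <= eps * #|V|%:R.

Definition tiling_threshold (d l k n : nat) (eps : R) : nat :=
  threshold d n (fun (V : finType) (H : kgraph k V) => almost_tiled l eps H).

End Thresholds.

(* The limits superior are taken in the extended reals, so that no finiteness
   is presupposed. *)
Definition h_lim (R : realType) (d l k : nat) : \bar R :=
  limf_esup
    (fun n : nat => ((hamilton_threshold d l k n)%:R / 'C(n, k - d)%:R)%:E)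
    (within [set n : nat | (k - l %| n)%N] \oo)%classic.

Definition t_lim (R : realType) (k d l : nat) : \bar R :=
  limf_esup
    (fun eps : R =>
       limn_esup (fun n : nat =>
         ((tiling_threshold d l k n eps)%:R / 'C(n, k - d)%:R)%:E))
    (0 : R)^'+.

(* Main.v *)
(* The argument is by absorption, with densities of lists of vertices playing
   the role of both counting and random choice.  Put theta = max + eta/2.

   Connecting: by the Loomis-Whitney inequality, an l-set S of degree density
   theta with theta^l > 2^-(k-l) has, for more than half of all l-sets U, many
   edges containing S and U.  Two l-sets S and T therefore share many such U,
   and an edge through S and U followed by one through U and T is an l-path.

   Absorbing: for all but few pairs x, y, many lists Q are such that Q + x and
   Q + y are both vertex sets of l-paths with the same ends.  An absorber of a
   (k-l)-set W consists of an edge s m t, of a connector c from s to t, and of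
   such lists Q_i for the pairs (c_i, z_i), where z = m W has as many entries
   as c.  Its idle paths are s m t and the Q_i + c_i, its absorbing paths are
   s c t and the Q_i + z_i.  A greedy selection yields linearly many disjoint
   absorbers serving every W; the few vertices lying in too many bad pairs are
   covered by edges in advance.

   Covering: almost all vertices are covered by blow-ups of Y_{k,2l}, each of
   which has an l-path missing only k-2l vertices.  A tiling by blow-ups is
   improved as follows.  Most samples of vertices, taken from a random set of
   blow-ups and of uncovered blocks of the same size, inherit the degree
   condition, hence have an almost perfect Y_{k,2l}-tiling; by Erdos' box
   theorem, such tilings extend to smaller blow-ups, whose total size exceeds
   that of the blow-ups they replace.

   The paths are joined through a reservoir of connectors, and the remaining
   vertices are absorbed. *)
Require Import Defs.
From HB Require Import structures.
From mathcomp Require Import all_boot all_order all_algebra.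
From mathcomp Require Import all_classical all_reals all_analysis.
From mathcomp Require Import zify ring lra.
From mathcomp Require Import fintype finset.

Set Implicit Arguments.
Unset Strict Implicit.
Unset Printing Implicit Defensive.

Import Order.TTheory GRing.Theory Num.Theory.

Local Open Scope ring_scope.

(** * Averages over lists *)

(** The exponent (k-l)/l comes from the shadow bound: a family of (k-l)-lists of density d has
    l-sublists of density at least d^(l/(k-l)), which exceeds one half precisely when d >
    (1/2)^((k-l)/l), and two majorities meet. The condition l >= 2 gives every pair of vertices
    positive degree, so that a positive density of bad pairs would span many four-cycles, and these
    are gadgets. A tiling by single copies of Y would leave a fixed fraction of n of paths, while
    the reservoir must stay below the absorbing capacity and can join only few; blow-ups allow as
    few as n / b paths, with b chosen after the reservoir. The tiling threshold is used only on
    samples of constant size. Each improvement replaces large blow-ups by much smaller ones, so a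
    cover is claimed for every part size at once; its gain does not depend on that size, hence
    boundedly many improvements suffice. Connectors depend only on the ends of the paths, which are
    the same in both states of an absorber; the leftover can thus be determined before it is
    absorbed. *)

(* The average runs over all lists of length r, repetitions included; lists
   with repetitions have density at most r^2 / #|T|. *)
Fixpoint average (R : realType) (T : finType) (r : nat) (F : seq T -> R) : R :=
  if r is r'.+1 then (\sum_(x : T) average r' (fun s => F (x :: s))) / #|T|%:R
  else F [::].

(** Locked, so that [/=] does not unfold averages over lists of length [r.+1]; [AvE] unfolds one
    entry on demand. *)
HB.lock Definition Av (R : realType) (T : finType) (r : nat) (F : seq T -> R) : R :=
  average r F.

Lemma Av_nil (R : realType) (T : finType) (F : seq T -> R) : Av 0 F = F [::].
Proof. by rewrite unlock. Qed.

Lemma AvS (R : realType) (T : finType) r (F : seq T -> R) :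
  Av r.+1 F = (\sum_(x : T) Av r (fun s => F (x :: s))) / #|T|%:R.
Proof. by rewrite unlock. Qed.

Definition AvE := (Av_nil, @AvS).

Section Averages.
Context {R : realType}.
Implicit Types (T : finType).

Lemma eq_Av T r (F G : seq T -> R) :
  (forall s, size s = r -> F s = G s) -> Av r F = Av r G.
Proof.
elim: r F G => [|r IH] F G h; rewrite !AvE; first exact: h.
congr (_ / _); apply: eq_bigr => x _; apply: IH => s hs; apply: h.
by rewrite /= hs.
Qed.

Lemma ler_Av T r (F G : seq T -> R) :
  (forall s, size s = r -> F s <= G s) -> Av r F <= Av r G.
Proof.
elim: r F G => [|r IH] F G h; rewrite !AvE; first exact: h.
apply: ler_wpM2r; first by rewrite invr_ge0 ler0n.
apply: ler_sum => x _; apply: IH => s hs; apply: h.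
by rewrite /= hs.
Qed.

Lemma AvZ T r (c : R) (F : seq T -> R) : Av r (fun s => c * F s) = c * Av r F.
Proof.
elim: r F => [|r IH] F; rewrite !AvE //.
under eq_bigr do rewrite IH.
by rewrite -mulr_sumr mulrA.
Qed.

Lemma AvZr T r (c : R) (F : seq T -> R) : Av r (fun s => F s * c) = Av r F * c.
Proof. by rewrite mulrC -AvZ; apply: eq_Av => s _; rewrite mulrC. Qed.

Lemma Av_sum T r (I : Type) (l : seq I) (P : pred I) (F : I -> seq T -> R) :
  Av r (fun s => \sum_(i <- l | P i) F i s) = \sum_(i <- l | P i) Av r (F i).
Proof.
elim: r F => [|r IH] F.
  by rewrite !AvE; apply: eq_bigr => i _; rewrite AvE.
rewrite AvE; under eq_bigr do rewrite IH.
by rewrite exchange_big /= mulr_suml; apply: eq_bigr => i _; rewrite AvE.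
Qed.

Lemma AvD T r (F G : seq T -> R) :
  Av r (fun s => F s + G s) = Av r F + Av r G.
Proof.
elim: r F G => [|r IH] F G; rewrite !AvE //.
under eq_bigr do rewrite IH.
by rewrite big_split mulrDl.
Qed.

Lemma AvN T r (F : seq T -> R) : Av r (fun s => - F s) = - Av r F.
Proof. by rewrite -mulN1r -AvZ; apply: eq_Av => s _; rewrite mulN1r. Qed.

Lemma AvB T r (F G : seq T -> R) :
  Av r (fun s => F s - G s) = Av r F - Av r G.
Proof. by rewrite AvD AvN. Qed.

Lemma Av0 T r : Av r (fun _ : seq T => 0 : R) = 0.
Proof.
by rewrite -[RHS](mul0r (Av r (fun _ : seq T => 0 : R))) -AvZ; apply: eq_Av => s _; rewrite mul0r.
Qed.

Lemma Av_ge0 T r (F : seq T -> R) :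
  (forall s, size s = r -> 0 <= F s) -> 0 <= Av r F.
Proof. by move=> h; rewrite -(Av0 T r); apply: ler_Av. Qed.

Lemma Av_const T r (c : R) : (0 < #|T|)%N -> Av r (fun _ : seq T => c) = c.
Proof.
move=> hT; elim: r => [|r IH]; rewrite !AvE //.
under eq_bigr do rewrite IH.
by rewrite sumr_const -(mulr_natr c) mulfK // pnatr_eq0 -lt0n.
Qed.

Lemma Av_le T r (F : seq T -> R) c : (0 < #|T|)%N ->
  (forall s, size s = r -> F s <= c) -> Av r F <= c.
Proof. by move=> hT h; rewrite -(Av_const r c hT); apply: ler_Av. Qed.

Lemma Av_ge T r (F : seq T -> R) c : (0 < #|T|)%N ->
  (forall s, size s = r -> c <= F s) -> c <= Av r F.
Proof. by move=> hT h; rewrite -(Av_const r c hT); apply: ler_Av. Qed.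

Lemma Av_cat T r r' (F : seq T -> R) :
  Av (r + r') F = Av r (fun s => Av r' (fun t => F (s ++ t))).
Proof.
elim: r F => [|r IH] F; rewrite !AvE //.
by congr (_ / _); apply: eq_bigr => x _; rewrite IH.
Qed.

Lemma Av_divr T r (c : R) (F : seq T -> R) :
  Av r (fun s => F s / c) = Av r F / c.
Proof. exact: AvZr. Qed.

Lemma Av_swap T T' r r' (F : seq T -> seq T' -> R) :
  Av r (fun s => Av r' (fun t => F s t)) = Av r' (fun t => Av r (fun s => F s t)).
Proof.
elim: r F => [|r IH] F.
  by rewrite !AvE; apply: eq_Av => t _; rewrite AvE.
under [RHS]eq_Av do rewrite AvE.
rewrite AvE AvZr Av_sum; congr (_ / _); apply: eq_bigr => x _.
by rewrite IH.
Qed.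

Lemma Av_exists T r (F : seq T -> R) c : (0 < #|T|)%N ->
  c <= Av r F -> exists2 s, size s = r & c <= F s.
Proof.
move=> hT; elim: r F => [|r IH] F; rewrite !AvE; first by exists [::].
rewrite ler_pdivlMr ?ltr0n // => h.
have [x hx] : exists x, c <= Av r (fun s => F (x :: s)).
  apply/existsP; apply: contraT; rewrite negb_exists => /forallP hn.
  move: h; rewrite leNgt => /negP[].
  rewrite mulr_natr -sumr_const; apply: ltr_sum => [|i _]; last by rewrite ltNge hn.
  by have /card_gt0P[x _] := hT; apply/hasP; exists x; rewrite // mem_index_enum.
by have [s hs hF] := IH _ hx; exists (x :: s); rewrite /= ?hs.
Qed.

Lemma Av_CS T r (F : seq T -> R) : (0 < #|T|)%N ->
  (Av r F) ^+ 2 <= Av r (fun s => F s ^+ 2).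
Proof.
move=> hT; set m := Av r F.
have : 0 <= Av r (fun s => (F s - m) ^+ 2) by apply: Av_ge0 => s _; exact: sqr_ge0.
have -> : Av r (fun s => (F s - m) ^+ 2) =
   Av r (fun s => F s ^+ 2 + (m ^+ 2 + (- 2 * m) * F s)).
  by apply: eq_Av => s _; ring.
rewrite !AvD (AvZ r (- 2 * m)) Av_const // -/m; nra.
Qed.

(** A reverse Markov inequality: values below c/2 contribute at most c/2 to the mean, so the values
    above, all at most 1, must contribute the rest. *)
Lemma Av_markov T r (F : seq T -> R) c : (0 < #|T|)%N ->
  (forall s, size s = r -> F s <= 1) -> 0 <= c -> c <= Av r F ->
  c / 2 <= Av r (fun s => (c / 2 <= F s)%R%:R).
Proof.
move=> hT h1 c0 hc.
suff : Av r F <= Av r (fun s => c / 2 + (c / 2 <= F s)%R%:R).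
  rewrite AvD Av_const //; lra.
apply: ler_Av => s hs; have := h1 s hs; case: (leP (c / 2) (F s)) => /= h; lra.
Qed.

Lemma sum_bool T (P : pred T) : \sum_x (P x)%:R = #|P|%:R :> R.
Proof.
rewrite -sum1_card natr_sum [RHS]big_mkcond /=; apply: eq_bigr => x _.
by rewrite /in_mem /=; case: (P x).
Qed.

Lemma Av_hit T r (X : {set T}) : (0 < #|T|)%N ->
  Av r (fun s => (has (mem X) s)%:R) <= r%:R * #|X|%:R / #|T|%:R :> R.
Proof.
move=> hT; elim: r => [|r IH]; rewrite !AvE /=; first by rewrite mul0r mul0r.
apply: ler_wpM2r; first by rewrite invr_ge0.
have h x : Av r (fun s : seq T => ((x \in X) || has (mem X) s)%:R) <=
   (x \in X)%:R + r%:R * #|X|%:R / #|T|%:R :> R.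
  apply: le_trans (_ : _ <= Av r (fun s : seq T => (x \in X)%:R + (has (mem X) s)%:R)) _.
    by apply: ler_Av => s _; case: (x \in X); case: has; rewrite /=; lra.
  by rewrite AvD Av_const // lerD2l.
apply: le_trans (_ : _ <= \sum_x ((x \in X)%:R + r%:R * #|X|%:R / #|T|%:R)) _.
  by apply: ler_sum => x _; exact: h.
rewrite big_split /= sum_bool sumr_const -(mulr_natr _ #|T|) divfK; last by rewrite pnatr_eq0 -lt0n.
by rewrite -[r.+1]addn1 natrD mulrDl mul1r addrC.
Qed.

Lemma Av_dup T r : (0 < #|T|)%N ->
  Av r (fun s : seq T => (~~ uniq s)%:R) <= r%:R ^+ 2 / #|T|%:R :> R.
Proof.
move=> hT; elim: r => [|r IH]; rewrite !AvE /=; first by rewrite expr0n mul0r.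
have h x : Av r (fun s : seq T => (~~ ((x \notin s) && uniq s))%:R) <=
   r%:R / #|T|%:R + r%:R ^+ 2 / #|T|%:R :> R.
  apply: le_trans (_ : _ <= Av r (fun s : seq T => (has (mem [set x]) s)%:R + (~~ uniq s)%:R)) _.
    apply: ler_Av => s _; rewrite negb_and negbK.
    have -> : has (mem [set x]) s = (x \in s).
      by apply/hasP/idP => [[z hz /=]|hx]; [rewrite in_set1 => /eqP <-|exists x; rewrite /= ?in_set1].
    by case: (x \in s); case: uniq; rewrite /=; lra.
  rewrite AvD; apply: lerD IH.
  by apply: le_trans (Av_hit _ _ _) _; rewrite ?cards1 ?mulr1.
apply: le_trans (_ : _ <= (\sum_(x : T) (r%:R / #|T|%:R + r%:R ^+ 2 / #|T|%:R)) / #|T|%:R) _.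
  by apply: ler_wpM2r; rewrite ?invr_ge0 //; apply: ler_sum => x _; exact: h.
rewrite sumr_const -[X in X / _]mulr_natr mulfK ?pnatr_eq0 -?lt0n // -mulrDl.
apply: ler_wpM2r; first by rewrite invr_ge0.
by rewrite -natrX -natrD -natrX ler_nat; nia.
Qed.

(** Fubini for two interleaved sets of positions: entries kept by the mask and the remaining ones
    are independent. *)
Lemma Av_mask T (m : seq bool) (F : seq T -> seq T -> R) :
  Av (size m) (fun s => F (mask m s) (mask (map negb m) s)) =
  Av (count id m) (fun u => Av (count negb m) (fun v => F u v)).
Proof.
elim: m F => [|[] m IH] F /=; rewrite ?add1n ?add0n !AvE //=.
  congr (_ / _); apply: eq_bigr => x _.
  by rewrite (IH (fun u v => F (x :: u) v)).
under [RHS]eq_Av do rewrite AvE.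
rewrite Av_divr Av_sum; congr (_ / _); apply: eq_bigr => x _.
by rewrite (IH (fun u v => F u (x :: v))).
Qed.

End Averages.

(** * Shadows *)

Section Shadow.
Context {R : realType}.
Implicit Types (T : finType).

Lemma root_exists (b : R) j : 0 <= b -> exists2 c : R, 0 <= c & c ^+ j.+1 = b.
Proof.
move=> b0; exists (b `^ (j.+1%:R^-1)); first exact: powR_ge0.
by rewrite -powR_mulrn ?powR_ge0 // -powRrM mulVf ?pnatr_eq0 // powRr1.
Qed.

Lemma Av_bool_le1 T r (A : pred (seq T)) : (0 < #|T|)%N ->
  Av r (fun x => (A x)%:R) <= 1 :> R.
Proof. by move=> hT; apply: Av_le => // s _; case: (A s); rewrite //= ler01. Qed.

Lemma Av_bool_ge0 T r (A : pred (seq T)) : 0 <= Av r (fun x => (A x)%:R) :> R.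
Proof. by apply: Av_ge0 => s _. Qed.

(** Induction on the dimension, slicing along the first entry [v]. A slice has density at most [b],
    by deletion of [v], and at most [bv v] to the power (j+2)/(j+1), by induction. A weighted
    geometric mean of these bounds is linear in [bv v], so that it can be averaged over [v]. *)
Lemma loomis_whitney T j (A B : pred (seq T)) : (0 < #|T|)%N ->
  (forall x, size x = j.+2 -> A x ->
     forall i, (i <= j.+1)%N -> B (take i x ++ drop i.+1 x)) ->
  (Av j.+2 (fun x => (A x)%:R)) ^+ j.+1
    <= (Av j.+1 (fun x => (B x)%:R)) ^+ j.+2 :> R.
Proof.
move=> hT; elim: j A B => [|j IH] A B hAB.
  rewrite expr1 expr2 -AvZr -[2%N]/(1 + 1)%N Av_cat.
  apply: ler_Av => s hs; rewrite -AvZ.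
  apply: ler_Av => t ht; case: (boolP (A (s ++ t))) => hA /=; last by rewrite mulr_ge0.
  case: s t hs ht hA => [//|x []] // [//|y []] //= _ _ hA.
  have := hAB [:: x; y] erefl hA 0%N isT; have := hAB [:: x; y] erefl hA 1%N isT.
  by move=> /= -> ->; rewrite mulr1.
set a := Av _ _; set b := Av _ _.
pose av v := Av j.+2 (fun x => (A (v :: x))%:R) : R.
pose bv v := Av j.+1 (fun x => (B (v :: x))%:R) : R.
have ea : a = (\sum_v av v) / #|T|%:R by rewrite /a AvS.
have eb : b = (\sum_v bv v) / #|T|%:R by rewrite /b AvS.
have b0 : 0 <= b by exact: Av_bool_ge0.
have [c c0 hc] := root_exists j.+1 b0.
have hv v : av v <= c * bv v.
  have bv0 : 0 <= bv v by exact: Av_bool_ge0.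
  have av0 : 0 <= av v by exact: Av_bool_ge0.
  have h1 : av v ^+ j.+1 <= bv v ^+ j.+2.
    apply: IH => x hx hA i hi.
    by have := hAB (v :: x) _ hA i.+1 hi; rewrite /= hx; exact.
  have h2 : av v <= b.
    apply: ler_Av => s hs; case: (boolP (A (v :: s))) => hA //=.
    by have := hAB (v :: s) _ hA 0%N isT; rewrite /= hs drop0 => ->.
  have cb0 : 0 <= c * bv v by exact: mulr_ge0.
  rewrite -(@ler_pXn2r _ j.+2) ?nnegrE // exprMn hc exprS.
  by apply: ler_pM => //; rewrite exprn_ge0.
have hab : a <= c * b.
  rewrite ea eb mulrA; apply: ler_wpM2r; first by rewrite invr_ge0.
  by rewrite mulr_sumr; apply: ler_sum.
rewrite [leRHS]exprS -{1}hc -exprMn lerXn2r // ?nnegrE ?mulr_ge0 //.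
exact: Av_bool_ge0.
Qed.

(** These lists play the role of cliques: deleting an entry keeps the property, so the
    Loomis-Whitney inequality applies with the same property before and after the deletion. *)
Definition allsub T l (G : pred (seq T)) (x : seq T) : bool :=
  [forall u : l.-tuple T, subseq u x ==> G u].

Lemma allsubP T l (G : pred (seq T)) (x : seq T) :
  reflect (forall u, size u = l -> subseq u x -> G u) (allsub l G x).
Proof.
apply: (iffP forallP) => [h u hu hs|h u]; last by apply/implyP; apply: h; rewrite size_tuple.
by have /implyP := h (@Tuple l T u (introT eqP hu)); exact.
Qed.

(** Each induction step is one use of [loomis_whitney], which shortens the lists by one entry; the
    exponents telescope. *)
Lemma shadow_power T l r (G : pred (seq T)) : (0 < #|T|)%N ->
  (Av (l.+1 + r) (fun x => (allsub l.+1 G x)%:R)) ^+ l.+1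
    <= (Av l.+1 (fun x => (G x)%:R)) ^+ (l.+1 + r) :> R.
Proof.
move=> hT; elim: r => [|r IH].
  rewrite addn0 lerXn2r ?nnegrE ?Av_bool_ge0 //.
  apply: ler_Av => x hx; case: allsubP => // h.
  by rewrite h.
rewrite addnS.
have h := @loomis_whitney T (l + r) (allsub l.+1 G) (allsub l.+1 G) hT.
set a := Av _ _ in IH *; set g := Av _ _ in IH *.
have {}h : (Av (l.+1 + r).+1 (fun x => (allsub l.+1 G x)%:R)) ^+ (l.+1 + r) <= a ^+ (l.+1 + r).+1.
  apply: h => x hx /allsubP hA i hi; apply/allsubP => u hu hs; apply: hA => //.
  apply: (subseq_trans hs); rewrite -{3}(cat_take_drop i x); apply: cat_subseq => //.
  by rewrite -addn1 addnC -drop_drop drop_subseq.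
rewrite -(@ler_pXn2r _ (l.+1 + r)) ?nnegrE ?exprn_ge0 ?Av_bool_ge0 //.
rewrite -!exprM mulnC exprM.
apply: le_trans (_ : _ <= (a ^+ (l.+1 + r).+1) ^+ l.+1) _.
  by rewrite lerXn2r ?nnegrE ?exprn_ge0 ?Av_bool_ge0.
rewrite -exprM mulnC exprM [leRHS]exprM -[leRHS]exprM mulnC [leRHS]exprM.
by rewrite lerXn2r ?nnegrE ?exprn_ge0 ?Av_bool_ge0.
Qed.

Lemma perm_mask_cat T (m : seq bool) (x : seq T) : size x = size m ->
  perm_eq x (mask m x ++ mask (map negb m) x).
Proof.
elim: m x => [|[] m IH] [|y x] //= [hx].
  by rewrite perm_cons IH.
by rewrite perm_sym perm_catC /= perm_cons perm_catC perm_sym IH.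
Qed.

(** A robust Kruskal-Katona bound: sublists count only if they extend to [L] with density [beta].
    Members of [L] with a sublist violating this are discarded at a cost of [beta] for each set of
    positions, and [shadow_power] applies to what is left. *)
Lemma shadow_density T l r (L : pred (seq T)) (beta : R) : (0 < #|T|)%N ->
  (forall x y, perm_eq x y -> L x = L y) -> 0 <= beta ->
  (2 ^ (l.+1 + r))%:R * beta <= Av (l.+1 + r) (fun x => (L x)%:R) ->
  (Av (l.+1 + r) (fun x => (L x)%:R) - (2 ^ (l.+1 + r))%:R * beta) ^+ l.+1 <=
  (Av l.+1 (fun u => (beta <= Av r (fun m => (L (u ++ m))%:R))%R%:R))
     ^+ (l.+1 + r).
Proof.
move=> hT Lsym beta0 hL; pose D (u : seq T) : R := Av r (fun m => (L (u ++ m))%:R).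
pose G u := beta <= D u; rewrite -[X in _ <= X ^+ _]/(Av l.+1 (fun u => (G u)%:R)).
apply: le_trans (shadow_power l r G hT).
rewrite lerXn2r ?nnegrE ?Av_bool_ge0 ?subr_ge0 // lerBlDr.
set n := (l.+1 + r)%N.
(* A discarded list is charged to the mask selecting its bad sublist; for a fixed mask, the other
   entries complete a bad sublist with probability less than [beta]. *)
apply: le_trans (_ : _ <= Av n (fun x => (allsub l.+1 G x)%:R + \sum_(m : n.-tuple bool | count id m == l.+1) (L x && ~~ G (mask m x))%:R)) _.
  apply: ler_Av => x hx; have [_|h] := boolP (allsub l.+1 G x).
    by apply: ler_wpDr; [apply: sumr_ge0|case: (L x)].
  rewrite add0r; have [hLx|] := boolP (L x); last by move=> _; apply: sumr_ge0.
  move: h; rewrite negb_forall => /existsP[u]; rewrite negb_imply => /andP[].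
  move=> /subseqP[m hm eu] hG.
  have hm' : size m == n by rewrite hm hx.
  rewrite (bigD1 (Tuple hm')) /=; last by rewrite -(size_mask (s := x)) // -eu size_tuple.
  by rewrite -eu hG ler_wpDr // sumr_ge0.
rewrite AvD lerD2l Av_sum.
apply: le_trans (_ : _ <= \sum_(m : n.-tuple bool) beta) _; last first.
  by rewrite sumr_const card_tuple card_bool mulr_natl.
rewrite big_mkcond /=; apply: ler_sum => m _; case: eqP => // hm.
have hsz : size m = n by rewrite size_tuple.
have hneg : count negb m = r.
  by apply/eqP; rewrite -(eqn_add2l (count id m)) -[X in _ == X]/(_ + r)%N; have := count_predC id m; rewrite hsz hm => ->.
have -> : Av n (fun x => (L x && ~~ G (mask m x))%:R) =
  Av (size m) (fun x => (L (mask m x ++ mask (map negb m) x) && ~~ G (mask m x))%:R) :> R.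
  rewrite hsz; apply: eq_Av => x hx; congr ((_ && _)%:R); apply: Lsym.
  by apply: perm_mask_cat; rewrite hsz.
rewrite (Av_mask m (fun u v => (L (u ++ v) && ~~ G u)%:R)) hm hneg.
apply: Av_le => // u hu; case: (boolP (G u)) => hG /=.
  apply: le_trans (_ : _ <= Av r (fun _ => 0)) _; last by rewrite Av0.
  by apply: ler_Av => v _; rewrite andbF.
have : D u < beta by rewrite ltNge.
by move/ltW; apply: le_trans; apply: ler_Av => v _; rewrite andbT.
Qed.

End Shadow.

(** * Degrees as densities *)

Section Counting.
Context {R : realType}.

Lemma Av_tuple (T : finType) r (F : seq T -> R) :
  Av r F = (\sum_(t : r.-tuple T) F t) / (#|T| ^ r)%:R.
Proof.
elim: r F => [|r IH] F.
  rewrite AvE expn0 divr1 (bigD1 [tuple]) //= big1 ?addr0 // => t /eqP[].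
  by apply: val_inj; rewrite /= tuple0.
rewrite AvE (eq_bigr (fun x => (\sum_(t : r.-tuple T) F (x :: t)) / (#|T| ^ r)%:R)); last first.
  by move=> x _; rewrite IH.
rewrite -mulr_suml -mulrA -invfM -natrM -expnSr; congr (_ / _).
rewrite pair_bigA /=.
rewrite (reindex (fun p : T * r.-tuple T => [tuple of p.1 :: p.2])) //=.
exists (fun t : r.+1.-tuple T => (thead t, [tuple of behead t])) => [[x t] _|t _] /=.
  by congr pair; apply: val_inj.
by rewrite -tuple_eta.
Qed.

Lemma Av_uniqE (T : finType) r :
  Av r (fun s : seq T => (uniq s)%:R) = (#|T| ^_ r)%:R / (#|T| ^ r)%:R :> R.
Proof.
rewrite Av_tuple; congr (_ / _).
rewrite (sum_bool (fun t : r.-tuple T => uniq t)).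
rewrite -(card_uniq_tuples r predT) cardsE; congr _%:R; apply: eq_card => t.
by rewrite ?inE /in_mem /= all_predT.
Qed.

Lemma ffact_lower (n r : nat) : (0 < n)%N ->
  (1 - r%:R ^+ 2 / n%:R) * (n ^ r)%:R <= (n ^_ r)%:R :> R.
Proof.
move=> n0; have hT : (0 < #|'I_n|)%N by rewrite card_ord.
rewrite -ler_pdivlMr ?ltr0n ?expn_gt0 ?n0 //.
have := Av_uniqE 'I_n r; rewrite card_ord => <-.
rewrite lerBlDr -[X in X <= _](Av_const r (1 : R) hT).
have := Av_dup (R := R) r hT; rewrite card_ord => h.
apply: le_trans (_ : _ <= Av r (fun s : seq 'I_n => (uniq s)%:R + (~~ uniq s)%:R)) _.
  by apply: ler_Av => s _; case: uniq; rewrite /= ?addr0 ?add0r.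
by rewrite AvD lerD2l.
Qed.

End Counting.

Section Hypergraph.
Variables (k : nat) (V : finType) (H : kgraph k V).

Definition ed (s : seq V) : bool := [set x in s] \in edges H.

Lemma eq_ed (s t : seq V) : s =i t -> ed s = ed t.
Proof.
move=> h; rewrite /ed; have -> // : [set x in s] = [set x in t].
by apply/setP => x; rewrite !inE h.
Qed.

Lemma perm_ed (s t : seq V) : perm_eq s t -> ed s = ed t.
Proof. by move/perm_mem; exact: eq_ed. Qed.

Lemma ed_uniq (s : seq V) : size s = k -> ed s -> uniq s.
Proof.
move=> hs h; have e := @edges_uniform _ _ H _ h; rewrite cardsE in e.
by apply/card_uniqP; rewrite e hs.
Qed.

Context {R : realType}.

(** Edges have k elements, so a list counted on the left neither repeats a vertex nor meets [s];
    each set counted by the degree is listed in (k-l)! orders. *)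
Lemma Av_deg (s : seq V) (l : nat) : uniq s -> size s = l -> (l <= k)%N ->
  Av (k - l) (fun x => (ed (s ++ x))%:R) =
  (deg H [set x in s])%:R * ((k - l)`!)%:R / (#|V| ^ (k - l))%:R :> R.
Proof.
move=> us hs hl; rewrite Av_tuple; congr (_ / _).
have cs : #|[set x in s]| = l by rewrite cardsE (card_uniqP us).
rewrite (sum_bool (fun t : (k - l).-tuple V => ed (s ++ t))) -natrM; congr _%:R.
rewrite /deg cs -sum1_card.
rewrite (partition_big (fun t : (k - l).-tuple V => [set x in t])
  (fun T => T \in [set T : {set V} | (#|T| == k - l)%N && ([set x in s] :|: T \in edges H)])) /=.
  rewrite -sum_nat_const; apply: eq_bigr => T; rewrite inE => /andP[/eqP cT hT].
  have -> : ((k - l)`! = #|T| ^_ (k - l))%N by rewrite cT ffactnn.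
  rewrite sum1_card -card_uniq_tuples cardsE; apply: eq_card => t.
  rewrite /in_mem /=; apply/andP/andP => [[h /eqP e]|[h1 h2]].
    split; first by apply/allP => x hx; change (x \in T); rewrite -e inE.
    by apply/card_uniqP; rewrite size_tuple -[RHS]cT -e cardsE.
  have e : [set x in t] = T.
    apply/eqP; rewrite eqEcard; apply/andP; split.
      by apply/subsetP => x; rewrite inE => /(allP h1).
    by rewrite cardsE (card_uniqP h2) size_tuple cT.
  split; last by rewrite e.
  rewrite /ed; suff -> : [set x in s ++ t] = [set x in s] :|: T by [].
  by rewrite -e; apply/setP => x; rewrite !inE mem_cat.
move=> t; rewrite -topredE /= => h; rewrite in_set.
have e : [set x in s ++ t] = [set x in s] :|: [set x in t].
  by apply/setP => x; rewrite !inE mem_cat.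
have := h; rewrite /ed e => ->; rewrite andbT cardsE.
have : uniq (s ++ t) by apply: ed_uniq h; rewrite size_cat size_tuple hs subnKC.
by rewrite cat_uniq => /and3P[_ _ /card_uniqP ->]; rewrite size_tuple.
Qed.

Definition dense (l : nat) (theta : R) : Prop :=
  forall s, uniq s -> size s = l -> theta <= Av (k - l) (fun x => (ed (s ++ x))%:R).

Lemma min_degree_leq (d : nat) (S : {set V}) : #|S| = d -> (min_degree H d <= deg H S)%N.
Proof.
move=> hS; rewrite /min_degree.
elim: (index_enum _) (mem_index_enum S) => [//|T s IH]; rewrite inE big_cons.
case/orP => [/eqP <-|h]; first by rewrite hS eqxx geq_min leqnn.
by case: ifP => _; rewrite ?geq_min IH ?orbT.
Qed.

(** The loss factor bounds the ratio of a falling factorial to the corresponding power. *)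
Lemma min_degree_dense (l : nat) (a b : R) : (l <= k)%N -> (0 < #|V|)%N ->
  0 <= a -> b <= a * (1 - (k - l)%:R ^+ 2 / #|V|%:R) ->
  a * 'C(#|V|, k - l)%:R <= (min_degree H l)%:R -> dense l b.
Proof.
move=> hl n0 a0 hb ha s us hs; rewrite (Av_deg us hs hl).
have cs : #|[set x in s]| = l by rewrite cardsE (card_uniqP us).
have h1 : (min_degree H l)%:R <= (deg H [set x in s])%:R :> R by rewrite ler_nat min_degree_leq.
rewrite ler_pdivlMr ?ltr0n ?expn_gt0 ?n0 //.
apply: le_trans (_ : _ <= a * ('C(#|V|, k - l)%:R * ((k - l)`!)%:R)) _; last first.
  by rewrite mulrA ler_wpM2r // (le_trans ha).
rewrite -natrM bin_ffact.
have := @ffact_lower R #|V| (k - l) n0 => h2.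
apply: le_trans (_ : _ <= a * (1 - (k - l)%:R ^+ 2 / #|V|%:R) * (#|V| ^ (k - l))%:R) _.
  by rewrite ler_wpM2r.
by rewrite -mulrA ler_wpM2l.
Qed.

(** No loss in this direction, since falling factorials are at most powers. The bound of [t] by the
    binomial coefficient accounts for the initial value of the minimum in [min_degree]. *)
Lemma dense_deg (l t : nat) (b : R) : (l <= k)%N -> (0 < #|V|)%N ->
  dense l b -> t%:R <= b * 'C(#|V|, k - l)%:R -> (t <= 'C(#|V|, k - l))%N -> (t <= min_degree H l)%N.
Proof.
move=> hl n0 hd ht ht'.
apply: (big_ind (fun m => t <= m)%N) => // [x y hx hy|S /eqP hS]; first by rewrite leq_min hx.
have := hd (enum S) (enum_uniq _); rewrite -cardE => /(_ hS).
rewrite (Av_deg (l := l)) ?enum_uniq // -?cardE //.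
have -> : [set x in enum S] = S by apply/setP => x; rewrite inE mem_enum.
rewrite ler_pdivlMr ?ltr0n ?expn_gt0 ?n0 // => h.
have [b0|b0] := ltP b 0.
  have : t%:R <= 0 :> R by apply: le_trans ht _; rewrite mulr_le0_ge0 // ltW.
  by rewrite lern0 => /eqP ->.
rewrite -(ler_nat R).
have f0 : 0 < ((k - l)`!)%:R :> R by rewrite ltr0n fact_gt0.
rewrite -(ler_pM2r f0); apply: le_trans h.
apply: le_trans (_ : _ <= b * 'C(#|V|, k - l)%:R * ((k - l)`!)%:R) _; first by rewrite ler_wpM2r // ltW.
rewrite -mulrA -natrM bin_ffact ler_wpM2l // ler_nat.
elim: (k - l)%N => [|r IH]; first by rewrite ffactn0.
by rewrite ffactnSr expnSr leq_mul // leq_subr.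
Qed.

End Hypergraph.

(** * Connectors and gadgets *)

Section Densities.
Context {R : realType}.

Lemma lebR (b1 b2 : bool) : (b1 -> b2) -> b1%:R <= b2%:R :> R.
Proof. by case: b1 => [->|] //; rewrite ler0n. Qed.

Lemma exp_sub_le (a b : R) n : 0 <= a -> a <= b -> b <= 1 ->
  b ^+ n - a ^+ n <= n%:R * (b - a).
Proof.
move=> a0 ab b1; elim: n => [|n IH]; first by rewrite !expr0 subrr mul0r.
have b0 : 0 <= b by exact: le_trans ab.
have -> : b ^+ n.+1 - a ^+ n.+1 = b * (b ^+ n - a ^+ n) + (b - a) * a ^+ n.
  by rewrite !exprS; ring.
have h1 : b * (b ^+ n - a ^+ n) <= n%:R * (b - a).
  apply: le_trans IH; rewrite ler_piMl // subr_ge0 lerXn2r ?nnegrE //.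
have h2 : (b - a) * a ^+ n <= b - a.
  rewrite ler_piMr ?subr_ge0 // exprn_ile1 //; exact: le_trans b1.
by rewrite -[n.+1]addn1 natrD; lra.
Qed.

(** Both sides are continuous in [beta] and the inequality is strict at 0; [exp_sub_le] supplies
    explicit Lipschitz constants. *)
Lemma choose_beta (theta c : R) (l r : nat) : 0 < theta -> theta <= 1 -> 0 < c ->
  (1 / 2) ^+ r < theta ^+ l ->
  exists beta : R, [/\ 0 < beta, beta <= 1 / 2, c * beta <= theta &
     (1 / 2 + beta) ^+ r <= (theta - c * beta) ^+ l].
Proof.
move=> t0 t1 c0 h; set e := theta ^+ l - (1 / 2) ^+ r.
have e0 : 0 < e by rewrite subr_gt0.
have d0 : 0 < l%:R * c + r%:R + 1 :> R by rewrite ltr_wpDl // addr_ge0 ?mulr_ge0 // ltW.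
pose beta := Num.min (1 / 2 : R) (Num.min (theta / c) (e / (l%:R * c + r%:R + 1))).
have b0 : 0 < beta by rewrite !lt_min !divr_gt0.
have b1 : beta <= 1 / 2 by rewrite ge_min lexx.
have b2 : c * beta <= theta by rewrite mulrC -ler_pdivlMr // !ge_min lexx orbT.
have b3 : beta * (l%:R * c + r%:R + 1) <= e by rewrite -ler_pdivlMr // !ge_min lexx !orbT.
exists beta; split => //.
have h1 : (1 / 2 + beta) ^+ r - (1 / 2) ^+ r <= r%:R * beta.
  by have -> : r%:R * beta = r%:R * ((1 / 2 + beta) - 1 / 2); [congr (_ * _); lra|apply: exp_sub_le; lra].
have cb : 0 <= c * beta by rewrite mulr_ge0 // ltW.
have h2 : theta ^+ l - (theta - c * beta) ^+ l <= l%:R * (c * beta).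
  have -> : l%:R * (c * beta) = l%:R * (theta - (theta - c * beta)) by congr (_ * _); lra.
  by apply: exp_sub_le; lra.
rewrite /e in b3; nra.
Qed.

Lemma Av_CS2 (T : finType) r r' (F : seq T -> seq T -> R) : (0 < #|T|)%N ->
  (Av r (fun s => Av r' (F s))) ^+ 2 <= Av r (fun s => Av r' (fun t => F s t ^+ 2)).
Proof.
move=> hT; apply: le_trans (Av_CS _ _ hT) _.
by apply: ler_Av => s _; exact: Av_CS.
Qed.

(** The density of four-cycles in a weighted bipartite graph is at least the fourth power of its
    edge density, by applying Cauchy-Schwarz once on each side. Here [p] and [q] are two opposite
    edges of the cycle. *)
Lemma Av_C4 (T : finType) (f : seq T -> R) : (0 < #|T|)%N ->
  (Av 2 f) ^+ 4 <= Av 2 (fun p => Av 2 (fun q =>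
     f (take 1 p ++ drop 1 p) * f (take 1 q ++ drop 1 p)
     * f (take 1 p ++ drop 1 q) * f (take 1 q ++ drop 1 q))).
Proof.
move=> hT.
pose G v b := Av 1 (fun u : seq T => f (u ++ v) * f (u ++ b)).
have h1 : (Av 2 f) ^+ 2 <= Av 1 (fun v => Av 1 (fun b => G v b)).
  rewrite -[2%N]/(1 + 1)%N Av_cat; apply: le_trans (Av_CS _ _ hT) _.
  rewrite /G; under [leRHS]eq_Av do rewrite Av_swap.
  rewrite Av_swap; apply: ler_Av => u hu.
  rewrite expr2 -AvZr; under [leRHS]eq_Av do rewrite AvZ.
  exact: lexx.
have -> : 4%N = (2 * 2)%N by [].
rewrite exprM; apply: le_trans (_ : _ <= (Av 1 (fun v => Av 1 (fun b => G v b))) ^+ 2) _.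
  by rewrite lerXn2r // ?nnegrE ?sqr_ge0 // (le_trans _ h1) // sqr_ge0.
apply: le_trans (Av_CS2 _ _ _ hT) _.
rewrite [leRHS](_ : _ = Av 1 (fun u => Av 1 (fun v => Av 1 (fun a => Av 1 (fun b =>
   f (u ++ v) * f (a ++ v) * f (u ++ b) * f (a ++ b)))))); last first.
  rewrite -[2%N]/(1 + 1)%N Av_cat; apply: eq_Av => u hu; apply: eq_Av => v hv.
  rewrite Av_cat; apply: eq_Av => a ha; apply: eq_Av => b hb.
  by rewrite !take_size_cat // !drop_size_cat.
rewrite [leRHS]Av_swap; apply: ler_Av => v hv.
under [leRHS]eq_Av do rewrite Av_swap.
rewrite [leRHS]Av_swap; apply: ler_Av => b hb.
rewrite expr2 /G -AvZr le_eqVlt; apply/orP; left; apply/eqP.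
apply: eq_Av => u hu; rewrite -AvZ; apply: eq_Av => a ha; ring.
Qed.

End Densities.

Section Connect.
Context {R : realType}.
Variables (k l : nat).
Hypotheses (hl : (0 < l)%N) (hlk : (2 * l < k)%N).

Definition csize : nat := l + ((k - 2 * l) + (k - 2 * l)).

(* A connector is c = u ++ m1 ++ m2 with edges s u m1 and t u m2. *)
Definition conn (V : finType) (H : kgraph k V) (s t c : seq V) : bool :=
  ed H (s ++ take l c ++ take (k - 2 * l) (drop l c)) &&
  ed H (t ++ take l c ++ drop (k - 2 * l) (drop l c)).

(** The shadow bound for the link of [s] gives a shadow of density at least about theta^(l/(k-l)).
    This is where the threshold (1/2)^((k-l)/l) originates; the strict inequality pays for the error
    2^(k-l) [beta]. *)
Lemma shadow_half (theta : R) : 0 < theta -> theta <= 1 ->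
  (1 / 2) ^+ (k - l) < theta ^+ l ->
  exists beta : R, [/\ 0 < beta, beta <= 1 / 2 &
    forall (V : finType) (H : kgraph k V), (0 < #|V|)%N -> dense H l theta ->
    forall s, uniq s -> size s = l ->
    1 / 2 + beta <= Av l (fun u =>
      (beta <= Av (k - 2 * l) (fun m => (ed H (s ++ u ++ m))%:R))%R%:R)].
Proof.
move=> t0 t1 ht.
have c0 : 0 < (2 ^ (k - l))%:R :> R by rewrite ltr0n expn_gt0.
have [beta [b0 b1 b2 b3]] := choose_beta t0 t1 c0 ht.
exists beta; split => // V H hV hd s us hs.
have hn : (k - l = l.-1.+1 + (k - 2 * l))%N by lia.
have := @shadow_density R V l.-1 (k - 2 * l) (fun x => ed H (s ++ x)) beta hV.
rewrite -hn prednK // => h.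
have hA := hd s us hs; set A := Av _ _ in h hA.
set P := Av l _ in h *.
have {}h : (theta - (2 ^ (k - l))%:R * beta) ^+ l <= P ^+ (k - l).
  apply: le_trans (h _ _ _); last 2 first.
  - exact: ltW.
  - exact: le_trans hA.
  - by rewrite lerXn2r ?nnegrE ?subr_ge0 ?(le_trans b2) // lerD2r.
  - by move=> x y hxy; apply: perm_ed; rewrite perm_cat2l.
have P0 : 0 <= P by apply: Av_ge0 => u _; exact: ler0n.
rewrite leNgt; apply/negP => hP.
have kl : (0 < k - l)%N by lia.
have : P ^+ (k - l) < (1 / 2 + beta) ^+ (k - l).
  by rewrite ltrXn2r // -lt0n.
by rewrite ltNge (le_trans b3 h).
Qed.

(** Two sets of l-lists of density 1/2 + beta share a set of density 2 beta. Each common [u] extends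
    to an edge with [s] and independently to one with [t], with density [beta] each. *)
Lemma conn_density (theta : R) : 0 < theta -> theta <= 1 ->
  (1 / 2) ^+ (k - l) < theta ^+ l ->
  exists2 beta : R, 0 < beta &
    forall (V : finType) (H : kgraph k V), (0 < #|V|)%N -> dense H l theta ->
    forall s t, uniq s -> size s = l -> uniq t -> size t = l ->
    beta <= Av csize (fun c => (conn H s t c)%:R).
Proof.
move=> t0 t1 /(shadow_half t0 t1)[beta [b0 b1 hb]].
exists (2 * beta * beta ^+ 2) => [|V H hV hd s t us hs ut ht].
  by rewrite !mulr_gt0 // exprn_gt0.
have hs1 := hb V H hV hd s us hs; have ht1 := hb V H hV hd t ut ht.
pose Ds u := Av (k - 2 * l) (fun m => (ed H (s ++ u ++ m))%:R) : R.
pose Dt u := Av (k - 2 * l) (fun m => (ed H (t ++ u ++ m))%:R) : R.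
have -> : Av csize (fun c => (conn H s t c)%:R) = Av l (fun u => Ds u * Dt u) :> R.
  rewrite Av_cat; apply: eq_Av => u hu; rewrite Av_cat /Ds -AvZr.
  apply: eq_Av => m hm; rewrite -AvZ; apply: eq_Av => m' hm'.
  by rewrite /conn take_size_cat // drop_size_cat // take_size_cat // drop_size_cat // -mulnb natrM.
have h2 : 2 * beta <= Av l (fun u => (beta <= Ds u)%R%:R * (beta <= Dt u)%R%:R).
  apply: le_trans (_ : _ <= Av l (fun u => (beta <= Ds u)%R%:R + (beta <= Dt u)%R%:R - 1)) _.
    rewrite AvB AvD Av_const //; rewrite /Ds /Dt; lra.
  by apply: ler_Av => u _; case: (beta <= Ds u); case: (beta <= Dt u); rewrite /=; lra.
rewrite mulrC; apply: le_trans (_ : _ <= beta ^+ 2 * Av l (fun u => (beta <= Ds u)%R%:R * (beta <= Dt u)%R%:R)) _.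
  by rewrite ler_wpM2l // exprn_ge0 // ltW.
rewrite -AvZ; apply: ler_Av => u hu.
have Ds0 : 0 <= Ds u by exact: Av_bool_ge0.
have Dt0 : 0 <= Dt u by exact: Av_bool_ge0.
by case: (leP beta (Ds u)) => h1; case: (leP beta (Dt u)) => h3; rewrite /= ?mulr0 ?mul0r ?mulr0 ?mulr_ge0 // !mulr1; nra.
Qed.

(** An edge of a gadget consists of a pair, of l - 1 vertices common to all three edges, and of this
    many further ones. *)
Definition wsize : nat := (k - l).-1.

Definition gsize : nat := l.-1 + (2 + (wsize + wsize)).

(* For p = [x; y] and q = [a; b], the l-path on q, g, X, Y and y uses the edges
   [a; b] g X and [a; y] g Y, which meet in a and g; the one with x in place of
   y uses [x; b] g Y, which meets [a; b] g X in b and g. *)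
Definition gadget (V : finType) (H : kgraph k V) (p q g Y X : seq V) : bool :=
  [&& ed H (take 1 q ++ drop 1 p ++ g ++ Y), ed H (take 1 p ++ drop 1 q ++ g ++ Y) &
      ed H (q ++ g ++ X)].

Definition gdens (V : finType) (H : kgraph k V) (p : seq V) : R :=
  Av l.-1 (fun g => Av 2 (fun q => Av wsize (fun Y => Av wsize (fun X =>
    (gadget H p q g Y X)%:R)))).

(** Otherwise the bad pairs forming an edge with a common [z] have average density at least [d],
    hence span four-cycles of density d^4. Three sides of such a cycle besides [p] are edges of a
    gadget with X = Y; one more Cauchy-Schwarz makes X independent of Y and gives bad pairs gadgets
    of density d^8, twice the bound [beta] that defines badness. *)
Lemma gadget_density (gamma theta : R) : 0 < gamma -> 0 < theta ->
  exists2 beta : R, 0 < beta &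
    exists n0 : nat, forall (V : finType) (H : kgraph k V), (n0 <= #|V|)%N ->
      (forall p, size p = 2 -> uniq p -> theta <= Av (k - 2) (fun z => (ed H (p ++ z))%:R)) ->
      Av 2 (fun p : seq V => (gdens H p < beta)%R%:R) <= gamma.
Proof.
move=> g0 t0; pose d := gamma / 2 * theta.
have d0 : 0 < d by rewrite mulr_gt0 // divr_gt0.
have d8 : 0 < d ^+ 8 by rewrite exprn_gt0.
exists (d ^+ 8 / 2); first by rewrite divr_gt0.
exists (Num.truncn (8 / gamma)).+1 => V H hn hp.
have hV : (0 < #|V|)%N by apply: leq_trans hn.
have hn' : 4 / #|V|%:R <= gamma / 2.
  have : 8 / gamma < #|V|%:R :> R.
    by apply: lt_le_trans (truncnS_gt _) _; rewrite ler_nat.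
  rewrite ltr_pdivrMr // => h; rewrite ler_pdivrMr ?ltr0n //; lra.
rewrite leNgt; apply/negP => hbad; set beta := d ^+ 8 / 2 in hbad *.
pose B p := gdens H p < beta.
pose e z p : bool := [&& B p, uniq p & ed H (p ++ z)].
have hk2 : (k - 2 = l.-1 + wsize)%N by rewrite /wsize; lia.
have hd : d <= Av (k - 2) (fun z => Av 2 (fun p => (e z p)%:R)).
  rewrite Av_swap.
  apply: le_trans (_ : _ <= Av 2 (fun p : seq V => (B p && uniq p)%:R * theta)) _.
    rewrite AvZr /d ler_wpM2r ?(ltW t0) //.
    have h1 : Av 2 (fun p : seq V => (~~ uniq p)%:R) <= gamma / 2.
      by apply: le_trans (Av_dup _ _) _ => //; rewrite (_ : 2%:R ^+ 2 = 4) //; ring.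
    have : Av 2 (fun p : seq V => (B p)%:R) <=
       Av 2 (fun p : seq V => (B p && uniq p)%:R + (~~ uniq p)%:R) :> R.
      by apply: ler_Av => p _; case: (B p); case: (uniq p); rewrite /=; lra.
    rewrite AvD; rewrite /B; lra.
  apply: ler_Av => p sp; rewrite /e; case: (B p); case: (boolP (uniq p)) => up /=; rewrite ?mul0r ?mul1r ?Av0 //.
  exact: hp.
pose f z p : R := (e z p)%:R.
pose C4 z p q := f z (take 1 p ++ drop 1 p) * f z (take 1 q ++ drop 1 p)
     * f z (take 1 p ++ drop 1 q) * f z (take 1 q ++ drop 1 q).
(* The four-cycle bound holds for each [z]; two uses of Cauchy-Schwarz move the fourth power outside
   the average over [z]. *)
have hC : d ^+ 4 <= Av (k - 2) (fun z => Av 2 (fun p => Av 2 (fun q => C4 z p q))).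
  apply: le_trans (_ : _ <= Av (k - 2) (fun z => (Av 2 (f z)) ^+ 4)) _; last first.
    by apply: ler_Av => z _; exact: Av_C4.
  have -> : 4%N = (2 * 2)%N by [].
  under eq_Av do rewrite exprM.
  apply: le_trans (Av_CS _ _ hV); rewrite exprM lerXn2r ?nnegrE ?sqr_ge0 //.
    by apply: Av_ge0 => z _; exact: sqr_ge0.
  apply: le_trans (Av_CS _ _ hV); rewrite lerXn2r ?nnegrE ?(ltW d0) //.
  by apply: Av_ge0 => z _; exact: Av_bool_ge0.
pose D (g q : seq V) : R := Av wsize (fun X => (ed H (q ++ g ++ X))%:R).
pose C g q : R := Av wsize (fun Y => Av 2 (fun p =>
   [&& B p, ed H (take 1 q ++ drop 1 p ++ g ++ Y), ed H (take 1 p ++ drop 1 q ++ g ++ Y) & ed H (q ++ g ++ Y)]%:R)).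
have hC1 : d ^+ 4 <= Av l.-1 (fun g => Av 2 (fun q => C g q)).
  apply: le_trans hC _; rewrite hk2 Av_cat; apply: ler_Av => g hg.
  under eq_Av do rewrite Av_swap.
  rewrite Av_swap; apply: ler_Av => q hq; apply: ler_Av => Y hY; apply: ler_Av => p hp2.
  rewrite /C4 /f -!natrM !mulnb; apply: lebR.
  rewrite /e !cat_take_drop -!catA => /andP[/andP[/andP[/and3P[-> _ _] /and3P[_ _ ->]] /and3P[_ _ ->]]].
  by case/and3P.
(* Each configuration counted by [C] includes an edge counted by [D]. Hence C^2 <= C D, and in the
   product the lists X and Y are drawn independently. *)
have hCD g q : C g q <= D g q.
  apply: ler_Av => Y _; apply: Av_le => // p _.
  by case: (ed H (q ++ g ++ Y)); rewrite ?andbT ?andbF //= lern1 leq_b1.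
have C0 g q : 0 <= C g q.
  by apply: Av_ge0 => Y _; exact: Av_bool_ge0.
have h8 : d ^+ 8 <= Av l.-1 (fun g => Av 2 (fun q => C g q * D g q)).
  have -> : 8%N = (4 * 2)%N by [].
  rewrite exprM; apply: le_trans (_ : _ <= (Av l.-1 (fun g => Av 2 (fun q => C g q))) ^+ 2) _.
    by rewrite lerXn2r ?nnegrE ?exprn_ge0 ?(ltW d0) // (le_trans _ hC1) // exprn_ge0 // ltW.
  apply: le_trans (Av_CS2 _ _ _ hV) _.
  apply: ler_Av => g _; apply: ler_Av => q _.
  by rewrite expr2 ler_wpM2l.
have e8 : Av l.-1 (fun g => Av 2 (fun q => C g q * D g q)) <=
   Av 2 (fun p => (B p)%:R * gdens H p).
  rewrite /gdens; under [leRHS]eq_Av do rewrite -AvZ.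
  rewrite [leRHS]Av_swap; apply: ler_Av => g _.
  under [leRHS]eq_Av do rewrite -AvZ.
  rewrite [leRHS]Av_swap; apply: ler_Av => q _.
  under [leRHS]eq_Av do rewrite -AvZ.
  rewrite [leRHS]Av_swap /C -AvZr; apply: ler_Av => Y _.
  rewrite -AvZr; apply: ler_Av => p _.
  rewrite /D -!AvZ; apply: ler_Av => X _.
  rewrite -!natrM !mulnb; apply: lebR => /andP[/and4P[-> h1 h2 _] h3].
  by rewrite /gadget h1 h2 h3.
have : Av 2 (fun p => (B p)%:R * gdens H p) <= beta.
  apply: Av_le => // p _; rewrite /B; case: (ltP (gdens H p) beta) => h; rewrite /= ?mul1r ?mul0r ?(ltW h) //.
  by rewrite divr_ge0 // ltW.
by move=> h9; have := le_trans h8 (le_trans e8 h9); rewrite /beta; lra.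
Qed.

End Connect.

(** * Absorbers *)

Section Absorber.
Context {R : realType}.
Variables (k l : nat).
Hypotheses (hl : (0 < l)%N) (hlk : (2 * l < k)%N).
Variables (V : finType) (H : kgraph k V).
Notation csize := (csize k l).
Notation gsize := (gsize k l).
Notation wsize := (wsize k l).

Definition gad (p Q : seq V) : bool :=
  let g := take l.-1 Q in let Q1 := drop l.-1 Q in
  let q := take 2 Q1 in let Q2 := drop 2 Q1 in
  gadget H p q g (take wsize Q2) (drop wsize Q2).

Lemma Av_gad p : Av gsize (fun Q => (gad p Q)%:R) = gdens l H p :> R.
Proof.
rewrite /gdens /gsize Av_cat; apply: eq_Av => g hg; rewrite Av_cat; apply: eq_Av => q hq.
rewrite Av_cat; apply: eq_Av => Y hY; apply: eq_Av => X hX.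
by rewrite /gad take_size_cat // drop_size_cat // take_size_cat // drop_size_cat // take_size_cat // drop_size_cat.
Qed.

Fixpoint gads (z c Q : seq V) : bool :=
  match z, c with
  | x :: z', y :: c' => gad [:: x; y] (take gsize Q) && gads z' c' (drop gsize Q)
  | _, _ => true
  end.

Definition absorber (W A : seq V) : bool :=
  let s := take l A in let A1 := drop l A in
  let m := take (k - 2 * l) A1 in let A2 := drop (k - 2 * l) A1 in
  let t := take l A2 in let A3 := drop l A2 in
  let c := take csize A3 in let Q := drop csize A3 in
  [&& ed H (s ++ m ++ t), conn l H s t c & gads (m ++ W) c Q].

Definition asize : nat := l + ((k - 2 * l) + (l + (csize + csize * gsize))).

Variables (bc br gamma theta : R).
Hypotheses (hV : (0 < #|V|)%N) (bc0 : 0 <= bc) (br0 : 0 <= br) (gamma0 : 0 <= gamma).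
Hypothesis hconn : forall s t, uniq s -> size s = l -> uniq t -> size t = l ->
    bc <= Av csize (fun c => (conn l H s t c)%:R).
Hypothesis hed : theta <= Av k (fun s => (ed H s)%:R).

Definition badpair (x y : V) : bool := gdens l H [:: x; y] < br.
Definition badness (x : V) : R := Av 1 (fun y => (has (badpair x) y)%:R).

Lemma Av_badness : Av 2 (fun p : seq V => (gdens l H p < br)%R%:R) =
  Av 1 (fun x => \sum_(v <- x) badness v) :> R.
Proof.
rewrite -[2%N]/(1 + 1)%N Av_cat; apply: eq_Av => -[//|x []] // _.
by rewrite big_seq1; apply: eq_Av => -[//|y []] //= _; rewrite orbF.
Qed.

Lemma Av_sum_seq r (F : V -> R) :
  Av r (fun x => \sum_(v <- x) F v) = r%:R * Av 1 (fun x => \sum_(v <- x) F v).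
Proof.
elim: r => [|r IH]; first by rewrite AvE big_nil mul0r.
rewrite -[r.+1]add1n Av_cat.
under eq_Av do under eq_Av do rewrite big_cat /=.
under eq_Av do rewrite AvD Av_const //.
by rewrite AvD IH Av_const // natrD mulrDl mul1r.
Qed.

Lemma Av_bad z : Av (size z) (fun c => (~~ all2 (fun x y => ~~ badpair x y) z c)%:R)
  <= \sum_(x <- z) badness x :> R.
Proof.
elim: z => [|x z IH]; first by rewrite AvE big_nil.
rewrite big_cons /= -add1n Av_cat.
apply: le_trans (_ : _ <= Av 1 (fun y => Av (size z) (fun c =>
   (has (badpair x) y)%:R + (~~ all2 (fun x y => ~~ badpair x y) z c)%:R))) _.
  apply: ler_Av => -[//|y []] // _; apply: ler_Av => c hc /=.
  by rewrite negb_and negbK orbF; case: badpair; case: all2; rewrite /=; lra.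
under eq_Av do rewrite AvD Av_const //.
by rewrite AvD Av_const // lerD2l.
Qed.

Lemma Av_gads z c : size z = size c ->
  all2 (fun x y => ~~ badpair x y) z c ->
  br ^+ size z <= Av (size z * gsize) (fun Q => (gads z c Q)%:R).
Proof.
elim: z c => [|x z IH] [|y c] //=; first by rewrite AvE.
move=> [hs] /andP[h1 h2]; rewrite mulSn Av_cat exprS.
apply: le_trans (_ : _ <= gdens l H [:: x; y] * br ^+ size z) _.
  by apply: ler_wpM2r; rewrite ?exprn_ge0 // leNgt.
rewrite -Av_gad -AvZr; apply: ler_Av => Q hQ.
apply: le_trans (_ : _ <= (gad [:: x; y] Q)%:R * Av (size z * gsize) (fun Q => (gads z c Q)%:R)) _.
  by apply: ler_wpM2l => //; exact: IH.
rewrite -AvZ; apply: ler_Av => Q' _.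
by rewrite take_size_cat // drop_size_cat // -natrM mulnb.
Qed.

(** An edge s m t and a connector from s to t have joint density theta * bc. At most csize * gamma
    of it has a bad pair: the entries of [W] have badness at most [gamma] individually, those of m
    on average. For good pairs the gadgets are independent, with density [br] each. *)
Lemma absorber_density (W : seq V) : size W = (k - l)%N ->
  (forall w, w \in W -> badness w <= gamma) ->
  Av 2 (fun p : seq V => (gdens l H p < br)%R%:R) <= gamma ->
  (theta * bc - csize%:R * gamma) * br ^+ csize <=
  Av asize (fun A => (absorber W A)%:R).
Proof.
move=> hW hbad h2.
have hcs : csize = ((k - 2 * l) + (k - l))%N by rewrite /csize; lia.
pose E s m t c := [&& ed H (s ++ m ++ t), conn l H s t c & all2 (fun x y => ~~ badpair x y) (m ++ W) c].
pose E4 : R := Av l (fun s => Av (k - 2 * l) (fun m => Av l (fun t => Av csize (fun c => (E s m t c)%:R)))).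
have hE : theta * bc - csize%:R * gamma <= E4.
  have h3 : theta * bc <= Av l (fun s => Av (k - 2 * l) (fun m => Av l (fun t =>
     Av csize (fun c => (ed H (s ++ m ++ t) && conn l H s t c)%:R)))).
    apply: le_trans (_ : _ <= Av k (fun s => (ed H s)%:R) * bc) _.
      by rewrite ler_wpM2r.
    have -> : Av k (fun s => (ed H s)%:R) = Av (l + ((k - 2 * l) + l)) (fun s => (ed H s)%:R) :> R.
      by congr (Av _ _); lia.
    rewrite Av_cat -AvZr.
    apply: ler_Av => s hs; rewrite Av_cat -AvZr; apply: ler_Av => m hm; rewrite -AvZr; apply: ler_Av => t ht.
    case: (boolP (ed H _)) => h /=; last by rewrite mul0r Av_ge0.
    have us : uniq (s ++ m ++ t) by apply: ed_uniq h; rewrite !size_cat; lia.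
    rewrite mul1r; apply: hconn => //; first by move: us; rewrite cat_uniq => /and3P[].
    by move: us; rewrite !cat_uniq => /and3P[_ _ /and3P[]].
  have h4 : Av l (fun s : seq V => Av (k - 2 * l) (fun m => Av l (fun t : seq V =>
     Av csize (fun c => (~~ all2 (fun x y => ~~ badpair x y) (m ++ W) c)%:R)))) <= csize%:R * gamma.
    apply: (Av_le hV) => s hs.
    apply: le_trans (_ : _ <= Av (k - 2 * l) (fun m => \sum_(x <- m ++ W) badness x)) _.
      apply: ler_Av => m hm; apply: Av_le => // t ht.
      have := Av_bad (m ++ W); rewrite (_ : size (m ++ W) = csize) //.
      by rewrite size_cat hm hW hcs.
    under eq_Av do rewrite big_cat /=.
    rewrite AvD Av_const // Av_sum_seq -Av_badness hcs natrD mulrDl.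
    apply: lerD; first by rewrite ler_wpM2l.
    rewrite -hW; elim: (W) hbad => [|w W' IH] hb; first by rewrite big_nil mul0r.
    rewrite big_cons /= -add1n natrD mulrDl mul1r; apply: lerD; first by rewrite hb ?mem_head.
    by apply: IH => x hx; rewrite hb // inE hx orbT.
  rewrite lerBlDr; apply: le_trans h3 _; apply: le_trans (lerD (lexx _) h4).
  rewrite /E4 -AvD; apply: ler_Av => s _; rewrite -AvD; apply: ler_Av => m _.
  rewrite -AvD; apply: ler_Av => t _; rewrite -AvD; apply: ler_Av => c _.
  by rewrite /E; case: ed; case: conn; case: all2; rewrite /=; lra.
apply: le_trans (_ : _ <= E4 * br ^+ csize) _.
  by rewrite ler_wpM2r // exprn_ge0.
rewrite /E4 /asize Av_cat -AvZr; apply: ler_Av => s hs.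
rewrite Av_cat -AvZr; apply: ler_Av => m hm.
rewrite Av_cat -AvZr; apply: ler_Av => t ht.
rewrite Av_cat -AvZr; apply: ler_Av => c hc.
case: (boolP (E s m t c)) => [/and3P[e1 e2 e3]|_]; last by rewrite mul0r Av_ge0.
have hz : size (m ++ W) = csize by rewrite size_cat hm hW hcs.
have hzc : size (m ++ W) = size c by rewrite hz hc.
have := Av_gads hzc e3; rewrite hz mul1r => h; apply: le_trans h _; apply: ler_Av => Q hQ; apply: lebR => hg.
rewrite /absorber; do 4 (rewrite take_size_cat // drop_size_cat //).
by rewrite e1 e2 hg.
Qed.

Lemma card_bad (g1 : R) : 0 < gamma ->
  Av 2 (fun p : seq V => (gdens l H p < br)%R%:R) <= gamma * g1 ->
  #|[set x | gamma < badness x]%R|%:R <= g1 * #|V|%:R.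
Proof.
move=> g0; rewrite Av_badness AvE.
under eq_bigr do rewrite AvE big_seq1.
rewrite ler_pdivrMr ?ltr0n // => h.
have : \sum_x (gamma < badness x)%R%:R * gamma <= \sum_x badness x.
  apply: ler_sum => x _; case: ltP => [h1|_]; first by rewrite mul1r ltW.
  by rewrite mul0r; apply: Av_ge0 => y _; exact: ler0n.
rewrite -mulr_suml sum_bool cardsE => h3.
rewrite -(ler_pM2l g0) mulrA; apply: le_trans h; apply: le_trans h3.
by rewrite mulrC.
Qed.

End Absorber.

(** * Exponentials outgrow polynomials *)

Lemma poly_exp2 (C a : nat) : exists h0, forall h, (h0 <= h)%N -> (a * h.+1 ^ C <= 2 ^ h)%N.
Proof.
elim: C a => [|C IH] a.
  by exists a => h ah; rewrite expn0 muln1 (leq_trans ah) // ltnW // ltn_expl.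
have [h0 hh] := IH (a * 2 ^ C.+1)%N; exists (2 * h0).*2 => h ah.
have hj : (h0 <= h./2)%N by lia.
have h1 : (h.+1 <= 2 * h./2.+1)%N by lia.
apply: leq_trans (_ : _ <= a * (2 * h./2.+1) ^ C.+1)%N _.
  by rewrite leq_mul2l leq_exp2r // h1 orbT.
rewrite expnMn [(h./2.+1 ^ C.+1)%N]expnSr !mulnA.
apply: leq_trans (_ : _ <= 2 ^ h./2 * 2 ^ h./2)%N _.
  by rewrite leq_mul ?hh // ltn_expl.
by rewrite -expnD leq_exp2l //; lia.
Qed.

Lemma poly_exp2_div (C K a : nat) : (0 < K)%N ->
  exists n0, forall n, (n0 <= n)%N -> (a * n ^ C <= 2 ^ (n %/ K))%N.
Proof.
move=> K0; have [h0 hh] := poly_exp2 C (a * K ^ C)%N.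
exists (h0 * K)%N => n hn.
apply: leq_trans (hh (n %/ K)%N _); last by rewrite leq_divRL.
rewrite -mulnA -expnMn leq_mul2l; apply/orP; right.
case: C hh => [//|C] _; rewrite leq_exp2r //.
by apply: ltnW; rewrite mulnC ltn_ceil.
Qed.

(** * Greedy selection of disjoint lists *)

Section Selection.
Context {R : realType}.

Lemma exp_small (x : R) : 0 < x -> x <= 1 -> exists p, (1 - x) ^+ p <= 1 / 4.
Proof.
move=> x0 x1.
have h p : (1 - x) ^+ p * (1 + p%:R * x) <= 1.
  elim: p => [|p IH]; first by rewrite expr0 mul0r addr0 mul1r.
  apply: le_trans IH; rewrite exprSr -mulrA ler_wpM2l ?exprn_ge0 ?subr_ge0 //.
  have h0 : 0 <= p%:R * (x * x) by rewrite !mulr_ge0 // ltW.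
  rewrite -[p.+1]addn1 natrD; nra.
exists (Num.truncn (3 / x)).+1; set p := _.+1.
have hp : 3 <= p%:R * x by rewrite -ler_pdivrMr // ltW // truncnS_gt.
have := h p; have : 0 <= (1 - x) ^+ p by rewrite exprn_ge0 // subr_ge0.
by set y := _ ^+ p; nra.
Qed.

Variables (V : finType) (m : nat) (I : finType) (A : I -> pred (seq V)) (Z : {set V}).
Variable (beta : R).
Hypotheses (hV : (0 < #|V|)%N) (b0 : 0 < beta) (b1 : beta <= 1).
Hypothesis hA : forall i, beta <= Av m (fun x => (A i x)%:R).

Definition valid (F : seq (seq V)) : bool :=
  [&& all (fun x => size x == m) F, uniq (flatten F) & ~~ has (mem Z) (flatten F)].

(* The factor 1/2 per hit makes the potential drop by a constant factor with
   each well-chosen list; a potential below 2^-h forces h hits for every i. *)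
Definition potential (F : seq (seq V)) : R := \sum_i (1 / 2) ^+ count (A i) F.

Lemma selection_step F : valid F ->
  m%:R ^+ 2 <= beta / 8 * #|V|%:R -> m%:R * #|Z|%:R <= beta / 4 * #|V|%:R ->
  m%:R ^+ 2 * (size F)%:R <= beta / 8 * #|V|%:R ->
  exists F', [/\ valid F', (size F' <= (size F).+1)%N & potential F' <= (1 - beta / 4) * potential F].
Proof.
move=> /and3P[v1 v2 v3] h1 h2 h3.
have n0 : 0 < #|V|%:R :> R by rewrite ltr0n.
pose U := Z :|: [set x in flatten F].
pose av x := uniq x && ~~ has (mem U) x.
pose F' x := if (size x == m) && av x then x :: F else F.
have vF' x : valid (F' x).
  rewrite /F'; case: ifP => [/andP[sx /andP[ux hx]]|_]; last by rewrite /valid v1 v2 v3.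
  rewrite /valid /= sx v1 cat_uniq ux v2 andbT has_cat negb_or v3 andbT /=.
  apply/andP; split.
    apply/hasPn => y hy; apply: contra hx => hyx; apply/hasP; exists y => //=.
    by rewrite !inE hy orbT.
  by rewrite andbT; apply: contra hx => /hasP[y hy hyZ]; apply/hasP; exists y => //=; rewrite in_setU; apply/orP; left.
have sF' x : (size (F' x) <= (size F).+1)%N by rewrite /F'; case: ifP.
have sfl : (size (flatten F) = m * size F)%N.
  elim: (F) v1 => [|y s IH] /=; first by rewrite muln0.
  by move=> /andP[/eqP hy hs]; rewrite size_cat hy IH // mulnS.
have hU : m%:R * #|U|%:R <= (beta / 4 + beta / 8) * #|V|%:R.
  apply: le_trans (_ : _ <= m%:R * (#|Z|%:R + (m * size F)%:R)) _.
    rewrite ler_wpM2l // -natrD ler_nat (leq_trans (leq_card_setU _ _)) // leq_add2l -sfl.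
    by rewrite cardsE card_size.
  by rewrite mulrDr [X in _ <= X]mulrDl natrM mulrA -expr2 lerD.
(* From [beta] one subtracts beta/4 for meeting [Z], beta/8 for meeting earlier lists and beta/8 for
   repetitions. *)
have hav i : beta / 2 <= Av m (fun x => (av x && A i x)%:R).
  have hh := Av_hit (R := R) m U hV; have hd := Av_dup (R := R) m hV.
  have : Av m (fun x => (A i x)%:R) <= Av m (fun x => (av x && A i x)%:R + ((has (mem U) x)%:R + (~~ uniq x)%:R)) :> R.
    apply: ler_Av => x _; rewrite /av; case: (A i x); case: uniq; case: has; rewrite /=; lra.
  rewrite !AvD => h; have := hA i.
  have {}hh : Av m (fun x => (has (mem U) x)%:R) <= beta / 4 + beta / 8.
    by apply: le_trans hh _; rewrite ler_pdivrMr.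
  have {}hd : Av m (fun x : seq V => (~~ uniq x)%:R) <= beta / 8.
    by apply: le_trans hd _; rewrite ler_pdivrMr.
  lra.
have hm : Av m (fun x => potential (F' x)) <= (1 - beta / 4) * potential F.
  rewrite Av_sum mulr_sumr; apply: ler_sum => i _.
  have e x : size x = m -> (1 / 2) ^+ count (A i) (F' x) =
      (1 / 2) ^+ count (A i) F * (1 - 1 / 2 * (av x && A i x)%:R) :> R.
    move=> sx; rewrite /F' sx eqxx /=; case: (av x) => /=; last by rewrite mulr0 subr0 mulr1.
    by case: (A i x); rewrite /= ?add1n ?exprS; field.
  rewrite (eq_Av e) AvZ mulrC ler_wpM2r ?exprn_ge0 ?divr_ge0 //.
  rewrite AvB Av_const // AvZ; have := hav i; lra.
have [x sx hx] : exists2 x, size x = m & - ((1 - beta / 4) * potential F) <= - potential (F' x).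
  by apply: Av_exists => //; rewrite AvN lerN2.
by exists (F' x); split => //; rewrite -lerN2.
Qed.

Lemma selection_iter N :
  m%:R ^+ 2 <= beta / 8 * #|V|%:R -> m%:R * #|Z|%:R <= beta / 4 * #|V|%:R ->
  m%:R ^+ 2 * N%:R <= beta / 8 * #|V|%:R ->
  exists F, [/\ valid F, (size F <= N)%N & potential F <= (1 - beta / 4) ^+ N * #|I|%:R].
Proof.
move=> h1 h2; elim: N => [|N IH] h3.
  exists [::]; split => //; rewrite expr0 mul1r /potential.
  under eq_bigr do rewrite expr0.
  by rewrite sumr_const.
have h3' n : (n <= N)%N -> m%:R ^+ 2 * n%:R <= beta / 8 * #|V|%:R.
  by move=> hn; apply: le_trans h3; rewrite ler_wpM2l ?exprn_ge0 // ler_nat ltnW.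
have [F [vF sF pF]] := IH (h3' N (leqnn N)).
have [F' [vF' sF' pF']] := selection_step vF h1 h2 (h3' _ sF).
exists F'; split => //; first exact: leq_trans sF' _.
have c0 : 0 <= 1 - beta / 4 by rewrite subr_ge0 ler_pdivrMr // mul1r (le_trans b1) // ler1n.
by apply: le_trans pF' _; rewrite exprS -mulrA ler_wpM2l.
Qed.

End Selection.

(** With h = n/K, after p h steps the potential is at most 4^-h n^C, which is at most 2^-h for large
    n. An index with fewer than h hits would exceed this by its own term. Since [K] is arbitrary
    above [K0], the family can be made as small a fraction of n as desired. *)
Lemma selection (R : realType) (beta : R) (m C : nat) : 0 < beta -> beta <= 1 ->
  exists p K0 : nat, forall K, (K0 <= K)%N -> exists n0 : nat,
  forall (V : finType) (I : finType) (A : I -> pred (seq V)) (Z : {set V}),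
  (n0 <= #|V|)%N -> (#|I| <= #|V| ^ C)%N -> m%:R * #|Z|%:R <= beta / 4 * #|V|%:R ->
  (forall i, beta <= Av m (fun x => (A i x)%:R)) ->
  exists F : seq (seq V), [/\ valid m Z F, (size F <= p * (#|V| %/ K))%N &
    forall i, (#|V| %/ K <= count (A i) F)%N].
Proof.
move=> b0 b1.
have x0 : 0 < beta / 4 by rewrite divr_gt0.
have x1 : beta / 4 <= 1 by lra.
have [p hp] := exp_small x0 x1.
(* Any total of at least [c] makes m^2 at most beta/8 of it; [K] above p c then keeps the chosen
   lists below that share of the vertices. *)
pose c := (Num.truncn (8 * m%:R ^+ 2 / beta)).+1.
have hc (a : R) : c%:R <= a -> m%:R ^+ 2 <= beta / 8 * a.
  move=> ha; have : 8 * m%:R ^+ 2 / beta < a.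
    by apply: lt_le_trans ha; exact: truncnS_gt.
  rewrite ltr_pdivrMr //; lra.
exists p, (p * c).+1 => K hK.
have K0 : (0 < K)%N by lia.
have [n1 hn1] := poly_exp2_div C 1 K0.
exists (maxn n1 c.+1) => V I A Z; rewrite geq_max => /andP[hn hnc] hI hZ hA.
have hV : (0 < #|V|)%N by apply: leq_trans hnc.
set h := (#|V| %/ K)%N.
have h1 : m%:R ^+ 2 <= beta / 8 * #|V|%:R by apply: hc; rewrite ler_nat ltnW.
have h3 : m%:R ^+ 2 * (p * h)%:R <= beta / 8 * #|V|%:R.
  have : (c * (p * h) <= #|V|)%N.
    apply: leq_trans (leq_divM #|V| K); rewrite -/h mulnA mulnC [(c * p)%N]mulnC leq_mul2l.
    by rewrite (leq_trans (leqnSn _) hK) orbT.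
  rewrite -(ler_nat R) natrM => hh.
  have := hc _ (lexx c%:R) => hm.
  apply: le_trans (_ : _ <= beta / 8 * c%:R * (p * h)%:R) _; first by rewrite ler_wpM2r.
  by rewrite -mulrA ler_wpM2l // divr_ge0 // ltW.
have [F [vF sF pF]] := selection_iter hV b1 hA h1 hZ h3.
exists F; split => // i.
rewrite leqNgt; apply/negP => hlt.
have e1 : (1 / 2) ^+ count (A i) F <= potential A F :> R.
  rewrite /potential (bigD1 i) //=; apply: ler_wpDr => //.
  by apply: sumr_ge0 => j _; apply: exprn_ge0; rewrite divr_ge0.
have e2 : potential A F <= (1 / 2) ^+ h :> R.
  apply: le_trans pF _; rewrite exprM.
  apply: le_trans (_ : _ <= (1 / 4) ^+ h * (2 ^ h)%:R) _.
    have q0 : 0 <= (1 - beta / 4) ^+ p by rewrite exprn_ge0 // subr_ge0.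
    apply: ler_pM.
    - exact: exprn_ge0.
    - exact: ler0n.
    - by rewrite lerXn2r // ?nnegrE // divr_ge0.
    - by rewrite ler_nat (leq_trans hI) // -[X in (X <= _)%N]mul1n hn1.
  by rewrite natrX -exprMn (_ : 1 / 4 * 2%:R = 1 / 2) //; field.
have e3 : (1 / 2) ^+ h < (1 / 2) ^+ count (A i) F :> R.
  rewrite ltr_iXn2l //; lra.
by have := lt_le_trans e3 (le_trans e1 e2); rewrite ltxx.
Qed.

(** * l-paths and Hamilton l-cycles *)

Section Paths.
Variables (k l : nat) (V : finType) (H : kgraph k V).
Hypotheses (hl : (0 < l)%N) (hlk : (2 * l < k)%N).

(* lpath S X T: the vertex set X carries an l-path that starts with the l-set S
   and ends with the l-set T. *)
Inductive lpath : {set V} -> {set V} -> {set V} -> Prop :=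
| lpath_edge (S X T : {set V}) : X \in edges H -> S \subset X -> T \subset X ->
    [disjoint S & T] -> #|S| = l -> #|T| = l -> lpath S X T
| lpath_cat (S X T X' U : {set V}) : lpath S X T -> lpath T X' U -> X :&: X' = T ->
    lpath S (X :|: X') U.

Lemma lpath_facts S X T : lpath S X T ->
  [/\ S \subset X, T \subset X, [disjoint S & T], #|S| = l & #|T| = l].
Proof.
elim=> {S X T} [S X T hX hS hT hd cS cT|S X T X' U _ [h1 h2 h3 h4 h5] _ [g1 g2 g3 g4 g5] hI]; first by split.
split => //; first by rewrite subsetU // h1.
  by rewrite subsetU // g2 orbT.
rewrite -setI_eq0; apply/eqP/setP => x; rewrite !inE; apply/negP => /andP[hS hU].
have : x \in T by rewrite -hI inE (subsetP h1 _ hS) (subsetP g2 _ hU).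
by apply/negP; have := disjointFr h3 hS => ->.
Qed.

(** The residue modulo k - l ensures that the set left for absorption has a size divisible by k -
    l. *)
Lemma lpath_card S X T : lpath S X T -> exists e, #|X| = (e.+1 * (k - l) + l)%N.
Proof.
elim=> {S X T} [S X T hX hS hT hd cS cT|S X T X' U hp [e he] hp' [e' he'] hI].
  exists 0%N; rewrite mul1n subnK; [exact: edges_uniform hX|lia].
exists (e + e').+1; rewrite cardsU hI.
have [_ _ _ _ ->] := lpath_facts hp.
rewrite he he'; set r := (k - l)%N; rewrite !mulSn mulnDl; set a := (e * r)%N; set b := (e' * r)%N; lia.
Qed.

Definition block_seq (p : {set V} * {set V}) : seq V := enum p.1 ++ enum p.2.

Definition vseq (B : seq ({set V} * {set V})) : seq V := flatten (map block_seq B).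

(** A block is an l-set, shared with the preceding edge, and the k - 2l vertices after it. An edge
    is a block together with the l-set of the next one; [T] follows the last block. *)
Fixpoint chain (B : seq ({set V} * {set V})) (T : {set V}) : bool :=
  if B is p :: B' then
    (p.1 :|: p.2 :|: (if B' is q :: _ then q.1 else T) \in edges H) && chain B' T
  else true.

Definition wf_block (p : {set V} * {set V}) : bool :=
  (#|p.1| == l) && (#|p.2| == k - 2 * l)%N.

Lemma chain_cat B B' q T : chain B q.1 -> chain (q :: B') T -> chain (B ++ q :: B') T.
Proof.
elim: B => [//|p B IH] /= /andP[h1 h2] h3; rewrite (IH h2 h3) andbT.
by case: B h1 {IH h2}.
Qed.

(** The end [T] is left out of the vertex list, because it opens the first block of whatever
    continues the path. Concatenation of paths thereby becomes concatenation of lists. *)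
Lemma lpath_chain S X T : lpath S X T ->
  exists p B, [/\ p.1 = S, chain (p :: B) T, all wf_block (p :: B),
    uniq (vseq (p :: B)) & [set x in vseq (p :: B)] = X :\: T].
Proof.
elim=> {S X T} [S X T hX hS hT hd cS cT|S X T X' U hp [p [B [h1 h2 h3 h4 h5]]] hp' [q [B' [g1 g2 g3 g4 g5]]] hI].
  have hST : S :|: T \subset X by rewrite subUset hS hT.
  exists (S, X :\: (S :|: T)), [::]; split => //=.
  - rewrite andbT; have -> // : S :|: X :\: (S :|: T) :|: T = X.
    apply/setP => x; rewrite !inE.
    have := subsetP hST x; rewrite inE; case: (x \in S); case: (x \in T) => //=; by rewrite ?orbF // => ->.
  - rewrite andbT /wf_block /= cS eqxx /= cardsD (setIidPr hST) cardsU.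
    move: hd; rewrite -setI_eq0 => /eqP ->; rewrite cards0 cS cT (edges_uniform hX).
    by apply/eqP; lia.
  - rewrite /vseq /= cats0 cat_uniq !enum_uniq /= andbT.
    by apply/hasPn => x; rewrite !mem_enum !inE negb_or => /andP[/andP[]].
  - apply/setP => x; rewrite /vseq /= cats0 !inE mem_cat !mem_enum !inE.
    case hxS: (x \in S) => /=; last by case: (x \in T).
    by rewrite (subsetP hS _ hxS) (disjointFr hd hxS).
have [f1 f2 f3 f4 f5] := lpath_facts hp.
have [e1 e2 e3 e4 e5] := lpath_facts hp'.
have hUX x : x \in U -> x \notin X.
  move=> hU; apply/negP => hx.
  have : x \in T by rewrite -hI inE hx (subsetP e2 _ hU).
  by rewrite (disjointFl e3 hU).
have vcat : vseq (p :: B ++ q :: B') = vseq (p :: B) ++ vseq (q :: B').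
  by rewrite -cat_cons /vseq map_cat flatten_cat.
exists p, (B ++ q :: B'); split => //.
- by rewrite -cat_cons; apply: chain_cat g2; rewrite g1.
- by rewrite -cat_cons all_cat h3 g3.
- rewrite vcat cat_uniq h4 g4 andbT /=.
  apply/hasPn => x hx; apply/negP => hx'.
  have : x \in X :\: T by rewrite -h5 inE.
  have : x \in X' :\: U by rewrite -g5 inE.
  rewrite !inE => /andP[_ hX'] /andP[hT hX].
  by move: hT; rewrite -hI inE hX hX'.
- rewrite vcat; apply/setP => x.
  have -> : x \in [set y in vseq (p :: B) ++ vseq (q :: B')] = (x \in X :\: T) || (x \in X' :\: U).
    by rewrite -h5 -g5 !inE mem_cat.
  rewrite !inE; case hxU: (x \in U) => /=.
    by rewrite (negbTE (hUX _ hxU)) andbF.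
  case hxT : (x \in T) => //=.
  by rewrite (subsetP e1 _ hxT) orbT.
Qed.

Let d0 : {set V} * {set V} := (set0, set0).

Lemma chain_nth B T i : chain B T -> (i < size B)%N ->
  (nth d0 B i).1 :|: (nth d0 B i).2 :|: (if (i.+1 < size B)%N then (nth d0 B i.+1).1 else T) \in edges H.
Proof.
elim: B i => [//|p B IH] [|i] /= /andP[h1 h2] hi; last exact: IH.
by case: B h1 {IH h2 hi}.
Qed.

Lemma size_vseq B : all wf_block B -> size (vseq B) = (size B * (k - l))%N.
Proof.
elim: B => [//|p B IH] /= /andP[/andP[/eqP h1 /eqP h2] hB].
rewrite /vseq /= size_cat -/(vseq B) IH // /block_seq size_cat -!cardE h1 h2; lia.
Qed.

Lemma rot_vseq B i : all wf_block B -> (i <= size B)%N ->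
  rot (i * (k - l)) (vseq B) = vseq (rot i B).
Proof.
move=> hB hi; rewrite -{1}(cat_take_drop i B) /vseq map_cat flatten_cat.
have : all wf_block (take i B) by move: hB; rewrite -{1}(cat_take_drop i B) all_cat => /andP[].
move/size_vseq; rewrite size_takel // => <-.
by rewrite rot_size_cat /rot map_cat flatten_cat.
Qed.

(** Windows start at the multiples of k - l and span a block and the l-set of the next. Consecutive
    windows involve three blocks, which must be distinct for their intersection to be exactly the
    middle l-set. *)
Lemma chain_hamilton p B : chain (p :: B) p.1 -> all wf_block (p :: B) ->
  uniq (vseq (p :: B)) -> (forall x, x \in vseq (p :: B)) -> (2 < size (p :: B))%N ->
  has_hamilton_cycle l H.
Proof.
set C := p :: B => hC hwf hu hall h3; set m := size C in h3.
set r := (k - l)%N; set s := vseq C.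
have r0 : (0 < r)%N by rewrite /r; lia.
have kr : (k < 2 * r)%N by rewrite /r; lia.
(* Rotating the cycle to block i reduces the claims about windows to the first three blocks of a
   list, without wrapping around. *)
have hrot i : (i < m)%N -> exists rest,
  rot i C = nth d0 C i :: nth d0 C (i.+1 %% m) :: nth d0 C (i.+2 %% m) :: rest.
  move=> hi; have sr : size (rot i C) = m by rewrite size_rot.
  have hn j : (j < m)%N -> nth d0 (rot i C) j = nth d0 C ((i + j) %% m).
    move=> hj; rewrite /rot nth_cat size_drop nth_drop -/m.
    case: ltnP => h; first by rewrite modn_small //; lia.
    rewrite nth_take; last by lia.
    have -> : (i + j = (j - (m - i)) + m)%N by lia.
    by rewrite modnDr modn_small //; lia.
  have n0 := hn 0%N (ltn_trans (isT : (0 < 2)%N) h3).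
  have n1 := hn 1%N (ltn_trans (isT : (1 < 2)%N) h3).
  have n2 := hn 2%N h3.
  case: (rot i C) sr n0 n1 n2 => [|a [|b [|c rest]]] /= sr; rewrite -?sr in h3 *; try by lia.
  rewrite addn0 addn1 addn2 => n0 n1 n2.
  by exists rest; rewrite n0 n1 n2 sr (modn_small hi).
have hsz i : (i < m)%N -> wf_block (nth d0 C i).
  by move=> hi; move/(all_nthP d0): hwf; apply.
pose w i : {set V} := (nth d0 C i).1 :|: (nth d0 C i).2 :|: (nth d0 C (i.+1 %% m)).1.
have m0 : (0 < m)%N by lia.
have hw i : (i < m)%N -> window k s (i * r) = w i.
  move=> hi; rewrite /window /s rot_vseq //; last exact: ltnW.
  have [rest ->] := hrot i hi.
  have := hsz i hi; have := hsz (i.+1 %% m)%N (ltn_pmod _ m0).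
  rewrite /w /vseq /=; set P := nth d0 C i; set Q := nth d0 C _.
  move=> /andP[/eqP q1 /eqP q2] /andP[/eqP p1 /eqP p2].
  have -> : take k (block_seq P ++ block_seq Q ++ block_seq (nth d0 C (i.+2 %% m)) ++ flatten (map block_seq rest))
    = enum P.1 ++ enum P.2 ++ enum Q.1.
    set L := flatten _; set K := block_seq (nth _ _ _).
    have -> : block_seq P ++ block_seq Q ++ K ++ L =
      (enum P.1 ++ enum P.2 ++ enum Q.1) ++ (enum Q.2 ++ K ++ L) by rewrite /block_seq -!catA.
    by rewrite take_size_cat // !size_cat -!cardE q1 p1 p2; lia.
  by apply/setP => x; rewrite !inE !mem_cat !mem_enum orbA.
have hedge i : (i < m)%N -> w i \in edges H.
  move=> hi; have := chain_nth hC hi; rewrite -/m /w; case: ltnP => hi1.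
    by rewrite modn_small.
  have -> : (i.+1 = m)%N by lia.
  by rewrite modnn.
have hint i : (i < m)%N -> #|w i :&: w (i.+1 %% m)%N| = l.
  move=> hi; have [rest hr] := hrot i hi.
  have hur : uniq (vseq (rot i C)) by rewrite -rot_vseq ?(ltnW hi) // rot_uniq.
  have hm1 : (i.+1 %% m < m)%N by rewrite ltn_pmod.
  have := hsz _ hm1 => /andP[/eqP <- _]; congr #|pred_of_set _|.
  rewrite /w.
  have -> : ((i.+1 %% m).+1 %% m = i.+2 %% m)%N by rewrite -addn1 modnDml addn1.
  move: hur; rewrite hr /vseq /=.
  set P := nth d0 C i; set Q := nth d0 C (i.+1 %% m); set S := nth d0 C _.
  rewrite /block_seq -!catA => hur.
  have hd x : x \in P.1 :|: P.2 -> x \in Q.2 :|: S.1 -> False.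
    rewrite !inE => h1 h2.
    have hu' : uniq ((enum P.1 ++ enum P.2) ++ (enum Q.1 ++ enum Q.2 ++ enum S.1 ++ enum S.2 ++ flatten (map block_seq rest))).
      by rewrite -catA.
    move: hu'; rewrite cat_uniq => /and3P[_ /hasPn h _].
    have /h : x \in enum Q.1 ++ enum Q.2 ++ enum S.1 ++ enum S.2 ++ flatten (map block_seq rest).
      by rewrite !mem_cat !mem_enum; case/orP: h2 => ->; rewrite ?orbT.
    by rewrite /= mem_cat !mem_enum h1.
  apply/setP => x; have := hd x; rewrite !inE.
  case: (x \in Q.1) => /=; first by rewrite orbT.
  rewrite orbF; case: (_ || _) => //= h.
  by case: (_ || _) h => // /(_ isT isT).
have hun : forall e : {set V}, e \in [set:: map (window k s) [seq i * r | i <- iota 0 m]]%N -> #|e| = k.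
  move=> e; rewrite inE => /mapP[_ /mapP[i hi ->] ->].
  move: hi; rewrite mem_iota /= add0n => hi.
  by rewrite hw //; apply: edges_uniform (hedge i hi).
exists (KGraph hun); split; last first.
  apply/subsetP => e; rewrite inE => /mapP[_ /mapP[i hi ->] ->].
  move: hi; rewrite mem_iota /= add0n => hi.
  by rewrite hw // hedge.
exists s, [seq i * r | i <- iota 0 m]%N; split => //.
- split; last by rewrite size_map size_iota.
  + rewrite sorted_map; apply: (sub_sorted _ (iota_ltn_sorted 0 m)) => i j /= hij.
    by rewrite ltn_mul2r r0.
  + apply/allP => _ /mapP[i hi ->]; move: hi; rewrite mem_iota /= add0n => hi.
    by rewrite size_vseq // ltn_mul2r r0.
- have [m1 hm1] : exists m1, m = m1.+1 by exists m.-1; rewrite prednK.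
  have hm : [seq i * r | i <- iota 0 m]%N = (0 * r)%N :: [seq i * r | i <- iota 1 m1]%N.
    by rewrite hm1.
  rewrite hm /=.
  apply/(pathP 0%N) => i; rewrite size_rcons size_map size_iota -hm1 => hi.
  have e1 : nth 0%N ((0 * r)%N :: rcons [seq i * r | i <- iota 1 m1]%N (0 * r)%N) i = (i * r)%N.
    rewrite -rcons_cons -hm nth_rcons size_map size_iota hi (nth_map 0%N) ?size_iota //.
    by rewrite nth_iota.
  have e2 : nth 0%N (rcons [seq i * r | i <- iota 1 m1]%N (0 * r)%N) i = ((i.+1 %% m) * r)%N.
    rewrite nth_rcons size_map size_iota; case: ltnP => h.
      rewrite (nth_map 0%N) ?size_iota // nth_iota // add1n modn_small //; lia.
    have -> : i = m1 by lia.
    by rewrite eqxx -hm1 modnn mul0n.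
  by rewrite e1 e2 !hw ?ltn_pmod // hint.
Qed.

Lemma lpath_hamilton S X T X' : lpath S X T -> lpath T X' S -> X :&: X' = S :|: T ->
  X :|: X' = [set: V] -> (3 * (k - l) <= #|V|)%N -> has_hamilton_cycle l H.
Proof.
move=> hp hp' hI hU hn.
have [p [B [h1 h2 h3 h4 h5]]] := lpath_chain hp.
have [q [B' [g1 g2 g3 g4 g5]]] := lpath_chain hp'.
have vcat : vseq (p :: B ++ q :: B') = vseq (p :: B) ++ vseq (q :: B').
  by rewrite -cat_cons /vseq map_cat flatten_cat.
have hall x : x \in vseq (p :: B ++ q :: B').
  have hx : x \in vseq (p :: B ++ q :: B') = (x \in X :\: T) || (x \in X' :\: S).
    by rewrite -h5 -g5 vcat mem_cat !inE.
  have [f1 f2 f3 f4 f5] := lpath_facts hp.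
  have [e1 e2 e3 e4 e5] := lpath_facts hp'.
  have : x \in X :|: X' by rewrite hU inE.
  rewrite hx !inE.
  case hS: (x \in S); case hT : (x \in T) => //=.
  - by move: (disjointFr f3 hS); rewrite hT.
  - by rewrite (subsetP f1 _ hS).
  - by rewrite (subsetP e1 _ hT).
have hwf : all wf_block (p :: B ++ q :: B') by rewrite -cat_cons all_cat h3 g3.
have hun : uniq (vseq (p :: B ++ q :: B')).
  rewrite vcat cat_uniq h4 g4 andbT /=.
  apply/hasPn => x hx; apply/negP => hx'.
  have : x \in X :\: T by rewrite -h5 inE.
  have : x \in X' :\: S by rewrite -g5 inE.
  rewrite !inE => /andP[hS hX'] /andP[hT hX].
  have : x \in S :|: T by rewrite -hI inE hX hX'.
  by rewrite inE (negbTE hS) (negbTE hT).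
apply: (@chain_hamilton p (B ++ q :: B')) => //.
  by rewrite -cat_cons h1; apply: chain_cat g2; rewrite g1.
rewrite -(@ltn_pmul2r (k - l)); last by lia.
have := size_vseq hwf; have /card_uniqP <- := hun.
have -> : #|vseq (p :: B ++ q :: B')| = #|V| by apply: eq_card => x; rewrite hall.
by move=> <-; lia.
Qed.

End Paths.

(** * Linking paths *)

Section Linking.
Variables (k l : nat) (V : finType) (H : kgraph k V).
Hypotheses (hl : (0 < l)%N) (hlk : (2 * l < k)%N).
Notation csize := (csize k l).
Notation gsize := (gsize k l).
Notation wsize := (wsize k l).
Notation lpath := (lpath l H).

Lemma disjoint_of_notin (A B : {set V}) : (forall x, x \in A -> x \in B = false) -> [disjoint A & B].
Proof.
move=> h; rewrite -setI_eq0; apply/eqP/setP => x; rewrite !inE.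
by case hA : (x \in A); rewrite //= h.
Qed.

Lemma card_set_seq (s : seq V) : uniq s -> #|[set x in s]| = size s.
Proof. by move=> us; rewrite cardsE; apply/card_uniqP. Qed.

Lemma lpath_two (S E1 U E2 T : {set V}) : E1 \in edges H -> E2 \in edges H ->
  S \subset E1 -> T \subset E2 -> E1 :&: E2 = U ->
  [disjoint S & U] -> [disjoint U & T] -> #|S| = l -> #|U| = l -> #|T| = l ->
  lpath S (E1 :|: E2) T.
Proof.
move=> h1 h2 hS hT hU d1 d2 cS cU cT.
apply: (lpath_cat (T := U)) => //; apply: lpath_edge => //.
  by rewrite -hU subsetIl.
by rewrite -hU subsetIr.
Qed.

Lemma ed_lpath (s m t : seq V) : size s = l -> size m = (k - 2 * l)%N -> size t = l ->
  ed H (s ++ m ++ t) ->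
  lpath [set x in s] [set x in s ++ m ++ t] [set x in t].
Proof.
move=> hs hm ht he.
have us : uniq (s ++ m ++ t) by apply: ed_uniq he; rewrite !size_cat; lia.
move: (us); rewrite !cat_uniq has_cat negb_or => /and3P[u1 /andP[u2 u3] /and3P[u4 u5 u6]].
apply: lpath_edge => //; rewrite ?card_set_seq //.
- by apply/subsetP => x; rewrite !inE mem_cat => ->.
- by apply/subsetP => x; rewrite !inE !mem_cat => ->; rewrite !orbT.
- apply: disjoint_of_notin => x; rewrite !inE => h1; apply/negbTE/negP => h2.
  by move/hasPn: u3 => /(_ x h2); rewrite /= h1.
Qed.

Lemma conn_lpath (S T : {set V}) (c : seq V) : #|S| = l -> #|T| = l ->
  [disjoint S & T] -> size c = csize -> uniq c -> [disjoint [set x in c] & S :|: T] ->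
  conn l H (enum S) (enum T) c ->
  lpath S (S :|: [set x in c] :|: T) T.
Proof.
move=> cS cT dST sc uc dc /andP[].
set u := take l c; set m1 := take _ _; set m2 := drop _ _ => e1 e2.
have hc : c = u ++ m1 ++ m2 by rewrite /u /m1 /m2 !cat_take_drop.
have su : size u = l by rewrite size_takel // sc /csize; lia.
have dcx x : x \in c -> (x \in S = false) * (x \in T = false).
  move=> hx; have := disjointFr dc (_ : x \in [set y in c]); rewrite !inE => /(_ hx).
  by case: (x \in S); case: (x \in T).
have dst x : x \in S -> x \in T = false by move=> hx; rewrite (disjointFr dST).
move: (uc); rewrite {1}hc !cat_uniq has_cat negb_or => /and3P[u1 /andP[u2 u3] /and3P[u4 u5 u6]].
have eX : S :|: [set x in c] :|: T =
   [set x in enum S ++ u ++ m1] :|: [set x in enum T ++ u ++ m2].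
  apply/setP => x; rewrite !inE {1}hc !mem_cat !mem_enum.
  by case: (x \in S); case: (x \in T); case: (x \in u); case: (x \in m1); case: (x \in m2).
have memu x : x \in u -> x \in c by move=> hx; rewrite hc mem_cat hx.
have mem1 x : x \in m1 -> x \in c by move=> hx; rewrite hc !mem_cat hx orbT.
have mem2 x : x \in m2 -> x \in c by move=> hx; rewrite hc !mem_cat hx !orbT.
rewrite eX; apply: (lpath_two (U := [set x in u])) => //.
- by apply/subsetP => x hx; rewrite inE mem_cat mem_enum hx.
- by apply/subsetP => x hx; rewrite inE mem_cat mem_enum hx.
- apply/setP => x; rewrite !inE !mem_cat !mem_enum.
  case hu : (x \in u); rewrite /= ?orbT //.
  case hS : (x \in S) => /=.
    rewrite (dst _ hS) /=; apply/negbTE/negP => h2.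
    by have := dcx _ (mem2 _ h2); rewrite hS => -[].
  case h1 : (x \in m1) => //=.
  rewrite (dcx _ (mem1 _ h1)) /=; apply/negbTE/negP => h2.
  by move/hasPn: u5 => /(_ x h2); rewrite /= h1.
- rewrite disjoint_sym; apply: disjoint_of_notin => x; rewrite inE => hx.
  by rewrite (dcx _ (memu _ hx)).
- apply: disjoint_of_notin => x; rewrite inE => hx.
  by rewrite (dcx _ (memu _ hx)).
- by rewrite card_set_seq.
Qed.

(** The ends are taken inside X and Y, which have at least l entries. They do not depend on which
    vertex of the pair the gadget currently carries. *)
Definition gend1 (Q : seq V) : {set V} :=
  [set x in take l (drop wsize (drop 2 (drop l.-1 Q)))].
Definition gend2 (Q : seq V) : {set V} :=
  [set x in take l (take wsize (drop 2 (drop l.-1 Q)))].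

Lemma gad_lpath (x y : V) (Q : seq V) : size Q = gsize -> uniq Q ->
  gad l H [:: x; y] Q ->
  (y \notin Q -> lpath (gend1 Q) (y |: [set z in Q]) (gend2 Q)) /\
  (x \notin Q -> lpath (gend1 Q) (x |: [set z in Q]) (gend2 Q)).
Proof.
move=> sQ uQ; rewrite /gad /gend1 /gend2.
set g := take l.-1 Q; set Q1 := drop l.-1 Q; set q := take 2 Q1; set Q2 := drop 2 Q1.
set Y := take wsize Q2; set X := drop wsize Q2.
have eQ : Q = g ++ q ++ Y ++ X by rewrite /g /q /Y /X !cat_take_drop.
have sw : (l <= wsize)%N by rewrite /wsize; lia.
have sg : size g = l.-1 by rewrite size_takel // sQ /gsize leq_addr.
have sQ1 : size Q1 = (2 + (wsize + wsize))%N by rewrite size_drop sQ /gsize addKn.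
have sq : size q = 2%N by rewrite size_takel // sQ1 leq_addr.
have sQ2 : size Q2 = (wsize + wsize)%N by rewrite size_drop sQ1 addKn.
have sY : size Y = wsize by rewrite size_takel // sQ2 leq_addr.
have sX : size X = wsize by rewrite size_drop sQ2 addKn.
case: q sq eQ => [|a [|b []]] // _ eQ /=.
rewrite /gadget /= => /and3P[e1 e2 e3].
rewrite {}eQ in uQ *; clear sQ sQ1 sQ2.
(* Both paths at once: [z0] is the vertex added to [Q], and [z1] is the entry of q that its edge
   shares with q g X. For y it is a, for x it is b. *)
have hset z0 z1 : z0 \notin g ++ [:: a; b] ++ Y ++ X ->
   (z1 == a) || (z1 == b) ->
   ed H ([:: z0; z1] ++ g ++ Y) ->
   lpath [set x in take l X] (z0 |: [set z in g ++ [:: a; b] ++ Y ++ X]) [set x in take l Y].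
  move=> hz0 hU he.
  have hp (z2 z1' : V) : perm_eq [:: a; b] [:: z1'; z2] ->  z1 = z1' ->
     lpath [set x in take l X] (z0 |: [set z in g ++ [:: a; b] ++ Y ++ X]) [set x in take l Y].
    move=> hab ?; subst z1'.
    have memab z : (z == a) || (z == b) = (z == z1) || (z == z2).
      by have := perm_mem hab z; rewrite !inE.
    have uq : uniq ([:: z1; z2] ++ g ++ Y ++ X).
      rewrite (perm_uniq (s2 := g ++ [:: a; b] ++ Y ++ X)) //.
      by rewrite perm_catCA perm_cat2l perm_cat2r perm_sym.
    have hz0' : z0 \notin [:: z1; z2] ++ g ++ Y ++ X.
      apply: contra hz0; rewrite !mem_cat !inE memab.
      by case: (z0 == z1); case: (z0 == z2); rewrite ?orbT //= ?orbF.
    have -> : z0 |: [set z in g ++ [:: a; b] ++ Y ++ X] =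
       [set z in [:: z1; z2] ++ g ++ X] :|: [set z in [:: z0; z1] ++ g ++ Y].
      apply/setP => z; rewrite !inE !mem_cat !inE memab.
      by case: (z == z0); case: (z == z1); case: (z == z2); case: (z \in g); case: (z \in Y); case: (z \in X).
    have e3' : ed H ([:: z1; z2] ++ g ++ X).
      rewrite (@perm_ed _ _ H _ ([:: a; b] ++ g ++ X)) //.
      by rewrite perm_cat2r perm_sym.
    have : uniq (([:: z1; z2] ++ g) ++ (Y ++ X)) by rewrite -catA.
    rewrite cat_uniq => /and3P[uq1 hYX]; rewrite cat_uniq => /and3P[uY hXY uX].
    have sub1 z : z \in take l X -> z \in X by exact: mem_take.
    have sub2 z : z \in take l Y -> z \in Y by exact: mem_take.
    have nX z : z \in X -> [/\ z == z1 = false, z == z2 = false, z \in g = false & z \in Y = false].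
      move=> hz; have hz' : z \in Y ++ X by rewrite mem_cat hz orbT.
      have := hasPn hYX z hz'.
      rewrite /= !inE; case: (z == z1) => //; case: (z == z2) => //; case: (z \in g) => // _; split => //.
      by have := hasPn hXY z hz; rewrite /=; case: (z \in Y).
    have nY z : z \in Y -> [/\ z == z1 = false, z == z2 = false, z \in g = false & z \in X = false].
      move=> hz; have hz' : z \in Y ++ X by rewrite mem_cat hz.
      have := hasPn hYX z hz'.
      rewrite /= !inE; case: (z == z1) => //; case: (z == z2) => //; case: (z \in g) => // _; split => //.
      by apply/negbTE/negP => hzX; have [_ _ _] := nX z hzX; rewrite hz.
    move: uq1; rewrite /= inE => /and3P[hz1 hz2 ug].
    apply: (lpath_two (U := [set z in z1 :: g])) => //.
    - by apply/subsetP => z; rewrite inE => /sub1 hz; rewrite !inE mem_cat hz !orbT.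
    - by apply/subsetP => z; rewrite inE => /sub2 hz; rewrite !inE mem_cat hz !orbT.
    - apply/setP => z; rewrite !inE /=.
      move: hz0'; rewrite !mem_cat !inE => hz0'.
      case c1 : (z == z1); case c3 : (z \in g); rewrite /= ?orbT //.
      apply/negbTE/negP => /andP[/orP[/eqP ez2|hX] /orP[/eqP ez0|hY]].
      * by move: hz0'; rewrite -ez0 ez2 eqxx orbT.
      * by have [_ + _ _] := nY _ hY; rewrite ez2 eqxx.
      * by move: hz0'; rewrite -ez0 hX !orbT.
      * by have [_ _ _] := nX _ hX; rewrite hY.
    - apply: disjoint_of_notin => z; rewrite !inE => /sub1 /nX[h1 h2 h3 h4].
      by rewrite h1 h3.
    - rewrite disjoint_sym; apply: disjoint_of_notin => z; rewrite !inE => /sub2 /nY[h1 h2 h3 h4].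
      by rewrite h1 h3.
    - by rewrite card_set_seq ?take_uniq // size_takel ?sX.
    - rewrite card_set_seq /=; first by rewrite sg prednK.
      by rewrite ug andbT; apply: contra hz1 => ->; rewrite orbT.
    - have uTY : uniq (take l Y) by exact: take_uniq.
      by rewrite (card_set_seq uTY) size_takel ?sY.
  case/orP: hU => /eqP ez; first exact: (hp b a).
  by apply: (hp a b) => //; rewrite (perm_catC [:: a] [:: b]).
split=> hz.
  apply: (hset y a) => //; first by rewrite eqxx.
  by rewrite (@perm_ed _ _ H _ ([:: a; y] ++ g ++ Y)) // perm_cat2r (perm_catC [:: y] [:: a]).
by apply: (hset x b) => //; rewrite eqxx orbT.
Qed.

End Linking.

Section Link.
Variables (k l : nat) (V : finType) (H : kgraph k V).
Hypotheses (hl : (0 < l)%N) (hlk : (2 * l < k)%N).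
Notation csize := (csize k l).
Notation lpath := (lpath l H).

(* Any two l-sets outside Y can be connected through Y, even after any z
   vertices of Y have been used. *)
Definition oracle (Y : {set V}) (z : nat) : Prop :=
  forall Z S T : {set V}, (#|Z :&: Y| <= z)%N -> #|S| = l -> #|T| = l ->
  [disjoint S & T] -> [disjoint S & Y] -> [disjoint T & Y] ->
  exists C : {set V}, [/\ C \subset Y, [disjoint C & Z], #|C| = csize &
     lpath S (S :|: C :|: T) T].

Fixpoint paths_ok (es : seq ({set V} * {set V})) (Xs : seq {set V}) : Prop :=
  match es, Xs with
  | e :: es', X :: Xs' => lpath e.1 X e.2 /\ paths_ok es' Xs'
  | [::], [::] => True
  | _, _ => False
  end.

Definition pdisj (Xs : seq {set V}) : bool := pairwise (fun A B : {set V} => [disjoint A & B]) Xs.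

Definition Union (Xs : seq {set V}) : {set V} := \bigcup_(X <- Xs) X.

Lemma disjointP (A B : {set V}) : reflect (forall x, x \in A -> x \in B -> False) [disjoint A & B].
Proof.
apply: (iffP idP) => [h x hA hB|h].
  by have := disjointFr h hA; rewrite hB.
by apply: disjoint_of_notin => x hA; apply/negbTE/negP => hB; exact: h x hA hB.
Qed.

Lemma in_Union x Xs : (x \in Union Xs) = has (fun X : {set V} => x \in X) Xs.
Proof.
rewrite /Union; elim: Xs => [|X Xs IH]; first by rewrite big_nil inE.
by rewrite big_cons inE IH.
Qed.

Lemma disj_Union (A : {set V}) Xs : all (fun X : {set V} => [disjoint A & X]) Xs -> [disjoint A & Union Xs].
Proof.
move/allP => h; apply/disjointP => x hA; rewrite in_Union => /hasP[X hX hx].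
by have /disjointP/(_ x hA hx) := h X hX.
Qed.

Lemma paths_ok_cat es es' Xs Xs' : paths_ok es Xs -> paths_ok es' Xs' ->
  paths_ok (es ++ es') (Xs ++ Xs').
Proof.
elim: es Xs => [|e es IH] [|X Xs] //= [h1 h2] h3; split => //; exact: IH.
Qed.

(* The connecting set C depends on the ends of the paths only, so that it can
   be chosen before the absorbers change their state. *)
Lemma link_paths e es Xs0 (Y : {set V}) : paths_ok (e :: es) Xs0 -> pdisj Xs0 ->
  all (fun X : {set V} => [disjoint X & Y]) Xs0 -> oracle Y (csize * size es) ->
  exists C : {set V}, [/\ C \subset Y, (#|C| <= csize * size es)%N &
   forall Xs, paths_ok (e :: es) Xs -> pdisj Xs ->
     all (fun X : {set V} => [disjoint X & C]) Xs ->
     lpath e.1 (C :|: Union Xs) (last e es).2].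
Proof.
elim: es e Xs0 => [|e1 es IH] e Xs0 hok hdis hY ho.
  exists set0; split => //; rewrite ?sub0set ?cards0 //.
  by move=> [|X [|X' Xs]] //= [hp hf] _ _ //; rewrite /Union big_seq1 set0U.
case: Xs0 hok hdis hY => [|X0 [|X1 Xs0]]; rewrite /=; try by move=> [].
move=> [h0 [h1 hok]] /andP[/andP[d01 d0] d1] /andP[y0 /andP[y1 y]].
have [||||C [C1 C2 C3]] := IH e1 (X1 :: Xs0).
- by split.
- exact: d1.
- by rewrite /= y1 y.
- by move=> Z S T hZ; apply: ho; apply: leq_trans hZ _; rewrite leq_mul.
have [a1 a2 a3 a4 a5] := lpath_facts h0.
have [b1 b2 b3 b4 b5] := lpath_facts h1.
have dE : [disjoint e.2 & e1.1] by apply: disjointWl a2 _; apply: disjointWr b1 _.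
(* Only the connectors in [C] are to be avoided: the paths themselves lie outside [Y]. *)
have [|||c [c1 c2 c3 c4]] := ho C e.2 e1.1 _ a5 b4 dE.
- by apply: leq_trans (subset_leq_card (subsetIl _ _)) _; apply: leq_trans C2 _; rewrite leq_mul.
- exact: disjointWl a2 y0.
- exact: disjointWl b1 y1.
exists (c :|: C); split.
- by rewrite subUset c1 C1.
- apply: leq_trans (leq_card_setU _ _) _; rewrite c3 mulnS leq_add2l //.
move=> Xs; case: Xs => [|X [|X' Xs]]; rewrite /=; try by move=> [].
move=> [p0 [p1 ps]] /andP[/andP[q01 q0] qs] /andP[r0 rs].
have {}rs : all (fun X : {set V} => [disjoint X & c :|: C]) (X' :: Xs) := rs.
have [f1 f2 f3 f4 f5] := lpath_facts p0.
have [g1 g2 g3 g4 g5] := lpath_facts p1.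
have hrest : lpath e1.1 (C :|: Union (X' :: Xs)) (last e1 es).2.
  apply: C3 => //.
  apply: sub_all rs => Z; apply: disjointWr; exact: subsetUr.
have -> : c :|: C :|: Union [:: X, X' & Xs] =
  (X :|: (e.2 :|: c :|: e1.1)) :|: (C :|: Union (X' :: Xs)).
  apply/setP => x; rewrite !inE !in_Union /=.
  case hx2: (x \in e.2); first by rewrite (subsetP f2 _ hx2) !orbT.
  case hx1: (x \in e1.1); first by rewrite (subsetP g1 _ hx1) !orbT.
  by case: (x \in c); case: (x \in C); case: (x \in X).
have rX Z : Z \in [:: X, X' & Xs] -> [disjoint Z & c] /\ [disjoint Z & C].
  move=> hZ; have : [disjoint Z & c :|: C].
    by move: hZ; rewrite inE => /orP[/eqP ->|hZ] //; move/allP: rs; apply.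
  by move=> h; split; apply: disjointWr h; [exact: subsetUl|exact: subsetUr].
have [X_c X_C] := rX X (mem_head _ _).
have [|X'_c X'_C] := rX X'; first by rewrite !inE eqxx orbT.
have qall : all (fun B : {set V} => [disjoint X & B]) (X' :: Xs) by rewrite /= q01 q0.
apply: lpath_cat hrest _; last first.
  apply/setP => x; rewrite inE.
  apply/andP/idP => [[h2 h3]|h2]; last first.
    split; first by rewrite !inE h2 !orbT.
    by rewrite inE in_Union /= (subsetP g1 _ h2) orbT.
  move: h2; rewrite !inE => /orP[hX|/orP[/orP[h2|h2]|//]].
  - move: h3; rewrite inE => /orP[hC|hU].
      by have /disjointP/(_ x hX hC) := X_C.
    by have /disjointP/(_ x hX hU) := disj_Union qall.
  - have hX := subsetP f2 _ h2; move: h3; rewrite inE => /orP[hC|hU].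
      by have /disjointP/(_ x hX hC) := X_C.
    by have /disjointP/(_ x hX hU) := disj_Union qall.
  - move: h3; rewrite inE => /orP[hC|]; first by have /disjointP/(_ x h2 hC) := c2.
    rewrite in_Union => /hasP[Z hZ hxZ].
    have hZ' : Z \in [:: X, X' & Xs] by rewrite inE hZ orbT.
    by have [/disjointP/(_ x hxZ h2)] := rX Z hZ'.
apply: lpath_cat p0 c4 _.
apply/setP => x; rewrite !inE; apply/andP/idP => [[hX]|h2]; last by rewrite h2 (subsetP f2 _ h2).
case/orP => [/orP[//|hc]|h2].
  by have /disjointP/(_ x hX hc) := X_c.
by have /disjointP/(_ x hX (subsetP g1 _ h2)) := q01.
Qed.

End Link.

(** * Box theorem and concentration *)

Section Box.
Context {R : realType}.

Lemma subset_card_eq (T : finType) (A : {set T}) b : (b <= #|A|)%N ->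
  exists2 B : {set T}, B \subset A & #|B| = b.
Proof.
move=> h; exists [set x in take b (enum A)].
  by apply/subsetP => x; rewrite inE => /mem_take; rewrite mem_enum.
rewrite cardsE; have /card_uniqP -> : uniq (take b (enum A)) by rewrite take_uniq // enum_uniq.
by rewrite size_takel // -cardE.
Qed.

Definition in_box (T : finType) (s : seq T) (X : seq {set T}) : bool :=
  all2 (fun x (A : {set T}) => x \in A) s X.

(** Fix b1 distinct vertices whose average degree into [G] is nearly [kappa]. By the reverse Markov
    inequality, for a kappa/4 share of the [s] at least [b] of them belong to [s]; by pigeonhole
    over at most 2^b1 subsets, one b-set serves many [s] simultaneously. *)
Lemma box_step (T : finType) M b b1 (kappa : R) (G : pred (seq T)) : (0 < #|T|)%N ->
  0 < kappa -> (0 < b1)%N -> b%:R <= kappa / 4 * b1%:R ->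
  b1%:R ^+ 2 <= kappa / 2 * #|T|%:R ->
  kappa <= Av M.+1 (fun s => (G s)%:R) ->
  exists2 A : {set T}, #|A| = b &
    kappa / 4 / (2 ^ b1)%:R <= Av M (fun s => [forall (v | v \in A), G (v :: s)]%:R).
Proof.
move=> hT k0 b10 hb hn hG.
pose g v : R := Av M (fun s => (G (v :: s))%:R).
have g0 v : 0 <= g v by exact: Av_bool_ge0.
have g1 v : g v <= 1 by exact: Av_bool_le1.
have hAv1 : Av 1 (fun x => \sum_(v <- x) g v) = Av M.+1 (fun s => (G s)%:R).
  rewrite -[M.+1]add1n Av_cat; apply: eq_Av => -[//|x []] // _.
  by rewrite big_seq1.
(* Samples with repetitions cost at most half of the mean. *)
have hvs : b1%:R * (kappa / 2) <= Av b1 (fun vs => (uniq vs)%:R * \sum_(v <- vs) g v).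
  have h1 : b1%:R * kappa <= Av b1 (fun vs => \sum_(v <- vs) g v).
    by rewrite Av_sum_seq // hAv1 ler_wpM2l.
  have h2 : Av b1 (fun vs : seq T => (~~ uniq vs)%:R * b1%:R) <= kappa / 2 * b1%:R :> R.
    rewrite AvZr ler_wpM2r //; apply: le_trans (Av_dup _ hT) _.
    by rewrite ler_pdivrMr ?ltr0n.
  have h3 : Av b1 (fun vs => \sum_(v <- vs) g v) <=
     Av b1 (fun vs => (uniq vs)%:R * (\sum_(v <- vs) g v) + (~~ uniq vs)%:R * b1%:R).
    apply: ler_Av => vs sv; case: (uniq vs); rewrite /= ?mul0r ?mul1r ?addr0 ?add0r //.
    rewrite -sv; elim: (vs) => [|v s IH]; first by rewrite big_nil.
    by rewrite big_cons /= -add1n natrD lerD.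
  move: h3; rewrite AvD; lra.
have [vs sv] := Av_exists hT hvs.
have b1R : 0 < b1%:R :> R by rewrite ltr0n.
case: (boolP (uniq vs)) => uv; last first.
  by rewrite mul0r leNgt !mulr_gt0.
rewrite mul1r /g -Av_sum => h.
pose F s : R := (\sum_(v <- vs) (G (v :: s))%:R) / b1%:R.
have hF : kappa / 2 <= Av M F by rewrite /F AvZr ler_pdivlMr // mulrC.
have F1 s : size s = M -> F s <= 1.
  move=> _; rewrite /F ler_pdivrMr // mul1r -sv.
  elim: (vs) => [|v t IH]; first by rewrite big_nil.
  by rewrite big_cons /= -add1n natrD lerD // lern1 leq_b1.
have hk2 : 0 <= kappa / 2 by rewrite divr_ge0 // ltW.
have := Av_markov hT F1 hk2 hF.
have -> : kappa / 2 / 2 = kappa / 4 by field.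
pose P (A : {set T}) := (A \subset [set v in vs]) && (#|A| == b).
move=> h4.
have h5 : kappa / 4 <= \sum_(A : {set T} | P A) Av M (fun s => [forall (v | v \in A), G (v :: s)]%:R).
  rewrite -Av_sum; apply: le_trans h4 _; apply: ler_Av => s ss.
  case: (leP (kappa / 4) (F s)) => [h6|_] /=; last by apply: sumr_ge0.
  rewrite /F ler_pdivlMr // in h6.
  pose I := [set v in vs | G (v :: s)].
  have cI : \sum_(v <- vs) (G (v :: s))%:R = #|I|%:R :> R.
    rewrite -natr_sum; congr _%:R; rewrite -big_mkcond /= sum1_count -size_filter.
    have -> : I = [set v in [seq v <- vs | G (v :: s)]].
      by apply/setP => v; rewrite !inE mem_filter andbC.
    by rewrite cardsE (card_uniqP (filter_uniq _ uv)).
  have [A hA cA] : exists2 A : {set T}, A \subset I & #|A| = b.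
    apply: subset_card_eq; rewrite -(ler_nat R) -cI; exact: le_trans h6.
  rewrite (bigD1 A) /=; last first.
    rewrite /P cA eqxx andbT; apply/subsetP => v /(subsetP hA); rewrite !inE => /andP[].
    by [].
  apply: ler_wpDr; first by apply: sumr_ge0.
  have -> // : [forall (v | v \in A), G (v :: s)].
  by apply/forall_inP => v /(subsetP hA); rewrite inE => /andP[].
have [A hPA hA] : exists2 A, P A & kappa / 4 / (2 ^ b1)%:R <= Av M (fun s => [forall (v | v \in A), G (v :: s)]%:R).
  apply/exists_inP; apply: contraT; rewrite negb_exists_in => /forall_inP hn'.
  suff : kappa / 4 < kappa / 4 by rewrite ltxx.
  apply: le_lt_trans h5 _.
  have [hP|/existsPn hP] := boolP [exists A, P A]; last first.
    by rewrite big1 ?divr_gt0 // => A hA; have := hP A; rewrite hA.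
  apply: lt_le_trans (_ : _ < \sum_(A | P A) kappa / 4 / (2 ^ b1)%:R) _.
    apply: ltr_sum => [|A hA]; last by rewrite ltNge hn'.
    by case/existsP: hP => A hA; apply/hasP; exists A => //; rewrite mem_index_enum.
  rewrite sumr_const -[X in X <= _]mulr_natr -mulrA -[leRHS]mulr1.
  rewrite ler_wpM2l ?divr_ge0 ?(ltW k0) //.
  rewrite mulrC ler_pdivrMr ?ltr0n ?expn_gt0 // mul1r ler_nat.
  apply: leq_trans (_ : _ <= #|powerset [set v in vs]|)%N _.
    by apply: subset_leq_card; apply/subsetP => A; rewrite inE => /andP[].
  by rewrite card_powerset cardsE (card_uniqP uv) sv.
by exists A => //; move: hPA => /andP[_ /eqP].
Qed.

(** One coordinate is boxed at a time, at the price of a smaller density for the rest. The sides of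
    the box may overlap; when the box is used, every coordinate has its own copy of the vertex
    set. *)
Lemma box_lemma M b (kappa : R) : 0 < kappa ->
  exists b0, forall (T : finType) (G : pred (seq T)), (b0 <= #|T|)%N ->
    kappa <= Av M (fun s => (G s)%:R) ->
    exists X : seq {set T}, [/\ size X = M, all (fun A : {set T} => #|A| == b) X &
      forall s, in_box s X -> G s].
Proof.
elim: M kappa => [|M IH] kappa k0.
  exists 0%N => T G _; rewrite AvE => h; exists [::]; split => // -[] // _.
  by case: (G [::]) h => //; rewrite leNgt k0.
pose b1 := (Num.truncn (b%:R / (kappa / 4))).+1.
have hb : b%:R <= kappa / 4 * b1%:R.
  rewrite mulrC -ler_pdivrMr ?divr_gt0 // ltW // truncnS_gt //.
pose kappa' := kappa / 4 / (2 ^ b1)%:R.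
have k0' : 0 < kappa' by rewrite !divr_gt0 // ltr0n expn_gt0.
have [b0 hb0] := IH kappa' k0'.
pose c := (Num.truncn (b1%:R ^+ 2 / (kappa / 2))).+1.
exists (maxn b0 c) => T G; rewrite geq_max => /andP[h1 h2] hG.
have hT : (0 < #|T|)%N by apply: leq_trans h2.
have hn : b1%:R ^+ 2 <= kappa / 2 * #|T|%:R.
  rewrite mulrC -ler_pdivrMr ?divr_gt0 //.
  by apply: le_trans (ltW (truncnS_gt _)) _; rewrite ler_nat.
have [A cA hA] := box_step hT k0 (isT : (0 < b1)%N) hb hn hG.
have [X [sX bX hX]] := hb0 T _ h1 hA.
exists (A :: X); split => /=; rewrite ?sX ?cA ?eqxx //.
case=> [|v s]; rewrite /in_box //= => /andP[hv hs].
by have /forall_inP := hX s hs; apply.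
Qed.

End Box.

(** * A Chernoff bound by counting functions *)

Section Chernoff.
Context {R : realType}.

Lemma expRN_le (x : R) : 0 <= x -> expR (- x) <= 1 - x + x ^+ 2.
Proof.
move=> x0; rewrite expRN.
have h1 : 1 + x <= expR x by exact: expR_ge1Dx.
have p1 : 0 < 1 + x by rewrite ltr_wpDr.
apply: le_trans (_ : _ <= (1 + x)^-1) _.
  by rewrite lef_pV2 // posrE ?expR_gt0.
rewrite -[_^-1]mul1r ler_pdivrMr //.
have : 0 <= x ^+ 3 by rewrite exprn_ge0.
by rewrite (_ : (1 - x + x ^+ 2) * (1 + x) = 1 + x ^+ 3); [lra|ring].
Qed.

Variables (Z : finType) (q : nat).
Hypothesis hZ : (0 < #|Z|)%N.
Implicit Types (f a : {ffun 'I_q -> Z}) (J : {set 'I_q}).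

Definition mean (g : Z -> R) : R := (\sum_z g z) / #|Z|%:R.

(** The multiplier alpha/2 optimises the bound: the exponent is at most -alpha * alpha/2 +
    (alpha/2)^2 = -alpha^2/4. *)
Lemma exp_moment (g : Z -> R) (alpha : R) : 0 <= alpha -> alpha <= 1 ->
  (forall z, 0 <= g z <= 1) ->
  \sum_z expR (alpha / 2 * (mean g - alpha - g z)) <= #|Z|%:R * expR (- (alpha ^+ 2 / 4)).
Proof.
move=> a0 a1 hg; set la := alpha / 2; set mu := mean g.
have la0 : 0 <= la by rewrite divr_ge0.
have Z0 : #|Z|%:R != 0 :> R by rewrite pnatr_eq0 -lt0n.
have h1 : \sum_z expR (- (la * g z)) <= #|Z|%:R * (1 - la * mu + la ^+ 2).
  apply: le_trans (_ : _ <= \sum_z (1 - la * g z + la ^+ 2)) _.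
    apply: ler_sum => z _; have /andP[g0 g1] := hg z.
    have hh : 0 <= la * g z by rewrite mulr_ge0.
    apply: le_trans (expRN_le hh) _; rewrite lerD2l exprMn ler_piMr ?sqr_ge0 //.
    by rewrite exprn_ile1.
  have cst (c : R) : \sum_(z : Z) c = #|Z|%:R * c by rewrite sumr_const mulr_natl.
  rewrite big_split big_split /= sumrN -mulr_sumr !cst /mu /mean.
  rewrite le_eqVlt; apply/orP; left; apply/eqP; set S := \sum_i g i.
  have -> : #|Z|%:R * (1 - la * (S / #|Z|%:R) + la ^+ 2) =
     #|Z|%:R - la * (S / #|Z|%:R * #|Z|%:R) + #|Z|%:R * la ^+ 2 by ring.
  by rewrite divfK // mulr1.
have e z : expR (la * (mu - alpha - g z)) = expR (la * (mu - alpha)) * expR (- (la * g z)).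
  by rewrite -expRD; congr expR; ring.
under eq_bigr do rewrite e.
rewrite -mulr_sumr.
have h2 : 1 - la * mu + la ^+ 2 <= expR (- (la * mu) + la ^+ 2).
  by rewrite -addrA; exact: expR_ge1Dx.
apply: le_trans (_ : _ <= expR (la * (mu - alpha)) * (#|Z|%:R * expR (- (la * mu) + la ^+ 2))) _.
  rewrite ler_wpM2l ?expR_ge0 //; apply: le_trans h1 _.
  by rewrite ler_wpM2l.
rewrite mulrCA ler_wpM2l // -expRD ler_expR /la; lra.
Qed.

(* Resampling the coordinates in J makes them independent of f, without any
   formal product measure. *)
Definition merge J a f : {ffun 'I_q -> Z} := [ffun j => if j \in J then a j else f j].

(** Exchanging the coordinates in [J] between a and f is an involution on pairs, and it turns
    [merge J a f] into f. *)
Lemma sum_merge J (F : {ffun 'I_q -> Z} -> R) :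
  \sum_a \sum_f F (merge J a f) = #|{ffun 'I_q -> Z}|%:R * \sum_f F f.
Proof.
pose h (p : {ffun 'I_q -> Z} * {ffun 'I_q -> Z}) := (merge J p.2 p.1, merge J p.1 p.2).
have hK : involutive h.
  by move=> [a f]; rewrite /h /=; congr pair; apply/ffunP => j; rewrite !ffunE; case: (j \in J).
rewrite pair_bigA /=.
rewrite (reindex_inj (inv_inj hK)) /=.
have hm (a f : {ffun 'I_q -> Z}) : merge J (merge J f a) (merge J a f) = f.
  by apply/ffunP => j; rewrite !ffunE; case: (j \in J).
under eq_bigr do rewrite hm.
rewrite -(pair_bigA _ (fun (a f : {ffun 'I_q -> Z}) => F f)) /= sumr_const.
by rewrite mulr_natl.
Qed.

Definition deviates J (g : {ffun 'I_q -> Z} -> Z -> R) (alpha : R) f : bool :=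
  \sum_(j in ~: J) g f (f j) < #|~: J|%:R * (mean (g f) - alpha).

(** The function [g f] may depend on f, but only through the coordinates in [J]. With these fixed,
    the other coordinates are independent and the exponential moment factors over them. *)
Lemma chernoff J (g : {ffun 'I_q -> Z} -> Z -> R) (alpha : R) : 0 <= alpha -> alpha <= 1 ->
  (forall f z, 0 <= g f z <= 1) ->
  (forall f f', (forall j, j \in J -> f j = f' j) -> g f =1 g f') ->
  #|[set f | deviates J g alpha f]|%:R <=
    #|{ffun 'I_q -> Z}|%:R * expR (- (alpha ^+ 2 / 4)) ^+ #|~: J|.
Proof.
move=> a0 a1 hg hJ.
have hFF : (0 < #|{ffun 'I_q -> Z}|)%N by rewrite card_ffun expn_gt0 hZ.
have FF0 : 0 < #|{ffun 'I_q -> Z}|%:R :> R by rewrite ltr0n.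
rewrite -(ler_pM2l FF0) cardsE -(sum_bool (deviates J g alpha)).
rewrite -(sum_merge J (fun f => (deviates J g alpha f)%:R)).
set rho := expR _.
apply: le_trans (_ : _ <= \sum_(a : {ffun 'I_q -> Z}) #|{ffun 'I_q -> Z}|%:R * rho ^+ #|~: J|) _; last first.
  by rewrite sumr_const -[X in X <= _]mulr_natl.
apply: ler_sum => a _.
pose la := alpha / 2; have la0 : 0 <= la by rewrite divr_ge0.
pose G j z : R := if j \in J then 1 else expR (la * (mean (g a) - alpha - g a z)).
apply: le_trans (_ : _ <= \sum_(f : {ffun 'I_q -> Z}) \prod_j G j (f j)) _.
  apply: ler_sum => f _.
  have eg : g (merge J a f) =1 g a by apply: hJ => j hj; rewrite ffunE hj.
  have em : mean (g (merge J a f)) = mean (g a).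
    by rewrite /mean; congr (_ / _); apply: eq_bigr => z _; rewrite eg.
  have -> : \prod_j G j (f j) = expR (la * (#|~: J|%:R * (mean (g a) - alpha) - \sum_(j in ~: J) g a (f j))).
    rewrite -sumr_const mulr_suml -sumrB mulr_sumr expR_sum [RHS]big_mkcond /=.
    apply: eq_bigr => j _; rewrite /G in_setC; case: (j \in J) => //=.
    by rewrite mul1r.
  rewrite /deviates em; under eq_bigr do rewrite eg.
  have -> : \sum_(j in ~: J) g a (merge J a f j) = \sum_(j in ~: J) g a (f j).
    by apply: eq_bigr => j; rewrite in_setC ffunE => /negbTE ->.
  case: (ltP (\sum_(j in ~: J) g a (f j)) (#|~: J|%:R * (mean (g a) - alpha))) => h /=; last exact: expR_ge0.
  by apply: le_trans (expR_ge1Dx _); rewrite lerDl mulr_ge0 // subr_ge0 ltW.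
rewrite -(bigA_distr_bigA G) /= (bigID (mem J)) /=.
have -> : \prod_(i in J) \sum_z G i z = #|Z|%:R ^+ #|J|.
  rewrite -prodr_const; apply: eq_bigr => j hj.
  by under eq_bigr do rewrite /G hj; rewrite sumr_const.
apply: le_trans (_ : _ <= #|Z|%:R ^+ #|J| * \prod_(i in ~: J) (#|Z|%:R * rho)) _.
  rewrite ler_wpM2l ?exprn_ge0 //.
  rewrite [leRHS](eq_bigl (fun i => i \notin J)); last by move=> i; rewrite in_setC.
  apply: ler_prod => j hj; apply/andP; split.
    by apply: sumr_ge0 => z _; rewrite /G (negbTE hj) expR_ge0.
  by under eq_bigr do rewrite /G (negbTE hj); exact: exp_moment.
rewrite prodr_const exprMn mulrA -exprD cardsC card_ord -natrX.
by rewrite card_ffun card_ord.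
Qed.

End Chernoff.

Lemma card_bigcup_le (T J : finType) (A : J -> {set T}) :
  (#|\bigcup_j A j| <= \sum_j #|A j|)%N.
Proof.
elim/big_rec2: _ => [|j n U _ h]; first by rewrite cards0.
by apply: leq_trans (leq_card_setU _ _) _; rewrite leq_add2l.
Qed.

(** * Random samples *)

Section Sampling.
Context {R : realType}.
Variables (k l : nat) (V : finType) (H : kgraph k V).
Variables (I : finType) (y : nat) (B : finType) (pos : I -> 'I_y -> B -> V) (q : nat).
Hypotheses (hlk : (l <= k)%N) (hI : (0 < #|I|)%N) (hy : (0 < y)%N) (hB : (0 < #|B|)%N) (hq : (0 < q)%N).

Let Omega := (I * 'I_y * B)%type.
Let Z := (I * {ffun 'I_y -> B})%type.
Let Idx := ('I_q * 'I_y)%type.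

(** [vert] describes one uniform vertex of the items, whereas an element of [Z] draws one item and a
    vertex from each of its [y] parts. The vertices of one sample share an item; independence holds
    only between the q samples. *)
Definition vert (o : Omega) : V := pos o.1.1 o.1.2 o.2.
Definition xz (z : Z) (v : 'I_y) : V := pos z.1 v (z.2 v).
Definition xs (f : {ffun 'I_q -> Z}) (i : Idx) : V := xz (f i.1) i.2.

Definition hdens r (w : seq V) : R := Av r (fun o : seq Omega => (ed H (w ++ map vert o))%:R).

Definition test r (w : seq V) (z : Z) : R := (\sum_v hdens r (w ++ [:: xz z v])) / y%:R.

Lemma card_Omega_gt0 : (0 < #|{: Omega}|)%N.
Proof. by rewrite !card_prod card_ord !muln_gt0 hI hy hB. Qed.

Lemma card_Z_gt0 : (0 < #|{: Z}|)%N.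
Proof. by rewrite card_prod muln_gt0 hI card_ffun expn_gt0 hB. Qed.

Lemma hdens01 r w : 0 <= hdens r w <= 1.
Proof.
apply/andP; split; first by apply: Av_ge0 => s _; exact: ler0n.
by apply: Av_le => [|s _]; [exact: card_Omega_gt0|rewrite lern1 leq_b1].
Qed.

Lemma test01 r w z : 0 <= test r w z <= 1.
Proof.
rewrite /test divr_ge0 //=; last by apply: sumr_ge0 => v _; case/andP: (hdens01 r (w ++ [:: xz z v])).
rewrite ler_pdivrMr ?ltr0n // mul1r.
apply: le_trans (_ : _ <= \sum_(v < y) 1) _; last by rewrite sumr_const card_ord.
by apply: ler_sum => v _; case/andP: (hdens01 r (w ++ [:: xz z v])).
Qed.

Lemma sum_marginal (v : 'I_y) (F : B -> R) :
  \sum_(t : {ffun 'I_y -> B}) F (t v) = (#|B| ^ y.-1)%:R * \sum_b F b.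
Proof.
pose G (i : 'I_y) (b : B) : R := if i == v then F b else 1.
transitivity (\sum_(t : {ffun 'I_y -> B}) \prod_i G i (t i)).
  apply: eq_bigr => t _; rewrite (bigD1 v) //= big1 ?mulr1 /G ?eqxx // => i /negbTE ->.
  by [].
rewrite -(bigA_distr_bigA G) /= (bigD1 v) //= mulrC; congr (_ * _).
  rewrite (eq_bigr (fun _ => #|B|%:R)); last first.
    by move=> i hi; rewrite /G (negbTE hi) sumr_const.
  by rewrite prodr_const natrX -[in RHS](card_ord y) -(cardC1 v).
by rewrite /G eqxx.
Qed.

(** Each of the y vertices of a sample is uniform in its part, so averaging a test over all samples
    draws one more uniform vertex. *)
Lemma mean_test r w : mean (test r w) = hdens r.+1 w.
Proof.
rewrite /mean /test /hdens AvE -mulr_suml exchange_big /=.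
have -> : \sum_(x : Omega) Av r (fun s : seq Omega => (ed H (w ++ map vert (x :: s)))%:R)
   = \sum_v \sum_i \sum_b hdens r (w ++ [:: pos i v b]).
  rewrite exchange_big /= pair_bigA /= pair_bigA /=; apply: eq_bigr => -[[i v] b] _ /=.
  by rewrite /hdens; apply: eq_Av => s _; rewrite -catA.
have -> : \sum_v \sum_z hdens r (w ++ [:: xz z v]) =
  (#|B| ^ y.-1)%:R * \sum_v \sum_i \sum_b hdens r (w ++ [:: pos i v b]).
  rewrite mulr_sumr; apply: eq_bigr => v _.
  rewrite -(pair_bigA _ (fun i (t : {ffun 'I_y -> B}) => hdens r (w ++ [:: pos i v (t v)]))) /= mulr_sumr.
  by apply: eq_bigr => i _; rewrite (sum_marginal v (fun b => hdens r (w ++ [:: pos i v b]))).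
set S := \sum_v _.
rewrite !card_prod card_ffun !card_ord -(prednK hy) expnS /= !natrM.
have hI0 : #|I|%:R != 0 :> R by rewrite pnatr_eq0 -lt0n.
have hB0 : #|B|%:R != 0 :> R by rewrite pnatr_eq0 -lt0n.
have hB1 : (#|B| ^ y.-1)%:R != 0 :> R by rewrite pnatr_eq0 -lt0n expn_gt0 hB.
have hy0 : y.-1.+1%:R != 0 :> R by rewrite pnatr_eq0.
move: hI0 hB0 hB1 hy0; move: (#|I|%:R) (#|B|%:R) ((#|B| ^ y.-1)%:R) (y.-1.+1%:R) S => a b c d S a0 b0 c0 d0.
by field; rewrite a0 b0 c0 d0.
Qed.

Definition fibers (js : seq Idx) : {set 'I_q} := [set i in map fst js].

Lemma card_fibersC (js : seq Idx) : (q - size js <= #|~: fibers js|)%N.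
Proof.
have := cardsC (fibers js); rewrite card_ord => h.
have : (#|fibers js| <= size js)%N by rewrite cardsE (leq_trans (card_size _)) // size_map.
lia.
Qed.

Definition jtest (alpha : R) (js : seq Idx) (f : {ffun 'I_q -> Z}) : bool :=
  deviates (fibers js) (fun f => test (k - (size js).+1) (map (xs f) js)) alpha f.

(** Every list of fewer than k sampled vertices defines a test. The other samples have to pass it up
    to [alpha]; those containing the list are excluded, as they are not independent of it. *)
Definition regular (alpha : R) (f : {ffun 'I_q -> Z}) : bool :=
  [forall p : 'I_k, [forall js : p.-tuple Idx, ~~ jtest alpha js f]].

(** A union bound over at most k (q y)^k tests, each with at least q - k independent coordinates. *)
Lemma card_irregular (alpha : R) : 0 <= alpha -> alpha <= 1 -> (k <= q)%N ->
  #|[set f | ~~ regular alpha f]|%:R <=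
   (k * (q * y) ^ k)%:R * expR (- (alpha ^+ 2 / 4)) ^+ (q - k) * #|{ffun 'I_q -> Z}|%:R.
Proof.
move=> a0 a1 kq; set rho := expR _.
have rho0 : 0 <= rho by exact: expR_ge0.
have rho1 : rho <= 1.
  by rewrite -expR0 ler_expR oppr_le0 divr_ge0 // exprn_ge0.
have M0 : (0 < q * y)%N by rewrite muln_gt0 hq.
have step (p : 'I_k) (js : p.-tuple Idx) : #|[set f | jtest alpha js f]|%:R <= rho ^+ (q - k) * #|{ffun 'I_q -> Z}|%:R.
  apply: le_trans (chernoff card_Z_gt0 (J := fibers js) a0 a1 _ _) _.
  - by move=> f z; exact: test01.
  - move=> f f' hf z; congr (test _ _ z); apply/eq_in_map => i hi.
    by rewrite /xs hf // inE; apply: map_f.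
  rewrite mulrC ler_wpM2r //; apply: ler_wiXn2l => //.
  by apply: leq_trans (card_fibersC js); rewrite size_tuple leq_sub2l // ltnW.
apply: le_trans (_ : _ <= \sum_(p < k) \sum_(js : p.-tuple Idx) #|[set f | jtest alpha js f]|%:R) _.
  under eq_bigr do rewrite -natr_sum.
  rewrite -natr_sum ler_nat.
  apply: leq_trans (_ : _ <= #|\bigcup_(p < k) \bigcup_(js : p.-tuple Idx) [set f | jtest alpha js f]|)%N _.
    apply: subset_leq_card; apply/subsetP => f; rewrite inE negb_forall => /existsP[p].
    rewrite negb_forall => /existsP[js]; rewrite negbK => h.
    by apply/bigcupP; exists p => //; apply/bigcupP; exists js => //; rewrite inE.
  refine (leq_trans (card_bigcup_le _) _) => /=.
  by apply: leq_sum => p _; exact: card_bigcup_le.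
apply: le_trans (_ : _ <= \sum_(p < k) (((q * y) ^ k)%:R * (rho ^+ (q - k) * #|{ffun 'I_q -> Z}|%:R))) _.
  apply: ler_sum => p _.
  apply: le_trans (_ : _ <= \sum_(js : p.-tuple Idx) rho ^+ (q - k) * #|{ffun 'I_q -> Z}|%:R) _.
    by apply: ler_sum => js _; exact: step.
  rewrite sumr_const card_tuple card_prod !card_ord -[X in X <= _]mulr_natl ler_wpM2r ?mulr_ge0 ?exprn_ge0 //.
  by rewrite ler_nat leq_pexp2l // ltnW.
by rewrite sumr_const card_ord -[X in X <= _]mulr_natl natrM !mulrA.
Qed.

(** The term k/q pays for the at most k samples that the test ignores. *)
Lemma regular_step (alpha : R) f (js : seq Idx) : 0 <= alpha -> regular alpha f -> (size js < k)%N ->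
  hdens (k - size js) (map (xs f) js) - (alpha + k%:R / q%:R) <=
  (\sum_(i : Idx) hdens (k - (size js).+1) (map (xs f) js ++ [:: xs f i])) / #|{: Idx}|%:R.
Proof.
move=> a0 /forallP hreg hp.
have /forallP/(_ (in_tuple js)) := hreg (Ordinal hp).
rewrite /jtest /deviates -leNgt mean_test /=.
set w := map (xs f) js; set r := (k - (size js).+1)%N.
have -> : (k - size js = r.+1)%N by rewrite /r; lia.
move=> h.
have /andP[h0 h1] := hdens01 r.+1 w; set D := hdens r.+1 w in h h0 h1 *.
have q0 : 0 < q%:R :> R by rewrite ltr0n.
have y0 : 0 < y%:R :> R by rewrite ltr0n.
have -> : \sum_(i : Idx) hdens r (w ++ [:: xs f i]) = y%:R * \sum_j test r w (f j).
  rewrite -(pair_bigA _ (fun j v => hdens r (w ++ [:: xz (f j) v]))) /= mulr_sumr.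
  by apply: eq_bigr => j _; rewrite /test mulrC divfK // gt_eqF.
rewrite card_prod !card_ord mulnC natrM -mulf_div divff ?gt_eqF // mul1r.
rewrite ler_pdivlMr //.
have t0 z : 0 <= test r w z by case/andP: (test01 r w z).
have hs : \sum_(j in ~: fibers js) test r w (f j) <= \sum_j test r w (f j).
  rewrite [leRHS](bigID (mem (~: fibers js))) /= lerDl.
  by apply: sumr_ge0.
have S0 : 0 <= \sum_j test r w (f j) by apply: sumr_ge0.
have hc : q%:R - k%:R <= #|~: fibers js|%:R :> R.
  rewrite lerBlDr -natrD ler_nat; have := card_fibersC js; lia.
have e : (D - (alpha + k%:R / q%:R)) * q%:R = (D - alpha) * q%:R - k%:R.
  by field; rewrite gt_eqF.
rewrite e; have k0 : 0 <= k%:R :> R by [].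
have [hneg|hpos] := ltP (D - alpha) 0.
  apply: le_trans S0; rewrite subr_le0; apply: le_trans k0.
  by apply: mulr_le0_ge0; [exact: ltW|exact: ltW].
apply: le_trans hs; apply: le_trans h.
apply: le_trans (_ : _ <= (q%:R - k%:R) * (D - alpha)) _; last by rewrite ler_wpM2r.
have : k%:R * (D - alpha) <= k%:R by rewrite ler_piMr //; lra.
by rewrite mulrBl; lra.
Qed.

(** The r uniform vertices are exchanged for sampled ones one at a time, each at a cost of alpha +
    k/q. *)
Lemma regular_dens (alpha : R) f r (js : seq Idx) : 0 <= alpha -> regular alpha f ->
  (size js + r = k)%N ->
  hdens r (map (xs f) js) - r%:R * (alpha + k%:R / q%:R) <=
  Av r (fun s : seq Idx => (ed H (map (xs f) (js ++ s)))%:R).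
Proof.
move=> a0 hreg; elim: r js => [|r IH] js hr.
  by rewrite /hdens !AvE mul0r subr0 /= !cats0.
have hs : (size js < k)%N by lia.
have := regular_step a0 hreg hs.
have -> : (k - size js = r.+1)%N by lia.
have -> : (k - (size js).+1 = r)%N by lia.
move=> h; rewrite AvE.
have M0 : 0 < #|{: Idx}|%:R :> R by rewrite card_prod !card_ord ltr0n muln_gt0 hq.
apply: le_trans (_ : _ <= (\sum_(i : Idx) (hdens r (map (xs f) js ++ [:: xs f i]) - r%:R * (alpha + k%:R / q%:R))) / #|{: Idx}|%:R) _.
  have cst (c : R) : \sum_(i : Idx) c = c * #|{: Idx}|%:R by rewrite sumr_const mulr_natr.
  rewrite sumrB cst mulrBl mulfK ?gt_eqF //.
  move: h; set a' := alpha + _; rewrite -[r.+1]addn1 natrD mulrDl mul1r; set ra := r%:R * a'; lra.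
rewrite ler_wpM2r ?invr_ge0 ?(ltW M0) //; apply: ler_sum => i _.
have := IH (rcons js i); rewrite size_rcons map_rcons -cats1 => /(_ _).
have hr' : ((size js).+1 + r = k)%N by lia.
move=> /(_ hr') h2; apply: le_trans h2 _.
by apply: ler_Av => s _; rewrite cat_rcons.
Qed.

(** The size of [e] is prescribed because [x] need not be injective, and larger sets could then have
    an edge as image. *)
Definition sample_edges (T : finType) (x : T -> V) : {set {set T}} :=
  [set e : {set T} | (#|e| == k) && (x @: e \in edges H)].

Lemma sample_uniform (T : finType) (x : T -> V) (e : {set T}) : e \in sample_edges x -> #|e| = k.
Proof. by rewrite inE => /andP[/eqP]. Qed.

Definition sample (T : finType) (x : T -> V) : kgraph k T := KGraph (@sample_uniform T x).

Lemma ed_sample (T : finType) (x : T -> V) (s : seq T) : size s = k ->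
  ed H (map x s) -> ed (sample x) s.
Proof.
move=> ss h; have us : uniq s.
  by apply: (@map_uniq _ _ x); apply: ed_uniq h; rewrite size_map.
rewrite /ed inE card_set_seq // ss eqxx /=.
have -> // : x @: [set z in s] = [set z in map x s].
apply/setP => v; rewrite inE; apply/imsetP/mapP => [[z]|[z hz ->]].
  by rewrite inE => hz ->; exists z.
by exists z; rewrite ?inE.
Qed.

Lemma regular_dense (alpha theta : R) f : 0 <= alpha -> regular alpha f ->
  injective (xs f) ->
  (forall w, uniq w -> size w = l -> theta <= hdens (k - l) w) ->
  dense (sample (xs f)) l (theta - (k - l)%:R * (alpha + k%:R / q%:R)).
Proof.
move=> a0 hreg hinj hw js ujs sjs.
have hs : (size js + (k - l) = k)%N by rewrite sjs subnKC.
apply: le_trans (_ : _ <= hdens (k - l) (map (xs f) js) - (k - l)%:R * (alpha + k%:R / q%:R)) _.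
  by rewrite lerD2r; apply: hw; rewrite ?map_inj_uniq // size_map.
apply: le_trans (regular_dens a0 hreg hs) _.
apply: ler_Av => s ss; apply: lebR; apply: ed_sample.
by rewrite size_cat sjs ss subnKC.
Qed.

End Sampling.

(** * Tilings by blow-ups *)

Section Pieces.
Variables (k l : nat) (V : finType) (H : kgraph k V).
Let y := (k + (k - 2 * l))%N.
Implicit Types (P : {ffun 'I_y -> {set V}}).

Definition blowup (b : nat) P : Prop :=
  [/\ forall v, (b <= #|P v|)%N,
      forall v v', v != v' -> [disjoint P v & P v'] &
      forall x : {ffun 'I_y -> V}, (forall v, x v \in P v) ->
        forall e, e \in edges (Y k (2 * l)) -> x @: e \in edges H].

Definition supp P : {set V} := \bigcup_v P v.

Definition piece_tiling (b : nat) (X : {set V}) (p : nat) : Prop :=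
  exists Ps : seq {ffun 'I_y -> {set V}},
    [/\ size Ps = p, forall P, P \in Ps -> blowup b P /\ (forall v, #|P v| = b),
        pdisj (map supp Ps) & Union (map supp Ps) \subset X].

Lemma piece_tiling0 b X : piece_tiling b X 0.
Proof. by exists [::]; split => //; rewrite /Union big_nil sub0set. Qed.

Lemma piece_tiling_sub b (X X' : {set V}) p : X \subset X' -> piece_tiling b X p -> piece_tiling b X' p.
Proof. by move=> h [Ps [h1 h2 h3 h4]]; exists Ps; split => //; exact: subset_trans h. Qed.

Lemma piece_tilingU b (X X' : {set V}) p p' : [disjoint X & X'] -> piece_tiling b X p -> piece_tiling b X' p' -> piece_tiling b (X :|: X') (p + p').
Proof.
move=> hd [Ps [h1 h2 h3 h4]] [Ps' [g1 g2 g3 g4]].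
exists (Ps ++ Ps'); split.
- by rewrite size_cat h1 g1.
- by move=> P; rewrite mem_cat => /orP[/h2|/g2].
- rewrite map_cat /pdisj pairwise_cat; apply/and3P; split => //.
  apply/allrelP => A A' hA hA'; apply: disjointWl (disjointWr _ hd).
    by apply: subset_trans h4; apply/subsetP => x hx; rewrite in_Union; apply/hasP; exists A.
  by apply: subset_trans g4; apply/subsetP => x hx; rewrite in_Union; apply/hasP; exists A'.
- rewrite map_cat /Union big_cat; exact: setUSS.
Qed.

Lemma piece_tiling_split b c P : blowup (c * b) P -> piece_tiling b (supp P) c.
Proof.
elim: c P => [|c IH] P [h1 h2 h3]; first exact: piece_tiling0.
have hA v : exists A : {set V}, (A \subset P v) && (#|A| == b).
  have hb : (b <= #|P v|)%N by apply: leq_trans (h1 v); rewrite mulSn leq_addr.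
  by have [A hA cA] := subset_card_eq hb; exists A; rewrite hA cA eqxx.
pose A v := xchoose (hA v).
have A1 v : A v \subset P v by have /andP[] := xchooseP (hA v).
have A2 v : #|A v| = b by have /andP[_ /eqP] := xchooseP (hA v).
pose PA : {ffun 'I_y -> {set V}} := [ffun v => A v].
pose PD : {ffun 'I_y -> {set V}} := [ffun v => P v :\: A v].
have hPD : blowup (c * b) PD.
  split.
  - move=> v; rewrite ffunE cardsD (setIidPr (A1 v)) A2.
    have := h1 v; rewrite mulSn; lia.
  - move=> v v' /h2; rewrite !ffunE; apply: disjointW; exact: subsetDl.
  - move=> x hx; apply: h3 => v; have := hx v; rewrite ffunE; exact: (subsetP (subsetDl _ _)).
have hPA : piece_tiling b (supp PA) 1.
  exists [:: PA]; split => //=; last by rewrite /Union big_seq1.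
  move=> P'; rewrite inE => /eqP ->; split; last by move=> v; rewrite ffunE A2.
  split.
  - by move=> v; rewrite ffunE A2.
  - by move=> v v' /h2; rewrite !ffunE; apply: disjointW; exact: A1.
  - move=> x hx; apply: h3 => v; have := hx v; rewrite ffunE; exact: (subsetP (A1 v)).
apply: (@piece_tiling_sub _ (supp PA :|: supp PD)).
  rewrite subUset; apply/andP; split; apply/subsetP => x /bigcupP[v _]; rewrite ffunE => hx; apply/bigcupP; exists v => //.
    exact: (subsetP (A1 v)).
  exact: (subsetP (subsetDl _ (A v))).
rewrite -add1n; apply: piece_tilingU hPA (IH _ hPD).
apply/disjointP => x /bigcupP[v _ hx] /bigcupP[v' _ hx'].
move: hx hx'; rewrite !ffunE inE => hx /andP[hx1 hx2].
case: (eqVneq v v') => [e|/h2 /disjointP hd]; first by move: hx1; rewrite -e hx.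
by apply: (hd x) => //; exact: (subsetP (A1 v)).
Qed.

End Pieces.

Lemma exists_term (R : realType) (J : finType) (f : J -> R) (c : R) (t : nat) :
  0 < c -> (#|J| <= t)%N -> c <= \sum_j f j -> exists j, c / t%:R <= f j.
Proof.
move=> c0 ht h; apply/existsP; apply: contraT; rewrite negb_exists => /forallP hn.
have hJ : (0 < #|J|)%N.
  rewrite lt0n; apply/eqP => hJ0; move: h; rewrite leNgt => /negP[].
  by rewrite big_pred0 // => j; have := fintype0 j hJ0.
have t0 : (0 < t)%N by exact: leq_trans ht.
suff : c < c by rewrite ltxx.
apply: le_lt_trans h _; apply: lt_le_trans (_ : _ < \sum_(j : J) c / t%:R) _.
  apply: ltr_sum => [|j _]; last by rewrite ltNge hn.
  by have /card_gt0P[j _] := hJ; apply/hasP; exists j; rewrite // mem_index_enum.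
rewrite sumr_const -[X in X <= _]mulr_natr mulrAC ler_pdivrMr ?ltr0n //.
by rewrite ler_wpM2l ?(ltW c0) // ler_nat.
Qed.

Lemma all2_map (A B C : Type) (r : B -> C -> bool) (f : A -> B) (g : A -> C) (s : seq A) :
  all2 r (map f s) (map g s) = all (fun a => r (f a) (g a)) s.
Proof. by elim: s => //= a s ->. Qed.

Section BoxExtract.
Context {R : realType}.
Variables (k l : nat) (V : finType) (H : kgraph k V).
Let y := (k + (k - 2 * l))%N.
Variables (T B : finType) (vx : T -> B -> V) (d : B).
Hypothesis vx_inj : forall i i' v v', vx i v = vx i' v' -> i = i' /\ v = v'.
Notation M := #|T|.

(** A list of length [#|T|] encodes a function from [T] to [B], so that averages over lists apply to
    such functions. *)
Definition at_ (s : seq B) (i : T) : B := nth d s (enum_rank i).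

Definition xsl (s : seq B) (i : T) : V := vx i (at_ s i).

Definition tiled (Tl : {set {ffun 'I_y -> T}}) (s : seq B) : bool :=
  `[< is_tiling (Y k (2 * l)) (sample H (xsl s)) Tl >].

Definition goodl (w : nat) (s : seq B) : bool :=
  [exists Tl : {set {ffun 'I_y -> T}}, tiled Tl s && (w <= #|Tl|)%N].

Lemma at_map (f : T -> B) i : at_ (map f (enum T)) i = f i.
Proof.
rewrite /at_ (nth_map i) ?nth_enum_rank //.
by rewrite -cardE; exact: ltn_ord.
Qed.

Lemma seq_enum (C : Type) (x0 : C) (s : seq C) : size s = M ->
  s = map (fun i : T => nth x0 s (enum_rank i)) (enum T).
Proof.
move=> hs; have hz : size (map (fun i : T => nth x0 s (enum_rank i)) (enum T)) = M.
  by rewrite size_map -cardE.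
apply: (@eq_from_nth _ x0); rewrite ?hz // => j; rewrite hs => hj.
have hj' : (j < size (enum T))%N by rewrite -cardE.
have t0 : T by case: (enum T) hj'.
by rewrite (nth_map t0) // -[j]/(nat_of_ord (Ordinal hj)) -(enum_val_nth t0) enum_valK.
Qed.

(** Since all choices from the box admit the same tiling [Tl], each of its copies spreads to a
    complete blow-up whose parts are the sides of the box. *)
Lemma box_piece_tiling b (X : seq {set B}) (Tl : {set {ffun 'I_y -> T}}) : (0 < b)%N ->
  size X = M -> all (fun A : {set B} => #|A| == b) X ->
  (forall s, in_box s X -> tiled Tl s) ->
  piece_tiling l H b (\bigcup_(i : T) [set vx i v | v in nth set0 X (enum_rank i)]) #|Tl|.
Proof.
move=> b0 sX bX hX; pose Xi (i : T) := nth set0 X (enum_rank i).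
have cX i : #|Xi i| = b.
  by apply/eqP; apply: (all_nthP set0 bX); rewrite sX; exact: ltn_ord.
have eX : X = map Xi (enum T) by exact: seq_enum.
have neX i : exists v, v \in Xi i.
  by apply/set0Pn; rewrite -card_gt0 cX.
pose w0 i := xchoose (neX i).
have w0X i : w0 i \in Xi i by exact: xchooseP.
have box f : (forall i, f i \in Xi i) -> tiled Tl (map f (enum T)).
  move=> hf; apply: hX; rewrite eX /in_box all2_map; apply/allP => i _; exact: hf.
have /asboolP[copy0 disj0] := box _ w0X.
have vinj i : injective (vx i) by move=> v v' /vx_inj[].
pose P (phi : {ffun 'I_y -> T}) : {ffun 'I_y -> {set V}} := [ffun v => [set vx (phi v) z | z in Xi (phi v)]].
have memP phi v x : x \in P phi v -> exists2 z, z \in Xi (phi v) & x = vx (phi v) z.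
  by rewrite ffunE => /imsetP[z hz ->]; exists z.
exists (map P (enum Tl)); split.
- by rewrite size_map -cardE.
- move=> P0 /mapP[phi]; rewrite mem_enum => hphi ->.
  have [phi_inj _] := copy0 phi hphi.
  have cP v : #|P phi v| = b by rewrite ffunE card_imset.
  split => //; split => [v|v v' hv|x hx e he]; first by rewrite cP.
    apply/disjointP => x /memP[z _ ->] /memP[z' _ /vx_inj[/phi_inj e _]].
    by move: hv; rewrite e eqxx.
  have hz v : exists z, (z \in Xi (phi v)) && (x v == vx (phi v) z).
    by have [z hz ->] := memP _ _ _ (hx v); exists z; rewrite hz eqxx.
  pose zz v := xchoose (hz v).
  have zz1 v : zz v \in Xi (phi v) by have /andP[] := xchooseP (hz v).
  have zz2 v : x v = vx (phi v) (zz v) by have /andP[_ /eqP] := xchooseP (hz v).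
  (* A transversal of the parts of [phi] prescribes a choice on the image of [phi] alone; elsewhere
     [w0] extends it to a choice from the whole box. *)
  pose f i := if [pick v | phi v == i] is Some v then zz v else w0 i.
  have hf i : f i \in Xi i by rewrite /f; case: pickP => // v /eqP <-; exact: zz1.
  have /asboolP[copy _] := box f hf.
  have [_ /(_ e he)] := copy phi hphi.
  rewrite inE => /andP[_]; rewrite -imset_comp.
  have -> // : (xsl (map f (enum T)) \o phi) @: e = x @: e.
  apply: eq_imset => v; rewrite /= /xsl at_map zz2; congr (vx _ _).
  by rewrite /f; case: pickP => [v' /eqP /phi_inj ->|/(_ v)] //; rewrite eqxx.
- rewrite -map_comp /pdisj pairwise_map.
  have : uniq (enum Tl) by exact: enum_uniq.
  have : {subset enum Tl <= Tl} by move=> phi; rewrite mem_enum.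
  elim: (enum Tl) => [//|phi s IH] hs /= /andP[h1 h2]; apply/andP; split; last first.
    by apply: IH => // psi hpsi; apply: hs; rewrite inE hpsi orbT.
  apply/allP => psi hpsi.
  have hne : phi != psi by apply: contra h1 => /eqP ->.
  have := disj0 phi psi (hs _ (mem_head _ _)) (hs psi _) hne; rewrite inE hpsi orbT => /(_ isT) hd.
  apply/disjointP => x /bigcupP[v _ /memP[z _ ->]] /bigcupP[v' _ /memP[z' _ /vx_inj[e _]]].
  have /disjointP/(_ (phi v)) := hd; apply; first exact: imset_f.
  by rewrite e; exact: imset_f.
- apply/subsetP => x; rewrite in_Union => /hasP[_ /mapP[_ /mapP[phi _ ->] ->]] /bigcupP[v _ /memP[z hz ->]].
  by apply/bigcupP; exists (phi v) => //; apply: imset_f.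
Qed.

Lemma Av_avoid (Us : seq {set B}) : (0 < #|B|)%N ->
  Av (size Us) (fun s => (~~ all2 (fun v (U : {set B}) => v \notin U) s Us)%:R) <=
  (\sum_(U <- Us) #|U|%:R) / #|B|%:R :> R.
Proof.
move=> hB; elim: Us => [|U Us IH]; first by rewrite AvE big_nil mul0r.
rewrite big_cons mulrDl /= -[(size Us).+1]add1n Av_cat.
apply: le_trans (_ : _ <= Av 1 (fun v => Av (size Us) (fun s =>
   (has (mem U) v)%:R + (~~ all2 (fun v (U : {set B}) => v \notin U) s Us)%:R))) _.
  apply: ler_Av => -[//|v []] // _; apply: ler_Av => s hs /=.
  by rewrite negb_and negbK orbF; case: (v \in U); case: all2; rewrite /=; lra.
under eq_Av do rewrite AvD Av_const //.
rewrite AvD Av_const //; apply: lerD => //.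
by apply: le_trans (Av_hit _ _ hB) _; rewrite mul1r.
Qed.

(** Boxes are extracted r times. The sides used so far are met by at most a kappa/2 share of the
    lists, so a share of kappa/2 with good tilings remains for the next box. *)
Lemma box_extract (b w r b0 : nat) (kappa : R) : (0 < b)%N -> 0 < kappa -> (0 < #|B|)%N ->
  (b0 <= #|B|)%N ->
  (forall G : pred (seq B), kappa / 2 / #|{: {set {ffun 'I_y -> T}}}|%:R <= Av M (fun s => (G s)%:R) ->
    exists X : seq {set B}, [/\ size X = M, all (fun A : {set B} => #|A| == b) X &
      forall s, in_box s X -> G s]) ->
  kappa <= Av M (fun s => (goodl w s)%:R) ->
  (M * (r * b))%:R <= kappa / 2 * #|B|%:R ->
  exists U : {ffun T -> {set B}}, (forall i, #|U i| = (r * b)%N) /\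
    exists2 p, (r * w <= p)%N & piece_tiling l H b (\bigcup_i [set vx i v | v in U i]) p.
Proof.
move=> hb k0 hB hb0 hbox hgood; elim: r => [|r IH] hr.
  exists [ffun _ => set0]; split; first by move=> i; rewrite ffunE cards0.
  by exists 0%N; [|exact: piece_tiling0].
have [|U [cU [p hp hTil]]] := IH.
  by apply: le_trans hr; rewrite ler_nat leq_mul2l leq_mul2r leqnSn !orbT.
pose Us := map U (enum T).
have sUs : size Us = M by rewrite size_map -cardE.
pose av (s : seq B) := all2 (fun v (U : {set B}) => v \notin U) s Us.
have hav : Av M (fun s => (~~ av s)%:R) <= kappa / 2.
  rewrite -sUs; apply: le_trans (Av_avoid Us hB) _; rewrite ler_pdivrMr ?ltr0n //.
  apply: le_trans hr; rewrite /Us big_map.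
  rewrite (eq_bigr (fun _ => (r * b)%:R)); last by move=> i _; rewrite cU.
  rewrite big_enum /= sumr_const -[X in X <= _]mulr_natr -natrM ler_nat mulnC leq_mul2l leq_mul2r leqnSn.
  by rewrite !orbT.
pose G Tl s := [&& tiled Tl s, (w <= #|Tl|)%N & av s].
have h1 : kappa / 2 <= \sum_(Tl : {set {ffun 'I_y -> T}}) Av M (fun s => (G Tl s)%:R).
  rewrite -Av_sum; apply: le_trans (_ : _ <= Av M (fun s => (goodl w s)%:R - (~~ av s)%:R)) _.
    by rewrite AvB; lra.
  apply: ler_Av => s _; case: (boolP (av s)) => hs /=; last first.
    by apply: le_trans (_ : _ <= 0) _; [rewrite subr_le0 lern1 leq_b1|apply: sumr_ge0].
  rewrite subr0; case: (boolP (goodl w s)) => [/existsP[Tl /andP[t1 t2]]|_] /=; last by apply: sumr_ge0.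
  rewrite (bigD1 Tl) //= /G t1 t2 hs; apply: ler_wpDr => //; by apply: sumr_ge0.
(* Pigeonhole over all sets of embeddings fixes one tiling common to many lists. *)
have [Tl hTl] := exists_term (t := #|{: {set {ffun 'I_y -> T}}}|) (divr_gt0 k0 (ltr0Sn _ 1)) (leqnn _) h1.
have [X [sX bX hX]] := hbox (G Tl) hTl.
pose Xi (i : T) := nth set0 X (enum_rank i).
have cX i : #|Xi i| = b.
  by apply/eqP; apply: (all_nthP set0 bX); rewrite sX; exact: ltn_ord.
have eX : X = map Xi (enum T) by exact: seq_enum.
have neX i : exists v, v \in Xi i.
  by apply/set0Pn; rewrite -card_gt0 cX.
pose w0 i := xchoose (neX i).
have w0X i : w0 i \in Xi i by exact: xchooseP.
have box f : (forall i, f i \in Xi i) -> G Tl (map f (enum T)).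
  move=> hf; apply: hX; rewrite eX /in_box all2_map; apply/allP => i _; exact: hf.
have /and3P[_ wTl _] := box _ w0X.
(* Each point of a side occurs in some list from the box, and all these lists avoid the used sides;
   hence the new box is disjoint from the old ones. *)
have dXU i v : v \in Xi i -> v \notin U i.
  move=> hv; pose f j := if j == i then v else w0 j.
  have hf j : f j \in Xi j by rewrite /f; case: eqP => [->|].
  have /and3P[_ _] := box f hf; rewrite /av /Us all2_map => /allP/(_ i (mem_enum _ i)).
  by rewrite /f eqxx.
exists [ffun i => Xi i :|: U i]; split.
  move=> i; rewrite ffunE cardsU cX cU.
  have -> : Xi i :&: U i = set0.
    by apply/setP => v; rewrite !inE; case hv: (v \in Xi i); rewrite //= (negbTE (dXU _ _ hv)).
  by rewrite cards0 subn0 mulSn.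
exists (#|Tl| + p)%N; first by rewrite mulSn leq_add.
have hT1 := box_piece_tiling hb sX bX (fun s hs => proj1 (andP (hX s hs))).
apply: piece_tiling_sub (piece_tilingU _ hT1 hTil).
  rewrite subUset; apply/andP; split; apply/bigcupsP => i _; apply: subset_trans (bigcup_sup i _) => //.
    by rewrite ffunE imsetU subsetUl.
  by rewrite ffunE imsetU subsetUr.
apply/disjointP => x /bigcupP[i _ /imsetP[v hv ->]] /bigcupP[i' _ /imsetP[v' hv' /vx_inj[ei ev]]].
by move: hv'; rewrite -ei -ev (negbTE (dXU _ _ hv)).
Qed.

End BoxExtract.

Section TupleCount.
Context {R : realType}.
Variables (k l : nat) (V : finType) (H : kgraph k V).
Let y := (k + (k - 2 * l))%N.
Variables (I B : finType) (pos : I -> 'I_y -> B -> V) (q : nat) (d : B) (fk : pred I).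
Hypotheses (hlk : (l <= k)%N) (hk : (0 < k)%N) (hI : (0 < #|I|)%N) (hq : (0 < q)%N) (hkq : (k <= q)%N).
Hypothesis pos_inj : forall i v b i' v' b', pos i v b = pos i' v' b' -> [/\ i = i', v = v' & b = b'].

Let Idx := ('I_q * 'I_y)%type.
Let Z := (I * {ffun 'I_y -> B})%type.

Definition vxu (u : {ffun 'I_q -> I}) (i : Idx) (b : B) : V := pos (u i.1) i.2 b.

(** A sample is separated into the choice [u] of the items and the choice [t] of vertices in them,
    because blow-ups are replaced for a fixed tuple of items. *)
Definition mk (u : {ffun 'I_q -> I}) (t : #|{: Idx}|.-tuple B) : {ffun 'I_q -> Z} :=
  [ffun j => (u j, [ffun v => tnth t (enum_rank (j, v))])].

Lemma xs_mk u (t : #|{: Idx}|.-tuple B) i : xs pos (mk u t) i = xsl (vxu u) d t i.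
Proof.
rewrite /xs /xz /xsl /vxu ffunE /= ffunE /at_ (tnth_nth d).
by rewrite -surjective_pairing.
Qed.

Lemma sum_mk (F : {ffun 'I_q -> Z} -> R) :
  \sum_f F f = \sum_u \sum_(t : #|{: Idx}|.-tuple B) F (mk u t).
Proof.
rewrite pair_bigA /=.
rewrite (reindex (fun p : {ffun 'I_q -> I} * #|{: Idx}|.-tuple B => mk p.1 p.2)) //=.
exists (fun f : {ffun 'I_q -> Z} => ([ffun j => (f j).1],
   [tuple (f (enum_val i).1).2 (enum_val i).2 | i < #|{: Idx}|])) => [[u t] _|f _] /=.
  congr pair; first by apply/ffunP => j; rewrite !ffunE.
  apply: eq_from_tnth => i; rewrite tnth_mktuple !ffunE /= -surjective_pairing enum_valK.
  by [].
apply/ffunP => j; rewrite !ffunE /=; case e : (f j) => [a b] /=; congr pair.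
by apply/ffunP => v; rewrite !ffunE tnth_mktuple enum_rankK /= e.
Qed.

Variables (alpha theta phi : R) (w : nat).
Hypotheses (a0 : 0 <= alpha) (a1 : alpha <= 1).
Hypothesis hirr : (k * (q * y) ^ k)%:R * expR (- (alpha ^+ 2 / 4)) ^+ (q - k) <= 1 / 8 :> R.
Hypothesis hN : q%:R ^+ 2 / #|I|%:R <= 1 / 4 :> R.
Hypothesis hphi : phi <= #|fk|%:R / #|I|%:R.
Hypothesis hdens_ge : forall s, uniq s -> size s = l -> theta <= hdens H pos (k - l) s.
Hypothesis hthr : forall G : kgraph k Idx,
  dense G l (theta - (k - l)%:R * (alpha + k%:R / q%:R)) ->
  exists Tl : {set {ffun 'I_y -> Idx}}, is_tiling (Y k (2 * l)) G Tl /\ (w <= #|Tl|)%N.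

(* fk marks the items that are uncovered blocks: a tiling of their samples is
   a net gain. *)
Definition nfake (u : {ffun 'I_q -> I}) : nat := #|[set j | fk (u j)]|.

Definition good_tuple (u : {ffun 'I_q -> I}) : bool :=
  [&& injectiveb u, (phi - alpha) * q%:R <= (nfake u)%:R &
   1 / 4 <= Av #|{: Idx}| (fun s => (goodl l H (vxu u) d w s)%:R) :> R].

(** All but 1/4 of the samples are regular and have enough uncovered blocks. If [u] is injective but
    not good, at most 1/4 of its vertex choices are of this kind, and at most 1/4 of all [u] are not
    injective; this leaves 1/4 for good tuples. *)
Lemma tuple_count : (1 / 4) * (#|I| ^ q)%:R <= #|[set u | good_tuple u]|%:R :> R.
Proof.
have hB : (0 < #|B|)%N by apply/card_gt0P; exists d.
have hy : (0 < y)%N by rewrite /y; lia.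
have ZZ0 : (0 < #|{ffun 'I_q -> Z}|)%N by rewrite card_ffun expn_gt0 (card_Z_gt0 y hI hB).
have ZZR : 0 < #|{ffun 'I_q -> Z}|%:R :> R by rewrite ltr0n.
pose rho : R := expR (- (alpha ^+ 2 / 4)).
pose fdev := deviates set0 (fun (_ : {ffun 'I_q -> Z}) (z : Z) => (fk z.1)%:R : R) alpha.
have hfd : #|[set f | fdev f]|%:R <= 1 / 8 * #|{ffun 'I_q -> Z}|%:R :> R.
  apply: le_trans (chernoff (card_Z_gt0 y hI hB) a0 a1 _ _) _ => //.
    by move=> f z; rewrite ler0n lern1 leq_b1.
  rewrite mulrC ler_wpM2r // finset.setC0 cardsT card_ord.
  apply: le_trans hirr; rewrite -[leLHS]mul1r.
  have r0 : 0 <= rho by exact: expR_ge0.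
  have r1 : rho <= 1 by rewrite /rho -expR0 ler_expR oppr_le0 divr_ge0 // exprn_ge0.
  apply: ler_pM; rewrite ?exprn_ge0 //.
    by rewrite ler1n muln_gt0 hk expn_gt0 muln_gt0 hq hy.
  by apply: ler_wiXn2l => //; exact: leq_subr.
have hir : #|[set f : {ffun 'I_q -> Z} | ~~ regular H pos alpha f]|%:R <= 1 / 8 * #|{ffun 'I_q -> Z}|%:R :> R.
  have hh := card_irregular H pos hlk hI hy hB hq a0 a1 hkq.
  by apply: le_trans hh _; rewrite ler_wpM2r.
pose okf (f : {ffun 'I_q -> Z}) := regular H pos alpha f && ~~ fdev f.
have hok : 3 / 4 * #|{ffun 'I_q -> Z}|%:R <= \sum_f (okf f)%:R :> R.
  have : \sum_(f : {ffun 'I_q -> Z}) 1 <= \sum_f ((okf f)%:R + ((~~ regular H pos alpha f)%:R + (fdev f)%:R)) :> R.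
    by apply: ler_sum => f _; rewrite /okf; case: (regular _ _ _ f); case: (fdev f); rewrite /=; lra.
  rewrite sumr_const !big_split /= -[#|xpredT|]/#|{ffun 'I_q -> Z}|.
  have := hfd; rewrite cardsE -(sum_bool fdev).
  have := hir; rewrite cardsE -(sum_bool (fun f : {ffun 'I_q -> Z} => ~~ regular H pos alpha f)).
  lra.
have BM0 : 0 < (#|B| ^ #|{: Idx}|)%:R :> R by rewrite ltr0n expn_gt0 hB.
have cZ : #|{ffun 'I_q -> Z}| = (#|I| ^ q * #|B| ^ #|{: Idx}|)%N.
  by rewrite card_ffun !card_prod card_ffun !card_ord expnMn -expnM mulnC [(y * q)%N]mulnC mulnC.
pose A (u : {ffun 'I_q -> I}) : R := Av #|{: Idx}| (fun s => (goodl l H (vxu u) d w s)%:R).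
have key (u : {ffun 'I_q -> I}) : injectiveb u ->
  (\sum_(t : #|{: Idx}|.-tuple B) (okf (mk u t))%:R) / (#|B| ^ #|{: Idx}|)%:R <=
  ((phi - alpha) * q%:R <= (nfake u)%:R)%R%:R * A u.
  move=> /injectiveP uinj; rewrite /A Av_tuple mulrA; apply: ler_wpM2r; first by rewrite invr_ge0 ltW.
  rewrite mulr_sumr; apply: ler_sum => t _; rewrite -natrM mulnb; apply: lebR.
  move=> /andP[hreg hnd]; apply/andP; split.
    move: hnd; rewrite /fdev /deviates -leNgt finset.setC0 cardsT card_ord.
    have -> : mean (fun z : Z => (fk z.1)%:R : R) = #|fk|%:R / #|I|%:R.
      rewrite /mean -(pair_bigA _ (fun i (_ : {ffun 'I_y -> B}) => (fk i)%:R : R)) /= card_prod natrM.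
      have -> : \sum_(i : I) \sum_(j : {ffun 'I_y -> B}) (fk i)%:R = #|fk|%:R * #|{ffun 'I_y -> B}|%:R :> R.
        by rewrite -(sum_bool fk) mulr_suml; apply: eq_bigr => i _; rewrite sumr_const mulr_natr.
      rewrite -mulf_div divff ?mulr1 // pnatr_eq0 -lt0n card_ffun expn_gt0 hB //.
    have -> : \sum_(j in [set: 'I_q]) (fk (mk u t j).1)%:R = (nfake u)%:R :> R.
      rewrite /nfake cardsE -(sum_bool (fun j => fk (u j))) big_mkcond /=.
      by apply: eq_bigr => j _; rewrite inE ffunE.
    by move=> h; apply: le_trans h; rewrite mulrC ler_wpM2l // lerD2r.
  have xinj : injective (xs pos (mk u t)).
    move=> [j v] [j' v']; rewrite /xs /xz !ffunE /= => /pos_inj[/uinj -> -> _].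
    by [].
  have [Tl [hTl wTl]] := hthr (regular_dense hlk hI hy hB hq a0 hreg xinj hdens_ge).
  apply/existsP; exists Tl; rewrite wTl andbT; apply/asboolP.
  have -> // : xsl (vxu u) d t = xs pos (mk u t).
  by apply/funext => i; rewrite xs_mk.
have A0 u : 0 <= A u by exact: Av_bool_ge0.
have A1 u : A u <= 1 by exact: Av_bool_le1.
have hsum : 3 / 4 * (#|I| ^ q)%:R <= \sum_u (good_tuple u)%:R + 1 / 4 * (#|I| ^ q)%:R + \sum_(u : {ffun 'I_q -> I}) (~~ injectiveb u)%:R :> R.
  have -> : 1 / 4 * (#|I| ^ q)%:R = \sum_(u : {ffun 'I_q -> I}) (1 / 4) :> R.
    by rewrite sumr_const card_ffun card_ord mulr_natr.
  rewrite -!big_split /=.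
  move: hok; rewrite sum_mk cZ natrM mulrA -ler_pdivlMr // => h; apply: le_trans h _.
  rewrite mulr_suml; apply: ler_sum => u _.
  case: (boolP (injectiveb u)) => hu /=.
    apply: le_trans (key u hu) _; rewrite /good_tuple hu /=.
    case: (_ <= (nfake u)%:R) => /=; rewrite ?mul0r ?mul1r; last by lra.
    by rewrite -/(A u); case: (leP 4^-1 (A u)) => h5 /=; have := A1 u; lra.
  apply: le_trans (_ : _ <= 1) _; last first.
    have : 0 <= (good_tuple u)%:R :> R by [].
    lra.
  rewrite ler_pdivrMr // mul1r.
  apply: le_trans (_ : _ <= \sum_(t : #|{: Idx}|.-tuple B) 1) _.
    by apply: ler_sum => t _; rewrite lern1 leq_b1.
  by rewrite sumr_const card_tuple.
have hninj : \sum_(u : {ffun 'I_q -> I}) (~~ injectiveb u)%:R <= 1 / 4 * (#|I| ^ q)%:R :> R.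
  have h1 : \sum_(u : {ffun 'I_q -> I}) (injectiveb u)%:R = (#|I| ^_ q)%:R :> R.
    by rewrite (sum_bool (fun u : {ffun 'I_q -> I} => injectiveb u)) -cardsE card_inj_ffuns card_ord.
  have h2 : \sum_(u : {ffun 'I_q -> I}) (injectiveb u)%:R + \sum_(u : {ffun 'I_q -> I}) (~~ injectiveb u)%:R = (#|I| ^ q)%:R :> R.
    rewrite -big_split /= (eq_bigr (fun _ => 1)); last by move=> u _; case: injectiveb; rewrite /= ?addr0 ?add0r.
    by rewrite sumr_const card_ffun card_ord.
  have h3 := @ffact_lower R #|I| q hI.
  have h4 : 0 <= (#|I| ^ q)%:R :> R by [].
  have h5 : (1 - 1 / 4) * (#|I| ^ q)%:R <= (#|I| ^_ q)%:R :> R.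
    by apply: le_trans h3; rewrite ler_wpM2r // lerD2l lerN2.
  move: h2; rewrite h1; lra.
rewrite cardsE -(sum_bool good_tuple); lra.
Qed.

End TupleCount.

(** * Exchanging blow-ups for a net gain *)

Section Improve.
Context {R : realType}.
Variables (k l : nat) (V : finType) (H : kgraph k V).
Let y := (k + (k - 2 * l))%N.

Lemma piece_tiling_list (b c : nat) (J : eqType) (X : J -> {set V}) (s : seq J) : uniq s ->
  (forall j j', j != j' -> [disjoint X j & X j']) -> (forall j, j \in s -> piece_tiling l H b (X j) c) ->
  piece_tiling l H b (\bigcup_(j <- s) X j) (size s * c).
Proof.
move=> us hd; elim: s us => [|j s IH] /= us hs; first by rewrite big_nil; exact: piece_tiling0.
move: us => /andP[hj us]; rewrite big_cons mulSn; apply: piece_tilingU.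
- apply/disjointP => x hx; elim: (s) hj => [|j' s' IH'] hj; first by rewrite big_nil inE.
  move: hj; rewrite inE negb_or => /andP[hjj' hj]; rewrite big_cons inE => /orP[hx'|]; last exact: IH'.
  by have /disjointP/(_ x hx hx') := hd j j' hjj'.
- by apply: hs; rewrite mem_head.
- by apply: IH => // j' hj'; apply: hs; rewrite inE hj' orbT.
Qed.

Variables (I B : finType) (pos : I -> 'I_y -> B -> V) (q : nat) (d : B) (fk : pred I).
Hypotheses (hk : (0 < k)%N) (hI : (0 < #|I|)%N) (hq : (0 < q)%N).
Hypothesis pos_inj : forall i v b i' v' b', pos i v b = pos i' v' b' -> [/\ i = i', v = v' & b = b'].
Variables (b c r w : nat) (alpha phi : R) (b0 : nat).
Hypotheses (hb : (0 < b)%N) (cB : #|B| = (c * b)%N) (hc : (0 < c)%N).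

Definition part (i : I) : {ffun 'I_y -> {set V}} := [ffun v => [set pos i v z | z in [set: B]]].

Hypothesis hreal : forall i, ~~ fk i -> blowup H (c * b) (part i).
Hypothesis hb0 : (b0 <= #|B|)%N.
Hypothesis hbox : forall G : pred (seq B),
    1 / 4 / 2 / #|{: {set {ffun 'I_y -> 'I_q * 'I_y}}}|%:R <= Av #|{: 'I_q * 'I_y}| (fun s => (G s)%:R) :> R ->
    exists X : seq {set B}, [/\ size X = #|{: 'I_q * 'I_y}|, all (fun A : {set B} => #|A| == b) X &
      forall s, in_box s X -> G s].
Hypothesis hr : (8 * #|{: 'I_q * 'I_y}| * r <= c)%N.
Hypothesis hgain : forall n : nat, (phi - alpha) * q%:R <= n%:R -> (q < w + n)%N.

Lemma mem_part i v x : x \in part i v -> exists z, x = pos i v z.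
Proof. by rewrite ffunE => /imsetP[z _ ->]; exists z. Qed.

Lemma part_disjoint i i' : i != i' -> [disjoint supp (part i) & supp (part i')].
Proof.
move=> hii; apply/disjointP => x /bigcupP[v _ /mem_part[z ->]] /bigcupP[v' _ /mem_part[z' /pos_inj[e _ _]]].
by move: hii; rewrite e eqxx.
Qed.

(** Each real item gives up r of its c pieces, while the boxes yield r w new ones. Blocks of
    uncovered vertices give up nothing, so there are only q - nfake losses of r; as w exceeds this
    number, the gain is at least r. *)
Lemma tuple_gain (u : {ffun 'I_q -> I}) : good_tuple H pos d fk alpha phi w u ->
  exists2 p, ((q - nfake fk u) * c + r <= p)%N &
    piece_tiling l H b (\bigcup_j supp (part (u j))) p.
Proof.
move=> /and3P[/injectiveP uinj hnf hA].
have hgn := hgain hnf.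
have vinj (i i' : 'I_q * 'I_y) v v' : vxu pos u i v = vxu pos u i' v' -> i = i' /\ v = v'.
  case: i i' => [j x] [j' x'] /= /pos_inj /= [/uinj -> -> ->].
  by [].
have hB : (0 < #|B|)%N by rewrite cB muln_gt0 hc.
have M0 : (0 < #|{: 'I_q * 'I_y}|)%N by rewrite card_prod !card_ord muln_gt0 hq /y; lia.
have rc : (r <= c)%N by apply: leq_trans hr; rewrite leq_pmull // muln_gt0.
have k4 : 0 < 1 / 4 :> R by [].
have hrM : (#|{: 'I_q * 'I_y}| * (r * b))%:R <= 1 / 4 / 2 * #|B|%:R :> R.
  rewrite (_ : 1 / 4 / 2 = 8^-1); last by field.
  rewrite mulrC ler_pdivlMr // -natrM ler_nat cB.
  by apply: leq_trans (leq_mul hr (leqnn b)); rewrite !mulnA mulnAC [(_ * 8)%N]mulnC !mulnA mulnAC.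
have [U [cU [p hp hTil]]] := box_extract vinj hb k4 hB hb0 hbox hA hrM.
pose P' j : {ffun 'I_y -> {set V}} := [ffun v => [set pos (u j) v z | z in ~: U (j, v)]].
have memP' j v x : x \in P' j v -> exists2 z, z \notin U (j, v) & x = pos (u j) v z.
  by rewrite ffunE => /imsetP[z]; rewrite inE => hz ->; exists z.
have subP' j v : P' j v \subset part (u j) v.
  by apply/subsetP => x /memP'[z hz ->]; rewrite ffunE; apply: imset_f.
have hP' j : ~~ fk (u j) -> piece_tiling l H b (supp (P' j)) (c - r).
  move=> /hreal[_ h2 h3]; apply: piece_tiling_split; split.
  - move=> v; rewrite ffunE card_imset; last by move=> z z' /pos_inj[].
    by rewrite mulnBl leq_subLR -cB -(cU (j, v)) cardsC.
  - by move=> v v' hv; apply: disjointW (h2 v v' hv).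
  - by move=> x hx; apply: h3 => v; exact: (subsetP (subP' j v)).
have dP' j j' : j != j' -> [disjoint supp (P' j) & supp (P' j')].
  move=> hjj; apply/disjointP => x /bigcupP[v _ /memP'[z _ ->]] /bigcupP[v' _ /memP'[z' _ /pos_inj[/uinj e _ _]]].
  by move: hjj; rewrite e eqxx.
pose s := enum [set j | ~~ fk (u j)].
have hs : size s = (q - nfake fk u)%N.
  rewrite /s -cardE /nfake; have := cardsC [set j | fk (u j)]; rewrite card_ord.
  have -> : ~: [set j | fk (u j)] = [set j | ~~ fk (u j)] by apply/setP => j; rewrite !inE.
  by lia.
have h1 : piece_tiling l H b (\bigcup_(j <- s) supp (P' j)) (size s * (c - r)).
  apply: piece_tiling_list => //; first exact: enum_uniq.
  by move=> j; rewrite mem_enum inE; exact: hP'.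
exists (size s * (c - r) + p)%N.
  rewrite hs; apply: leq_trans (leq_add (leqnn _) hp).
  have hn : (nfake fk u <= q)%N by rewrite /nfake (leq_trans (max_card _)) // card_ord.
  have hw : (q - nfake fk u < w)%N by lia.
  rewrite mulnBr; set a := (q - nfake fk u)%N in hw *.
  have : (a * r <= a * c)%N by rewrite leq_mul2l rc orbT.
  have : (r * a.+1 <= r * w)%N by rewrite leq_mul2l hw orbT.
  by rewrite mulnS [(r * a)%N]mulnC; lia.
apply: piece_tiling_sub (piece_tilingU _ h1 hTil).
  rewrite subUset; apply/andP; split.
    apply/subsetP => x; rewrite -(big_map (fun j => supp (P' j)) xpredT id) -/(Union _) in_Union.
    move=> /hasP[X /mapP[j _ ->]] /bigcupP[v _ hx]; apply/bigcupP; exists j => //.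
    by apply/bigcupP; exists v => //; exact: (subsetP (subP' j v)).
  apply/bigcupsP => -[j v] _; apply/subsetP => x /imsetP[z _ ->].
  apply/bigcupP; exists j => //; apply/bigcupP; exists v => //.
  by rewrite ffunE; apply: imset_f.
apply/disjointP => x; rewrite -(big_map (fun j => supp (P' j)) xpredT id) -/(Union _) in_Union.
move=> /hasP[X /mapP[j _ ->]] /bigcupP[v _ /memP'[z hz ->]] /bigcupP[[j' v'] _ /imsetP[z' hz' /pos_inj[/= /uinj ej ev ez]]].
by move: hz; rewrite ej ev ez hz'.
Qed.

Lemma card_hit (W : {set I}) :
  (#|[set u : {ffun 'I_q -> I} | [exists j, u j \in W]]| <= q * (#|W| * #|I| ^ q.-1))%N.
Proof.
apply: leq_trans (_ : _ <= #|\bigcup_j [set u : {ffun 'I_q -> I} | u j \in W]|)%N _.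
  apply: subset_leq_card; apply/subsetP => u; rewrite inE => /existsP[j hj].
  by apply/bigcupP; exists j => //; rewrite inE.
refine (leq_trans (card_bigcup_le _) _).
have -> : (q * (#|W| * #|I| ^ q.-1) = \sum_(j < q) #|W| * #|I| ^ q.-1)%N by rewrite sum_nat_const card_ord.
apply: leq_sum => j _.
rewrite -(ler_nat R) cardsE -(sum_bool (fun u : {ffun 'I_q -> I} => u j \in W)).
rewrite (@sum_marginal R _ _ j (fun i => (i \in W)%:R)) (sum_bool (fun i => i \in W)).
by rewrite -natrM mulnC.
Qed.

Hypothesis hcount : (1 / 4) * (#|I| ^ q)%:R <=
  #|[set u : {ffun 'I_q -> I} | good_tuple H pos d fk alpha phi w u]|%:R :> R.

(** At most q |W| |I|^(q-1) tuples meet the used items [W]. While |W| <= q t this is below the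
    quarter of all tuples that are good, so a disjoint good tuple exists. *)
Lemma greedy_tuples t : (4 * q * (q * t) <= #|I|)%N ->
  exists W : {set I}, (#|W| <= q * t)%N /\
   exists2 p, (#|[set i in W | ~~ fk i]| * c + t * r <= p)%N &
     piece_tiling l H b (\bigcup_(i in W) supp (part i)) p.
Proof.
elim: t => [|t IH] ht.
  exists set0; split; first by rewrite cards0.
  exists 0%N; last exact: piece_tiling0.
  rewrite mul0n addn0; have -> : [set i in set0 | ~~ fk i] = set0 by apply/setP => i; rewrite !inE.
  by rewrite cards0.
have [|W [cW [p hp hT]]] := IH.
  by apply: leq_trans ht; rewrite !leq_mul2l leqnSn !orbT.
have : [exists u : {ffun 'I_q -> I}, good_tuple H pos d fk alpha phi w u && ~~ [exists j, u j \in W]].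
  apply: contraT; rewrite negb_exists => /forallP hn.
  have h1 : (#|[set u : {ffun 'I_q -> I} | good_tuple H pos d fk alpha phi w u]| <= q * (#|W| * #|I| ^ q.-1))%N.
    apply: leq_trans (card_hit W); apply: subset_leq_card; apply/subsetP => u.
    by rewrite !inE => gu; have := hn u; rewrite gu negbK.
  have h2 : (4 * (q * (#|W| * #|I| ^ q.-1)) < #|I| ^ q)%N.
    have -> : (#|I| ^ q = #|I| * #|I| ^ q.-1)%N by rewrite -expnS prednK.
    rewrite !mulnA ltn_pmul2r ?expn_gt0 ?hI //.
    apply: leq_trans ht; apply: leq_ltn_trans (_ : _ <= 4 * q * (q * t))%N _.
      by rewrite leq_mul2l cW orbT.
    by rewrite ltn_pmul2l ?muln_gt0 ?hq // ltn_pmul2l.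
  have h3 : (#|I| ^ q)%:R <= (4 * (q * (#|W| * #|I| ^ q.-1)))%:R :> R.
    rewrite natrM; move: hcount; rewrite -(ler_nat R) in h1; lra.
  by move: h2; rewrite -(ltr_nat R) ltNge h3.
case/existsP => u /andP[gu hu].
have [p' hp' hT'] := tuple_gain gu.
have /injectiveP uinj : injectiveb u by case/and3P: gu.
pose W' := [set u j | j in [set: 'I_q]].
have hWW' : [disjoint W' & W].
  apply/disjointP => i /imsetP[j _ ->] hj; move/negP: hu; apply; apply/existsP; by exists j.
exists (W' :|: W); split.
  apply: leq_trans (leq_card_setU _ _) _; rewrite mulnS leq_add //.
  by rewrite card_imset // cardsT card_ord.
exists (p' + p)%N.
  have e1 : [set i in W' :|: W | ~~ fk i] = [set i in W' | ~~ fk i] :|: [set i in W | ~~ fk i].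
    by apply/setP => i; rewrite !inE andb_orl.
  have e2 : (#|[set i in W' | ~~ fk i]| <= q - nfake fk u)%N.
    have -> : (q - nfake fk u = #|[set j | ~~ fk (u j)]|)%N.
      have := cardsC [set j | fk (u j)]; rewrite card_ord.
      have -> : ~: [set j | fk (u j)] = [set j | ~~ fk (u j)] by apply/setP => j; rewrite !inE.
      by move=> hh; rewrite -{1}hh /nfake addKn.
    rewrite -(card_imset [set j | ~~ fk (u j)] uinj); apply: subset_leq_card.
    apply/subsetP => i; rewrite inE => /andP[/imsetP[j _ ->] hj]; apply: imset_f; by rewrite inE.
  have e3 := leq_card_setU [set i in W' | ~~ fk i] [set i in W | ~~ fk i].
  rewrite e1; apply: leq_trans (leq_add hp' hp).
  apply: leq_trans (_ : _ <= (q - nfake fk u + #|[set i in W | ~~ fk i]|) * c + t.+1 * r)%N _.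
    by rewrite leq_add2r leq_mul2r (leq_trans e3) ?leq_add2r ?orbT.
  by rewrite mulnDl mulSn; lia.
have -> : \bigcup_(i in W' :|: W) supp (part i) = \bigcup_j supp (part (u j)) :|: \bigcup_(i in W) supp (part i).
  rewrite bigcup_setU; congr (_ :|: _); apply/setP => x.
  apply/bigcupP/bigcupP => [[i /imsetP[j _ ->] hx]|[j _ hx]]; first by exists j.
  by exists (u j) => //; apply: imset_f.
apply: piece_tilingU hT' hT.
apply/disjointP => x /bigcupP[j _ hx] /bigcupP[i hi hx'].
have hne : u j != i.
  by apply: contra hu => /eqP e; apply/existsP; exists j; rewrite e.
by have /disjointP/(_ x hx hx') := part_disjoint hne.
Qed.

Lemma improve t : (4 * q * (q * t) <= #|I|)%N ->
  exists2 p, (#|[set i | ~~ fk i]| * c + t * r <= p)%N & piece_tiling l H b [set: V] p.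
Proof.
move=> /greedy_tuples[W [cW [p hp hT]]].
pose s := enum [set i | ~~ fk i & i \notin W].
have h1 : piece_tiling l H b (\bigcup_(i <- s) supp (part i)) (size s * c).
  apply: piece_tiling_list; [exact: enum_uniq|exact: part_disjoint|].
  by move=> i; rewrite mem_enum inE => /andP[hi _]; apply: piece_tiling_split; exact: hreal.
exists (size s * c + p)%N.
  apply: leq_trans (leq_add (leqnn _) hp).
  rewrite addnA leq_add2r -mulnDl leq_mul2r; apply/orP; right.
  rewrite /s -cardE; apply: leq_trans (leq_card_setU _ _).
  by apply: subset_leq_card; apply/subsetP => i; rewrite !inE => ->; case: (i \in W).
apply: piece_tiling_sub (subsetT _) (piece_tilingU _ h1 hT).
apply/disjointP => x; rewrite -(big_map (fun i => supp (part i)) xpredT id) -/(Union _) in_Union.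
move=> /hasP[X /mapP[i hi ->] hx] /bigcupP[i' hi' hx'].
have hne : i != i'.
  by apply/eqP => e; move: hi; rewrite mem_enum inE e hi' andbF.
by have /disjointP/(_ x hx hx') := part_disjoint hne.
Qed.

End Improve.

(** A union bound: each of the r entries misses the image of [g] with probability 1 - |A|/|T|, and
    otherwise it is uniform in the image. *)
Lemma Av_inj (R : realType) (A T : finType) (g : A -> T) r (F : seq T -> R) : injective g ->
  (0 < #|A|)%N -> (forall s, 0 <= F s <= 1) ->
  Av r F <= Av r (fun s : seq A => F (map g s)) + r%:R * (1 - #|A|%:R / #|T|%:R).
Proof.
move=> ginj hA; have hAT : (#|A| <= #|T|)%N := leq_card g ginj.
have hT : (0 < #|T|)%N by exact: leq_trans hAT.
have T0 : 0 < #|T|%:R :> R by rewrite ltr0n.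
have A0 : 0 < #|A|%:R :> R by rewrite ltr0n.
have AT : #|A|%:R <= #|T|%:R :> R by rewrite ler_nat.
set e := 1 - _; have e0 : 0 <= e by rewrite subr_ge0 ler_pdivrMr // mul1r.
elim: r F => [|r IH] F hF; first by rewrite !AvE mul0r addr0.
rewrite !AvE; pose psi x := Av r (fun s : seq A => F (x :: map g s)).
have psi0 x : 0 <= psi x by apply: Av_ge0 => s _; case/andP: (hF (x :: map g s)).
have hphi x : Av r (fun s => F (x :: s)) <= psi x + r%:R * e by apply: IH.
have hphi1 x : Av r (fun s => F (x :: s)) <= 1 by apply: Av_le => // s _; case/andP: (hF (x :: s)).
pose J := [set g a | a in [set: A]].
have cJ : #|J| = #|A| by rewrite card_imset // cardsT.
rewrite ler_pdivrMr // (bigID (mem J)) /=.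
have h1 : \sum_(x in J) Av r (fun s => F (x :: s)) <= \sum_a psi (g a) + #|A|%:R * (r%:R * e).
  apply: le_trans (_ : _ <= \sum_(x in J) (psi x + r%:R * e)) _; first exact: ler_sum.
  rewrite big_split /= sumr_const cJ -[X in _ + X <= _]mulr_natl lerD2r big_imset /=; last by move=> a a' _ _; exact: ginj.
  by rewrite le_eqVlt; apply/orP; left; apply/eqP; apply: eq_bigl => a; rewrite inE.
have h2 : \sum_(x | x \notin J) Av r (fun s => F (x :: s)) <= #|T|%:R - #|A|%:R.
  apply: le_trans (_ : _ <= \sum_(x | x \notin J) 1) _; first exact: ler_sum.
  rewrite sumr_const -natrB // ler_nat -cJ.
  by have := cardsC J; rewrite -cardsE => <-; rewrite addKn; apply: subset_leq_card; apply/subsetP => x; rewrite !inE.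
set S := \sum_a psi (g a) in h1 *.
have S0 : 0 <= S by apply: sumr_ge0.
rewrite mulrDl -[r.+1]addn1 natrD mulrDl mul1r mulrDl.
have h3 : S <= S / #|A|%:R * #|T|%:R.
  by rewrite mulrAC ler_pdivlMr // ler_wpM2l.
have h4 : #|A|%:R * (r%:R * e) <= r%:R * e * #|T|%:R.
  by rewrite mulrC ler_wpM2l // mulr_ge0.
have h5 : e * #|T|%:R = #|T|%:R - #|A|%:R.
  by rewrite /e mulrBl mul1r divfK // gt_eqF.
rewrite h5; lra.
Qed.

(** * Iterating the improvement *)

Section Iteration.
Context {R : realType}.
Variables (k l : nat).
Let y := (k + (k - 2 * l))%N.
Hypotheses (hk : (0 < k)%N) (hlk : (l <= k)%N).
Variables (theta delta eps alpha : R) (q w : nat).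
Hypotheses (d0 : 0 < delta) (e0 : 0 < eps) (e1 : eps <= 1 / 8).
Hypotheses (a0 : 0 <= alpha) (ae : alpha <= eps) (kq : (k <= q)%N).
Hypothesis hirr : (k * (q * y) ^ k)%:R * expR (- (alpha ^+ 2 / 4)) ^+ (q - k) <= 1 / 8 :> R.
Hypothesis hthr : forall G : kgraph k ('I_q * 'I_y)%type,
  dense G l (theta - delta - (k - l)%:R * (alpha + k%:R / q%:R)) ->
  exists Tl : {set {ffun 'I_y -> 'I_q * 'I_y}}, is_tiling (Y k (2 * l)) G Tl /\ (w <= #|Tl|)%N.
Hypothesis hw : (1 - eps) * q%:R <= w%:R.

(** The quantification over all part sizes is what allows iteration: an improved tiling with parts
    of size b starts from one with parts of a much larger size. *)
Definition pieces_cover (s : R) : Prop := forall b, (0 < b)%N -> exists n0 : nat,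
  forall (V : finType) (H : kgraph k V), (n0 <= #|V|)%N -> dense H l theta ->
  exists2 p, s * #|V|%:R <= (p * (y * b))%:R & piece_tiling l H b [set: V] p.

Lemma piece_tiling_refine (V : finType) (H : kgraph k V) b c X p : piece_tiling l H (c * b) X p -> piece_tiling l H b X (p * c).
Proof.
move=> [Ps [h1 h2 h3 h4]]; apply: piece_tiling_sub h4 _; rewrite -{}h1.
elim: Ps h2 h3 => [|P Ps IH] h2 h3; first exact: piece_tiling0.
move: h3; rewrite /pdisj /= => /andP[hd h3].
rewrite /Union big_cons /=.
have -> : ((size Ps).+1 * c = c + size Ps * c)%N by rewrite mulSn.
apply: piece_tilingU.
- exact: disj_Union.
- apply: piece_tiling_split; exact: (proj1 (h2 P (mem_head _ _))).
- by apply: IH => // P' hP'; apply: h2; rewrite inE hP' orbT.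
Qed.

(** The share of vertices gained in one improvement, as computed in [step_count]. It is independent
    of the part size, which bounds the number of improvements. *)
Let kappa : R := 1 / (128 * q%:R ^+ 3 * y%:R).

Lemma card_supp (V : finType) (P : {ffun 'I_y -> {set V}}) b : (forall v, #|P v| = b) -> (#|supp P| <= y * b)%N.
Proof.
move=> h; refine (leq_trans (card_bigcup_le _) _).
by rewrite (eq_bigr (fun _ => b)) // sum_nat_const card_ord.
Qed.

Section Items.
Variables (V : finType) (H : kgraph k V) (bb p0 nf : nat) (Ps : seq {ffun 'I_y -> {set V}}) (x0 : V).
Hypotheses (sP : size Ps = p0) (hP : forall P, P \in Ps -> blowup H bb P /\ (forall v, #|P v| = bb)).
Hypothesis hdisj : pdisj (map (@supp k l V) Ps).
Let U := ~: Union (map (@supp k l V) Ps).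
Hypothesis hnf : (nf * (y * bb) <= #|U|)%N.

(** The uncovered vertices are cut into blocks of y parts in an arbitrary order. Such blocks need
    not carry any edges; they only have the shape of a blow-up. *)
Definition item_pos (i : 'I_p0 + 'I_nf) (v : 'I_y) (z : 'I_bb) : V :=
  match i with
  | inl j => nth x0 (enum (nth [ffun _ => set0] Ps j v)) z
  | inr f => nth x0 (enum U) ((f * y + v) * bb + z)
  end.

Lemma item_in_P (j : 'I_p0) : nth [ffun _ => set0] Ps j \in Ps.
Proof. by apply: mem_nth; rewrite sP. Qed.

Lemma item_pos_mem (j : 'I_p0) v z : item_pos (inl j) v z \in nth [ffun _ => set0] Ps j v.
Proof.
have [_ h] := hP (item_in_P j).
by rewrite /= -mem_enum mem_nth // -cardE h.
Qed.

Lemma item_idx_lt (f : 'I_nf) (v : 'I_y) (z : 'I_bb) : ((f * y + v) * bb + z < size (enum U))%N.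
Proof.
rewrite -cardE; apply: leq_trans hnf.
have h1 : ((f * y + v).+1 * bb <= nf * (y * bb))%N.
  rewrite mulnA leq_mul2r; apply/orP; right.
  apply: leq_trans (_ : _ <= f.+1 * y)%N _; first by rewrite mulSn addnC ltn_add2r.
  by rewrite leq_mul2r ltn_ord orbT.
apply: leq_trans h1; by rewrite mulSn addnC ltn_add2r.
Qed.

Lemma item_pos_U (f : 'I_nf) v z : item_pos (inr f) v z \in U.
Proof. by rewrite /= -mem_enum mem_nth // item_idx_lt. Qed.

Lemma item_pos_inj i v z i' v' z' : item_pos i v z = item_pos i' v' z' ->
  [/\ i = i', v = v' & z = z'].
Proof.
have hUn (j : 'I_p0) x v0 : x \in nth [ffun _ => set0] Ps j v0 -> x \in Union (map (@supp k l V) Ps).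
  move=> hx; rewrite in_Union; apply/hasP; exists (supp (nth [ffun _ => set0] Ps j)).
    by apply: map_f; exact: item_in_P.
  by apply/bigcupP; exists v0.
case: i i' => [j|f] [j'|f'] e.
- have hx := item_pos_mem j v z; have hx' := item_pos_mem j' v' z'; rewrite -e in hx'.
  have [[_ hd _] hc] := hP (item_in_P j).
  case: (eqVneq j j') => [ej|hne]; last first.
    exfalso; pose S i := supp (nth [ffun _ => set0] Ps i).
    have hS (i : 'I_p0) v0 x : x \in nth [ffun _ => set0] Ps i v0 -> x \in S i.
      by move=> h; apply/bigcupP; exists v0.
    have hpd (a b : 'I_p0) : (a < b)%N -> [disjoint S a & S b].
      move=> hab; have /(pairwiseP set0)/(_ a b) := hdisj.
      rewrite !inE size_map sP !ltn_ord => /(_ isT isT hab).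
      by rewrite !(nth_map [ffun _ => set0]) ?sP.
    have := hne; rewrite -val_eqE neq_ltn => /orP[/hpd|/hpd] /disjointP hh.
      by apply: (hh _ (hS _ _ _ hx) (hS _ _ _ hx')).
    by apply: (hh _ (hS _ _ _ hx') (hS _ _ _ hx)).
  subst j'; case: (eqVneq v v') => [ev|/hd /disjointP hh]; last by case: (hh _ hx hx').
  subst v'; split => //; apply: val_inj.
  move/eqP: e; rewrite /= nth_uniq ?enum_uniq //; try by rewrite -cardE hc.
  by move/eqP.
- have := item_pos_U f' v' z'; rewrite -e inE => /negP[]; exact: hUn (item_pos_mem j v z).
- have := item_pos_U f v z; rewrite e inE => /negP[]; exact: hUn (item_pos_mem j' v' z').
- move/eqP: e; rewrite /= nth_uniq ?enum_uniq ?item_idx_lt // => /eqP e.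
  have bb0 : (0 < bb)%N by exact: leq_ltn_trans (ltn_ord z).
  have y0 : (0 < y)%N by exact: leq_ltn_trans (ltn_ord v).
  have ez : z = z' :> nat.
    by have := congr1 (fun n => n %% bb)%N e; rewrite !modnMDl !modn_small.
  have ed : (f * y + v = f' * y + v')%N.
    by have := congr1 (fun n => n %/ bb)%N e; rewrite !divnMDl // !divn_small // !addn0.
  have ev : v = v' :> nat.
    by have := congr1 (fun n => n %% y)%N ed; rewrite !modnMDl !modn_small.
  have ef : f = f' :> nat.
    by have := congr1 (fun n => n %/ y)%N ed; rewrite !divnMDl // !divn_small // !addn0.
  by split; [congr inr|..]; apply: val_inj.
Qed.

Lemma item_blowup (j : 'I_p0) : blowup H bb (part item_pos (inl j)).
Proof.
have [hb hc] := hP (item_in_P j).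
have -> // : part item_pos (inl j) = nth [ffun _ => set0] Ps j.
apply/ffunP => v; rewrite ffunE; apply/eqP; rewrite eqEcard; apply/andP; split.
  by apply/subsetP => x /imsetP[z _ ->]; exact: item_pos_mem.
rewrite card_imset ?cardsT ?card_ord ?hc // => z z' e.
by have [] := item_pos_inj e.
Qed.

End Items.

Lemma hdens_lower (V : finType) (H : kgraph k V) (I B : finType) (pos : I -> 'I_y -> B -> V) :
  (forall i v b i' v' b', pos i v b = pos i' v' b' -> [/\ i = i', v = v' & b = b']) ->
  (0 < #|{: I * 'I_y * B}|)%N -> dense H l theta ->
  (k - l)%:R * (1 - #|{: I * 'I_y * B}|%:R / #|V|%:R) <= delta ->
  forall s, uniq s -> size s = l -> theta - delta <= hdens H pos (k - l) s.
Proof.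
move=> pinj h0 hd hdl s us ss.
have vinj : injective (vert pos).
  by move=> [[i v] b] [[i' v'] b'] /pinj /= [-> -> ->].
have hF (x : seq V) : 0 <= ((ed H (s ++ x))%:R : R) <= 1 by rewrite ler0n lern1 leq_b1.
have := Av_inj (k - l) vinj h0 hF; have := hd s us ss; rewrite /hdens; lra.
Qed.

(** With t = N/(4 q^2) tuples, each gaining rr pieces, N + 1 is at most 8 q^2 t, because t >= 2
    outweighs rounding; cc = 8 q y rr contributes the remaining factors. *)
Lemma step_count (n E N qq rr cc yy b : nat) : (0 < qq)%N -> (0 < yy)%N ->
  (8 * (qq * yy) * rr = cc)%N -> (n <= (N + 1) * E)%N -> E = (yy * (cc * b))%N ->
  (8 * qq ^ 2 <= N)%N ->
  (n <= 128 * qq ^ 3 * yy * ((N %/ (4 * qq * qq)) * rr * (yy * b)))%N.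
Proof.
move=> q0 y0 hc hn hE hN; set t := (N %/ (4 * qq * qq))%N.
have q4 : (0 < 4 * qq * qq)%N by rewrite !muln_gt0 q0.
have ht : (N < t.+1 * (4 * qq * qq))%N by exact: ltn_ceil.
have t1 : (2 <= t)%N by rewrite leq_divRL //; apply: leq_trans hN; rewrite expnS expn1; lia.
have h1 : (N + 1 <= 2 * (t * (4 * qq * qq)))%N.
  apply: leq_trans (_ : _ <= t.+1 * (4 * qq * qq))%N _; first by rewrite addn1.
  by rewrite [(2 * (t * _))%N]mulnA leq_mul2r; apply/orP; right; lia.
apply: leq_trans hn _; apply: leq_trans (leq_mul h1 (leqnn E)) _.
rewrite hE -hc.
have -> : (2 * (t * (4 * qq * qq)) * (yy * (8 * (qq * yy) * rr * b)) =
   64 * qq ^ 3 * yy * (t * rr * (yy * b)))%N by rewrite !expnS expn0; ring.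
by rewrite -!mulnA; apply: leq_mul.
Qed.

(** The hypothesis is applied with parts of size c b, and these blow-ups, together with blocks of
    uncovered vertices, are the items to be sampled. *)
Lemma pieces_cover_step (s : R) : pieces_cover s -> pieces_cover (Num.min (s + kappa) (1 - 4 * eps)).
Proof.
move=> hs b hb.
have q0 : (0 < q)%N by exact: leq_trans kq.
have y0 : (0 < y)%N by rewrite /y; lia.
have qR : 0 < q%:R :> R by rewrite ltr0n.
pose M := #|{: 'I_q * 'I_y}|.
have MqE : M = (q * y)%N by rewrite /M card_prod !card_ord.
have M0 : (0 < M)%N by rewrite MqE muln_gt0 q0.
pose S := #|{: {set {ffun 'I_y -> 'I_q * 'I_y}}}|.
have S0 : (0 < S)%N by apply/card_gt0P; exists set0.
have k0 : 0 < 1 / 4 / 2 / S%:R :> R by rewrite !divr_gt0 // ltr0n.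
have [b0 hbox] := box_lemma M b k0.
(* The factor 8 M lets r boxes use up at most an eighth of the parts in total over the M
   coordinates, and r > b0 makes the parts large enough for the box theorem. *)
pose r := b0.+1; pose c := (8 * M * r)%N; pose bb := (c * b)%N.
have c0 : (0 < c)%N by rewrite !muln_gt0 M0.
have bb0 : (0 < bb)%N by rewrite muln_gt0 c0.
pose E := (y * bb)%N.
have E0 : (0 < E)%N by rewrite muln_gt0 y0.
have [n1 hn1] := hs bb bb0.
(* Three demands on n/E: the fewer than E vertices outside all items cost at most [delta] in density
   and [eps] in the cover, and there are at least 8 q^2 items. *)
pose D := ((Num.truncn ((k - l)%:R / delta + 1 / eps)).+1 + 8 * q ^ 2 + 2)%N.
exists (maxn n1 (E * D)) => V H; rewrite geq_max => /andP[hn hnD] hd.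
have n0 : (0 < #|V|)%N by apply: leq_trans hnD; rewrite muln_gt0 E0 /D addn2.
have nR : 0 < #|V|%:R :> R by rewrite ltr0n.
have ER : 0 < E%:R :> R by rewrite ltr0n.
have hEn : ((k - l)%:R / delta + 1 / eps) * E%:R <= #|V|%:R.
  have h1 : (k - l)%:R / delta + 1 / eps <= D%:R.
    by apply: le_trans (ltW (truncnS_gt _)) _; rewrite ler_nat /D -addnA leq_addr.
  apply: le_trans (ler_wpM2r (ltW ER) h1) _.
  by rewrite -natrM ler_nat mulnC.
have kd0 : 0 <= (k - l)%:R / delta by rewrite divr_ge0 // ltW.
have ie0 : 0 <= 1 / eps by rewrite divr_ge0 // ltW.
have hE1 : (k - l)%:R * E%:R <= delta * #|V|%:R.
  have : (k - l)%:R / delta * E%:R <= #|V|%:R.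
    by apply: le_trans hEn; rewrite ler_wpM2r ?(ltW ER) // lerDl.
  by rewrite mulrAC ler_pdivrMr // mulrC => h; apply: le_trans h _; rewrite mulrC.
have hE2 : E%:R <= eps * #|V|%:R.
  have : 1 / eps * E%:R <= #|V|%:R.
    by apply: le_trans hEn; rewrite ler_wpM2r ?(ltW ER) // lerDr.
  by rewrite mulrAC mul1r ler_pdivrMr // mulrC.
have [p0 hp0 hT] := hn1 V H hn hd.
(* Either the cover already suffices and is merely subdivided, or more than 4 eps n vertices are
   uncovered and the blocks cut from them are at least a 3 eps share of the items. *)
have [hbig|hsmall] := leP ((1 - 4 * eps) * #|V|%:R) (p0 * E)%:R.
  exists (p0 * c)%N; last exact: piece_tiling_refine hT.
  apply: le_trans (_ : _ <= (1 - 4 * eps) * #|V|%:R) _.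
    by rewrite ler_wpM2r // ge_min lexx orbT.
  apply: le_trans hbig _; rewrite ler_nat /E /bb.
  by rewrite -mulnA; apply/eq_leq; ring.
have [Ps [sP hP hdis _]] := hT.
pose U := ~: Union (map (@supp k l V) Ps).
have hU : (#|V| <= #|U| + p0 * E)%N.
  rewrite -(cardsC (Union (map (@supp k l V) Ps))) addnC leq_add2l -sP.
  elim: (Ps) hP => [|P Ps' IH] hP'; first by rewrite /Union big_nil cards0.
  rewrite /Union /= big_cons; apply: leq_trans (leq_card_setU _ _) _.
  rewrite [(_ * E)%N]mulSn; apply: leq_add; first exact: card_supp (proj2 (hP' P (mem_head _ _))).
  by apply: IH => P' hP0; apply: hP'; rewrite inE hP0 orbT.
pose nf := (#|U| %/ E)%N.
have hnf : (nf * E <= #|U|)%N by exact: leq_divM.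
have [x0 _] : exists x0 : V, x0 \in V by exact/card_gt0P.
pose pos := @item_pos V bb p0 nf Ps x0.
have pinj := item_pos_inj (x0 := x0) sP hP hdis hnf.
pose I := ('I_p0 + 'I_nf)%type.
have cI : #|{: I}| = (p0 + nf)%N by rewrite card_sum !card_ord.
have cO : #|{: I * 'I_y * 'I_bb}| = ((p0 + nf) * E)%N.
  by rewrite !card_prod cI !card_ord /E mulnA.
have vinj : injective (vert pos).
  by move=> [[i v] z] [[i' v'] z'] /pinj /= [-> -> ->].
have hNE : ((p0 + nf) * E <= #|V|)%N by rewrite -cO; exact: leq_card vinj.
have hnN : (#|V| < (p0 + nf + 1) * E)%N.
  apply: leq_ltn_trans hU _; rewrite -addnA mulnDl addnC ltn_add2l addn1; exact: ltn_ceil.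
have hN8 : (8 * q ^ 2 <= p0 + nf)%N.
  have : (E * D < (p0 + nf + 1) * E)%N by exact: leq_ltn_trans hnN.
  rewrite mulnC ltn_pmul2r // addn1 ltnS => hD; apply: leq_trans hD.
  by rewrite /D -addnA addnCA leq_addr.
have N0 : (0 < p0 + nf)%N by apply: leq_trans hN8; rewrite muln_gt0 expn_gt0 q0.
have I0 : (0 < #|{: I}|)%N by rewrite cI.
pose fk (i : I) := if i is inr _ then true else false.
have cfk : #|fk| = nf.
  have -> : #|fk| = #|[set (inr f : I) | f in [set: 'I_nf]]|.
    apply: eq_card => -[j|f]; apply/esym.
      by have -> : (inl j : I) \in fk = false by []; apply/negbTE/imsetP => -[].
    by have -> : (inr f : I) \in fk = true by []; apply/imsetP; exists f.
  by rewrite card_imset ?cardsT ?card_ord // => f f' [].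
have cnfk : #|[set i | ~~ fk i]| = p0.
  have -> : [set i | ~~ fk i] = [set (inl j : I) | j in [set: 'I_p0]].
    apply/setP => -[j|f]; rewrite inE; apply/esym.
      by have -> : ~~ fk (inl j) = true by []; apply/imsetP; exists j.
    by have -> : ~~ fk (inr f) = false by []; apply/negbTE/imsetP => -[].
  by rewrite card_imset ?cardsT ?card_ord // => j j' [].
have NR : 0 < (p0 + nf)%:R :> R by rewrite ltr0n.
have hN1 : q%:R ^+ 2 / #|{: I}|%:R <= 1 / 4 :> R.
  rewrite cI ler_pdivrMr // -natrX.
  have : (4 * q ^ 2 <= p0 + nf)%N by apply: leq_trans hN8; rewrite leq_mul2r orbT.
  by rewrite -(ler_nat R) natrM; lra.
have hphi : 3 * eps <= #|fk|%:R / #|{: I}|%:R.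
  rewrite cI cfk ler_pdivlMr //.
  have h1 : (p0 + nf)%:R * E%:R <= #|V|%:R :> R by rewrite -natrM ler_nat.
  have h2 : #|V|%:R <= (p0 * E)%:R + nf%:R * E%:R + E%:R :> R.
    by move: (ltnW hnN); rewrite -(ler_nat R) !mulnDl mul1n !natrD !natrM.
  rewrite -(ler_pM2r ER).
  apply: le_trans (_ : _ <= 3 * eps * #|V|%:R) _.
    by rewrite -[X in X <= _]mulrA ler_wpM2l // mulr_ge0 // ltW.
  lra.
have hO0 : (0 < #|{: I * 'I_y * 'I_bb}|)%N by rewrite cO muln_gt0 N0.
have hdl : (k - l)%:R * (1 - #|{: I * 'I_y * 'I_bb}|%:R / #|V|%:R) <= delta.
  rewrite -(ler_pM2r nR) -mulrA mulrBl mul1r divfK ?gt_eqF //.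
  apply: le_trans hE1; rewrite ler_wpM2l // cO lerBlDr -natrD ler_nat.
  by apply: ltnW; move: hnN; rewrite [((p0 + nf + 1) * E)%N]mulnDl mul1n addnC.
have a1 : alpha <= 1 by apply: le_trans ae _; apply: le_trans e1 _; rewrite ler_pdivrMr // mul1r ler1n.
have hden := hdens_lower pinj hO0 hd hdl.
have hcount := tuple_count (Ordinal bb0) hlk hk I0 q0 kq pinj a0 a1 hirr hN1 hphi hden hthr.
have hreal i : ~~ fk i -> blowup H (c * b) (part pos i).
  by case: i => [j|//] _; exact: item_blowup.
have cB : #|'I_bb| = (c * b)%N by rewrite card_ord.
have hb0 : (b0 <= #|'I_bb|)%N.
  rewrite card_ord /bb /c -!mulnA; apply: leq_trans (_ : _ <= r)%N _; first exact: leqnSn.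
  by rewrite mulnA mulnCA leq_pmulr // !muln_gt0 M0.
have hr : (8 * #|{: 'I_q * 'I_y}| * r <= c)%N by [].
(* A sample has at least 2 eps q uncovered blocks, and its tiling has at least (1 - eps) q copies;
   together these exceed q. *)
have hgain n : (3 * eps - alpha) * q%:R <= n%:R -> (q < w + n)%N.
  move=> h; rewrite -(ltr_nat R) natrD.
  have h2 : 2 * eps * q%:R <= n%:R by apply: le_trans h; rewrite ler_wpM2r // ?(ltW qR) //; move: ae; lra.
  have : 0 < eps * q%:R by rewrite mulr_gt0.
  have := hw; rewrite mulrBl mul1r; lra.
pose t := ((p0 + nf) %/ (4 * q * q))%N.
have ht : (4 * q * (q * t) <= #|{: I}|)%N by rewrite cI mulnA mulnC; exact: leq_divM.
have [p hp hTp] := improve hk I0 q0 pinj hb cB c0 hreal hb0 (fun G => hbox _ G hb0) hr hgain hcount ht.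
exists p => //; rewrite cnfk in hp.
have hcE : (8 * (q * y) * r = c)%N by rewrite /c MqE.
have hcnt := step_count q0 y0 hcE (ltnW hnN) (erefl : E = (y * (c * b))%N) hN8.
rewrite -/t in hcnt.
apply: le_trans (_ : _ <= (s + kappa) * #|V|%:R) _.
  by rewrite ler_wpM2r // ge_min lexx.
have h1 : kappa * #|V|%:R <= (t * r * (y * b))%:R.
  have y0R : 0 < y%:R :> R by rewrite ltr0n.
  have q3 : 0 < 128 * q%:R ^+ 3 * y%:R :> R by rewrite !mulr_gt0 // exprn_gt0.
  rewrite /kappa mulrAC mul1r ler_pdivrMr // mulrC -!natrX -!natrM ler_nat.
  exact: hcnt.
have h2 : (p0 * (y * bb))%:R + (t * r * (y * b))%:R <= (p * (y * b))%:R :> R.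
  rewrite -natrD ler_nat; apply: leq_trans (leq_mul hp (leqnn (y * b))).
  by rewrite mulnDl leq_add2r /bb; apply/eq_leq; ring.
rewrite mulrDl; apply: le_trans (lerD hp0 h1) h2.
Qed.

Lemma pieces_cover_le (s s' : R) : s' <= s -> pieces_cover s -> pieces_cover s'.
Proof.
move=> hs hc b hb; have [n0 h] := hc b hb; exists n0 => V H hn hd.
have [p hp hT] := h V H hn hd; exists p => //.
by apply: le_trans hp; rewrite ler_wpM2r.
Qed.

(** The empty tiling covers the share 0, and more than 1/kappa improvements reach the cap 1 - 4
    eps. *)
Lemma pieces_cover_main : pieces_cover (1 - 4 * eps).
Proof.
have q0 : (0 < q)%N by exact: leq_trans kq.
have y0 : (0 < y)%N by rewrite /y; lia.
have kap0 : 0 < kappa.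
  by rewrite /kappa divr_gt0 // !mulr_gt0 ?exprn_gt0 ?ltr0n.
have h m : pieces_cover (Num.min (m%:R * kappa) (1 - 4 * eps)).
  elim: m => [|m IH].
    move=> b hb; exists 0%N => V H _ _; exists 0%N; last exact: piece_tiling0.
    rewrite mul0n mulr_le0_ge0 // ge_min mul0r lexx //.
  apply: pieces_cover_le (pieces_cover_step IH).
  rewrite le_min; apply/andP; split; last by rewrite ge_min lexx orbT.
  rewrite -[m.+1]addn1 natrD mulrDl mul1r.
  have [h|h] := leP (m%:R * kappa) (1 - 4 * eps); first by rewrite ge_min lexx.
  by rewrite ge_min; apply/orP; right; rewrite lerDl ltW.
apply: pieces_cover_le (h (Num.truncn (1 / kappa)).+1).
rewrite le_min lexx andbT.
have : 1 / kappa < (Num.truncn (1 / kappa)).+1%:R by exact: truncnS_gt.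
by rewrite ltr_pdivrMr //; move: e0; lra.
Qed.

End Iteration.

(** * From the tiling threshold to covers by blow-ups *)

Section Threshold.
Context {R : realType}.

Lemma limf_esup_lt (T : choiceType) (X : filteredType T) (f : X -> \bar R) (F : set (set X)) (x : \bar R) :
  (limf_esup f F < x)%E -> exists2 A, F A & forall a, A a -> (f a < x)%E.
Proof.
move=> /ereal_inf_lt[_ [A FA <-] hA]; exists A => // a Aa.
by apply: le_lt_trans hA; apply: ereal_sup_ubound; exists a.
Qed.

(** Unfolds both limits superior: the inner one is small for all eps near 0 on the right, and one
    such eps below [eps0] is kept. *)
Lemma tiling_threshold_le (k l : nat) (theta eps0 : R) : (l <= k)%N -> 0 < eps0 ->
  (t_lim R k l l < theta%:E)%E ->
  exists2 eps : R, 0 < eps < eps0 & exists n0 : nat, forall n, (n0 <= n)%N ->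
    (tiling_threshold l l k n eps)%:R <= theta * 'C(n, k - l)%:R.
Proof.
move=> hlk e0 /limf_esup_lt[A hA hlt].
have hB := @nbhs_right_lt R 0 eps0 e0.
have hC := @nbhs_right_gt R 0.
have [eps [[eA e1] e2]] := filter_ex (filterI (filterI hA hB) hC).
exists eps; first by rewrite e2.
have [B [n1 _ hn1] hB'] := limf_esup_lt (hlt eps eA).
exists (maxn n1 k) => n; rewrite geq_max => /andP[h1 h2].
have /hB' := hn1 n h1; rewrite lte_fin => h.
have C0 : 0 < 'C(n, k - l)%:R :> R.
  by rewrite ltr0n bin_gt0; apply: leq_trans h2; exact: leq_subr.
by move/ltW: h; rewrite ler_pdivrMr.
Qed.

(** Chooses the number q of samples: the number of tests is polynomial in q, the failure probability
    of each is exponentially small. *)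
Lemma expR_poly_small (alpha : R) (k y N : nat) : 0 < alpha -> (0 < y)%N ->
  exists2 q, (N <= q)%N /\ (k <= q)%N &
   (k * (q * y) ^ k)%:R * expR (- (alpha ^+ 2 / 4)) ^+ (q - k) <= 1 / 8 :> R.
Proof.
move=> a0 y0; set rho := expR _.
have rho0 : 0 < rho by exact: expR_gt0.
have rho1 : rho < 1.
  by rewrite /rho -expR0 ltr_expR oppr_lt0 divr_gt0 // exprn_gt0.
have x0 : 0 < 1 - rho by rewrite subr_gt0.
have x1 : 1 - rho <= 1 by rewrite gerBl ltW.
have [p] := exp_small x0 x1; rewrite opprB addrCA subrr addr0 => hp.
pose K := (2 * p.+1)%N.
have [n0 hn0] := @poly_exp2_div k K (8 * k * y ^ k) isT.
pose q := (n0 + N + 2 * k)%N.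
exists q; first by rewrite /q; split; lia.
have hq : (8 * k * y ^ k * q ^ k <= 2 ^ (q %/ K))%N by apply: hn0; rewrite /q; lia.
have h1 : rho ^+ (q - k) <= (1 / 4) ^+ (q %/ K).
  have hle : (p.+1 * (q %/ K) <= q - k)%N.
    have := leq_divM q K; rewrite /K => h.
    have h3 : (2 * (p.+1 * (q %/ (2 * p.+1))) <= q)%N by apply: leq_trans h; apply/eq_leq; ring.
    have h4 : (2 * k <= q)%N by rewrite /q; lia.
    by move: h3 h4; set a := (p.+1 * _)%N; lia.
  apply: le_trans (ler_wiXn2l (ltW rho0) (ltW rho1) hle) _.
  rewrite exprM lerXn2r ?nnegrE ?exprn_ge0 ?(ltW rho0) //.
  apply: le_trans hp; apply: ler_wiXn2l => //; exact: ltW.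
apply: le_trans (ler_wpM2l _ h1) _ => //.
have h2 : (8 * (k * (q * y) ^ k))%:R <= (2 ^ (q %/ K))%:R :> R.
  by rewrite ler_nat; apply: leq_trans hq; rewrite expnMn; apply/eq_leq; ring.
rewrite natrM natrX in h2.
have h3 : (1 / 4) ^+ (q %/ K) * 2 ^+ (q %/ K) <= 1 :> R.
  by rewrite -exprMn exprn_ile1 //; lra.
have h4 : 0 <= (1 / 4) ^+ (q %/ K) :> R by rewrite exprn_ge0.
have := ler_wpM2l h4 h2; move: h3; set a := (1 / 4) ^+ _; set b := _%:R; lra.
Qed.

(** The sample graph has q y vertices and inherits density [theta']. For large q the threshold
    provides its almost perfect tiling, which drives the iteration. *)
Lemma tiling_pieces_cover (k l : nat) (theta' theta eps0 : R) : (0 < k)%N -> (l <= k)%N ->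
  theta' < theta -> theta' <= 1 -> 0 < eps0 -> (t_lim R k l l < theta'%:E)%E ->
  pieces_cover k l theta (1 - eps0).
Proof.
move=> k0 hlk htt ht1 e0 ht.
pose y := (k + (k - 2 * l))%N; have y0 : (0 < y)%N by rewrite /y; lia.
pose e1 := Num.min (eps0 / 4) (1 / 8 : R).
have e10 : 0 < e1 by rewrite lt_min !divr_gt0.
have [eps /andP[eps1 eps2] [n0 hn0]] := tiling_threshold_le hlk e10 ht.
have e4 : 4 * eps <= eps0.
  have : eps <= eps0 / 4 by apply: le_trans (ltW eps2) _; rewrite ge_min lexx.
  lra.
have e8 : eps <= 1 / 8 by apply: le_trans (ltW eps2) _; rewrite ge_min lexx orbT.
(* A quarter of the slack for each of three losses: vertices outside the items, the deviation
   [alpha], and the excluded samples k/q. The sample keeps density above [theta']. *)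
pose delta := (theta - theta') / 4.
have d0 : 0 < delta by rewrite divr_gt0 // subr_gt0.
have kl0 : 0 < (k - l)%:R + 1 :> R by rewrite ltr_wpDl.
pose alpha := Num.min eps (delta / ((k - l)%:R + 1)).
have a0 : 0 < alpha by rewrite lt_min eps1 divr_gt0.
have ae : alpha <= eps by rewrite ge_min lexx.
have ad : (k - l)%:R * alpha <= delta.
  have : alpha * ((k - l)%:R + 1) <= delta by rewrite -ler_pdivlMr // ge_min lexx orbT.
  by rewrite mulrDr mulr1 mulrC; move: a0; lra.
pose N := ((Num.truncn ((k - l)%:R * k%:R / delta)).+1 + n0 + l)%N.
have [q [hNq hkq] hirr] := @expR_poly_small alpha k y N a0 y0.
have q0 : (0 < q)%N by exact: leq_trans hkq.
have qR : 0 < q%:R :> R by rewrite ltr0n.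
have hq : (k - l)%:R * (k%:R / q%:R) <= delta.
  rewrite mulrA ler_pdivrMr // [delta * _]mulrC -ler_pdivrMr //.
  apply: le_trans (ltW (truncnS_gt _)) _; rewrite ler_nat; apply: leq_trans hNq.
  by rewrite /N -addnA leq_addr.
have hnq : (n0 <= q)%N by apply: leq_trans hNq; rewrite /N addnAC leq_addl.
have hlq : (l <= q)%N by apply: leq_trans hNq; rewrite /N leq_addl.
have eq0 : 0 <= eps * q%:R by rewrite mulr_ge0 // ltW.
(* At most eps q y of the q y vertices are uncovered and a copy has y vertices, so at least this
   many copies are present. *)
pose w := (q - Num.truncn (eps * q%:R))%N.
have /andP[tr1 tr2] := truncn_itv eq0.
have trq : (Num.truncn (eps * q%:R) <= q)%N.
  rewrite -(ler_nat R); apply: le_trans tr1 _; rewrite ler_piMl //; lra.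
have hw : (1 - eps) * q%:R <= w%:R.
  by rewrite /w natrB // mulrBl mul1r lerD2l lerN2.
have hthr (G : kgraph k ('I_q * 'I_y)%type) :
  dense G l (theta - delta - (k - l)%:R * (alpha + k%:R / q%:R)) ->
  exists Tl : {set {ffun 'I_y -> 'I_q * 'I_y}}, is_tiling (Y k (2 * l)) G Tl /\ (w <= #|Tl|)%N.
  move=> hd.
  have hd' : dense G l theta'.
    move=> s us ss; apply: le_trans (hd s us ss).
    rewrite mulrDr; move: ad hq; rewrite /delta; lra.
  pose M := #|{: 'I_q * 'I_y}|.
  have cM : M = (q * y)%N by rewrite /M card_prod !card_ord.
  have qM : (q <= M)%N by rewrite cM leq_pmulr.
  have M0 : (0 < M)%N by exact: leq_trans qM.
  have hthM := hn0 M (leq_trans hnq qM).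
  have hC : (tiling_threshold l l k M eps <= 'C(M, k - l))%N.
    by rewrite -(ler_nat R); apply: le_trans hthM _; rewrite ler_piMl.
  have hmd := dense_deg hlk M0 hd' hthM hC.
  move: hmd; rewrite /tiling_threshold /threshold; case: ex_minnP => m /asboolP hf _ hm.
  have [Tl [hT hcov]] := hf _ G erefl hm.
  exists Tl; split => //.
  have hc1 : (#|covered Tl| <= #|Tl| * y)%N.
    rewrite /covered -sum_nat_const.
    elim/big_rec2: _ => [|phi n U _ h]; first by rewrite cards0.
    apply: leq_trans (leq_card_setU _ _) _; apply: leq_add h.
    by apply: leq_trans (leq_imset_card _ _) _; rewrite cardsT card_ord.
  have hc2 := cardsC (covered Tl).
  have hc3 : #|~: covered Tl|%:R <= eps * (q%:R * y%:R) :> R.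
    by apply: le_trans hcov _; rewrite -natrM -cM.
  have yR : 0 < y%:R :> R by rewrite ltr0n.
  have hc4 : q%:R * y%:R <= #|Tl|%:R * y%:R + eps * (q%:R * y%:R) :> R.
    rewrite -[leLHS]natrM -cM (_ : M = #|covered Tl| + #|~: covered Tl|)%N; last by rewrite hc2.
    rewrite natrD.
    by apply: lerD => //; rewrite -natrM ler_nat.
  have hc5 : q%:R <= #|Tl|%:R + eps * q%:R :> R.
    by rewrite -(ler_pM2r yR) mulrDl -mulrA.
  have hc6 : q%:R < (#|Tl| + (Num.truncn (eps * q%:R)).+1)%:R :> R.
    by rewrite natrD; lra.
  move: hc6; rewrite ltr_nat addnS ltnS /w leq_subLR addnC.
  by [].
apply: (@pieces_cover_le _ k l theta (1 - 4 * eps)); first by lra.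
exact: (@pieces_cover_main R k l k0 hlk theta delta eps alpha q w d0 eps1 e8 (ltW a0) ae hkq hirr hthr hw).
Qed.

End Threshold.

(** * Paths covering almost all vertices *)

Section PiecePath.
Variables (k l : nat) (V : finType) (H : kgraph k V).
Hypotheses (hl : (0 < l)%N) (hlk : (2 * l < k)%N).
Let y := (k + (k - 2 * l))%N.
Variables (b : nat) (P : {ffun 'I_y -> {set V}}).
Hypotheses (hb : (0 < b)%N) (hP : blowup H b P) (cP : forall v, #|P v| = b).

Lemma piece_default : V.
Proof.
have y0 : (0 < y)%N by rewrite /y; lia.
have h : (0 < #|P (Ordinal y0)|)%N by rewrite cP.
by have [x _] := sig_eqW (card_gt0P h).
Qed.

Let px (v : 'I_y) (j : nat) : V := nth piece_default (enum (P v)) j.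

Lemma px_mem v j : (j < b)%N -> px v j \in P v.
Proof. by move=> hj; rewrite -mem_enum mem_nth // -cardE cP. Qed.

Lemma px_inj v j v' j' : (j < b)%N -> (j' < b)%N -> px v j = px v' j' -> v = v' /\ j = j'.
Proof.
move=> hj hj' e; have [_ hd _] := hP.
case: (eqVneq v v') => [ev|/hd /disjointP h]; last first.
  by case: (h (px v j)); rewrite ?px_mem // e px_mem.
subst v'; split => //; move/eqP: e.
by rewrite nth_uniq ?enum_uniq -?cardE ?cP // => /eqP.
Qed.

Implicit Types (p : 'I_y -> nat -> bool).

(** Vertex sets of a piece are encoded by predicates on the part v and the layer j, so that
    identities between them become arithmetic. *)
Definition im (p : 'I_y -> nat -> bool) : {set V} :=
  [set px vj.1 vj.2 | vj : 'I_y * 'I_b in [set vj : 'I_y * 'I_b | p vj.1 vj.2]].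

Lemma imP p x : reflect (exists v j, [/\ (j < b)%N, p v j & x = px v j]) (x \in im p).
Proof.
apply: (iffP imsetP) => [[[v j]]|[v [j [hj hp ->]]]].
  by rewrite inE /= => hp ->; exists v, j; split.
by exists (v, Ordinal hj); rewrite ?inE.
Qed.

Lemma mem_im p v j : (j < b)%N -> px v j \in im p = p v j.
Proof.
move=> hj; apply/imP/idP => [[v' [j' [hj' hp]]]|hp]; last by exists v, j.
by move=> e; have [-> ->] := px_inj hj hj' e.
Qed.

Lemma im_sub p p' : (forall v j, p v j -> p' v j) -> im p \subset im p'.
Proof. by move=> h; apply/subsetP => x /imP[v [j [hj hp ->]]]; rewrite mem_im // h. Qed.

Lemma imI p p' : im p :&: im p' = im (fun v j => p v j && p' v j).
Proof.
apply/setP => x; rewrite inE; apply/andP/imP => [[/imP[v [j [hj hp ->]]]]|[v [j [hj /andP[h1 h2] ->]]]].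
  by rewrite mem_im // => hp'; exists v, j; rewrite hp hp'.
by rewrite !mem_im.
Qed.

Lemma imU p p' : im p :|: im p' = im (fun v j => p v j || p' v j).
Proof.
apply/setP => x; rewrite inE; apply/orP/imP => [[/imP|/imP]|]; move=> [v [j [hj hp e]]].
- by exists v, j; rewrite hp.
- by exists v, j; rewrite hp orbT.
- by rewrite e !mem_im //; case/orP: hp => ->; [left|right].
Qed.

Lemma eq_im p p' : (forall v j, (j < b)%N -> p v j = p' v j) -> im p = im p'.
Proof.
move=> h; apply/setP => x; apply/imP/imP => -[v [j [hj hp e]]]; exists v, j; split => //.
  by rewrite -h.
by rewrite h.
Qed.

Lemma card_im p : #|im p| = #|[set vj : 'I_y * 'I_b | p vj.1 vj.2]|.
Proof.
apply: card_imset => -[v j] [v' j'] /= e.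
have [-> ej] := px_inj (ltn_ord j) (ltn_ord j') e.
by congr pair; apply: val_inj.
Qed.

Lemma card_im_layer (d : pred 'I_y) j : (j < b)%N -> #|im (fun v i => d v && (i == j))| = #|d|.
Proof.
move=> hj; rewrite card_im.
have -> : [set vj : 'I_y * 'I_b | d vj.1 && (vj.2 == j :> nat)] =
  [set (v, Ordinal hj) | v in [set v | d v]].
  apply/setP => -[v i]; rewrite inE /=; apply/andP/imsetP => [[hd /eqP e]|[v' + [-> ->]]].
    by exists v; rewrite ?inE //; congr pair; apply: val_inj.
  by rewrite inE /= eqxx.
by rewrite card_imset ?cardsE // => v v' [].
Qed.

Lemma card_interval m n : (m <= n)%N -> (n <= y)%N -> #|[pred v : 'I_y | (m <= v < n)%N]| = (n - m)%N.
Proof.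
move=> hmn hny.
suff : #|[set v : 'I_y | (m <= v < n)%N]| = (n - m)%N by rewrite cardsE.
have h1 := card_ord_lt hny; have h2 := card_ord_lt (leq_trans hmn hny).
have := cardsC [set i : 'I_y | (i < m)%N] ; rewrite h2 card_ord => hC.
have e : [set i : 'I_y | (i < n)%N] = [set i : 'I_y | (i < m)%N] :|: [set v : 'I_y | (m <= v < n)%N].
  apply/setP => i; rewrite !inE; case: (ltnP i m) => //= h; exact: leq_trans h hmn.
have := cardsUI [set i : 'I_y | (i < m)%N] [set v : 'I_y | (m <= v < n)%N].
rewrite -e h1 h2 (_ : _ :&: _ = set0); last first.
  by apply/setP => i; rewrite !inE; case: (ltnP i m).
by rewrite cards0 addn0; set X := #|_|; lia.
Qed.

Lemma im_edge (p : 'I_y -> nat -> bool) (f : 'I_y -> nat) (e : {set 'I_y}) :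
  e \in edges (Y k (2 * l)) -> (forall v, (f v < b)%N) ->
  (forall v j, (j < b)%N -> p v j = (v \in e) && (j == f v)) -> im p \in edges H.
Proof.
move=> he hf hp; have [_ _ h] := hP.
pose x : {ffun 'I_y -> V} := [ffun v => px v (f v)].
have -> : im p = x @: e; last by apply: h => // v; rewrite ffunE px_mem.
apply/setP => z; apply/imP/imsetP => [[v [j [hj]]]|[v hv ->]].
  by rewrite hp // => /andP[hv /eqP ->] ->; exists v; rewrite ?ffunE.
by exists v, (f v); rewrite ffunE; split => //; rewrite hp // hv eqxx.
Qed.

(** The 2l common vertices of the two edges of Y fall into two l-sets, which serve as the ends of
    the edges of the path. *)
Let D1 (v : 'I_y) := (k - 2 * l <= v < k - l)%N.
Let D2 (v : 'I_y) := (k - l <= v < k)%N.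

Lemma card_D1 j : (j < b)%N -> #|im (fun v i => D1 v && (i == j))| = l.
Proof. move=> hj; rewrite card_im_layer // card_interval; rewrite /y; lia. Qed.

Lemma card_D2 j : (j < b)%N -> #|im (fun v i => D2 v && (i == j))| = l.
Proof. move=> hj; rewrite card_im_layer // card_interval; rewrite /y; lia. Qed.

Lemma im_disjoint p p' : (forall v j, p v j -> p' v j -> False) -> [disjoint im p & im p'].
Proof.
move=> h; apply/disjointP => x /imP[v [j [hj hp ->]]]; rewrite mem_im // => hp'.
exact: h hp hp'.
Qed.

Lemma layer_path j : (j < b)%N ->
  lpath l H (im (fun v i => D1 v && (i == j))) (im (fun v i => (v < k)%N && (i == j)))
    (im (fun v i => D2 v && (i == j))).
Proof.
move=> hj; apply: lpath_edge.
- apply: (@im_edge _ (fun _ => j) (Y_edge1 k (2 * l))) => //; first by rewrite !inE eqxx.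
  by move=> v i _; rewrite inE.
- apply: im_sub => v i /andP[/andP[_ h] ->]; rewrite andbT; lia.
- by apply: im_sub => v i /andP[/andP[_ ->] ->].
- apply: im_disjoint => v i /andP[/andP[_ h1] _] /andP[/andP[h2 _] _]; lia.
- exact: card_D1.
- exact: card_D2.
Qed.

Lemma cross_path j : (j.+1 < b)%N ->
  lpath l H (im (fun v i => D2 v && (i == j)))
    (im (fun v i => ((k - l <= v)%N && (i == j)) || (D1 v && (i == j.+1))))
    (im (fun v i => D1 v && (i == j.+1))).
Proof.
move=> hj; apply: lpath_edge.
- apply: (@im_edge _ (fun v => if (v < k - l)%N then j.+1 else j) (Y_edge2 k (2 * l))).
  + by rewrite !inE eqxx orbT.
  + by move=> v; case: ifP => _; lia.
  + move=> v i _; rewrite inE /D1; case: (ltnP v (k - l)) => h; first by rewrite /= andbT.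
    have -> : (k - 2 * l <= v)%N by lia.
    by rewrite andbF orbF.
- by apply: im_sub => v i /andP[/andP[-> _] ->].
- by apply: im_sub => v i ->; rewrite orbT.
- apply: im_disjoint => v i /andP[/andP[h1 _] _] /andP[/andP[_ h2] _]; lia.
- by apply: card_D2; lia.
- exact: card_D1.
Qed.

(** The path alternates between the first edge of Y inside layer j and the second edge with its [D1]
    part shifted to layer j + 1. Consecutive edges thus meet in [D2] of layer j or in [D1] of layer
    j + 1, and each layer before the last is used up entirely. *)
Lemma piece_path_aux j : (j < b)%N ->
  lpath l H (im (fun v i => D1 v && (i == 0%N)))
    (im (fun v i => (i < j)%N || ((v < k)%N && (i == j))))
    (im (fun v i => D2 v && (i == j))).
Proof.
elim: j => [|j IH] hj.
  have := layer_path hj; congr lpath; by apply: eq_im.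
have hj' : (j < b)%N by lia.
have -> : im (fun v i => (i < j.+1)%N || ((v < k)%N && (i == j.+1))) =
  (im (fun v i => (i < j)%N || ((v < k)%N && (i == j))) :|:
   im (fun v i => ((k - l <= v)%N && (i == j)) || (D1 v && (i == j.+1)))) :|:
   im (fun v i => (v < k)%N && (i == j.+1)).
  rewrite !imU; apply: eq_im => v i _; rewrite /D1.
  apply/idP/idP; lia.
apply: lpath_cat (layer_path hj) _; last first.
  rewrite imU imI; apply: eq_im => v i _; rewrite /D1; apply/idP/idP; lia.
apply: lpath_cat (IH hj') (cross_path hj) _.
rewrite imI; apply: eq_im => v i _; rewrite /D1 /D2; apply/idP/idP; lia.
Qed.

Lemma piece_path : exists S X T, [/\ lpath l H S X T, X \subset supp P & (y * b.-1 <= #|X|)%N].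
Proof.
have hj : (b.-1 < b)%N by rewrite prednK.
have h := piece_path_aux hj; eexists; eexists; eexists; split; first exact: h.
  apply/subsetP => x /imP[v [j [hj' _ ->]]]; apply/bigcupP; exists v => //; exact: px_mem.
rewrite card_im.
pose J := [set vj : 'I_y * 'I_b | (vj.2 < b.-1)%N].
have -> : (y * b.-1 = #|J|)%N.
  have -> : J = setX [set: 'I_y] [set j : 'I_b | (j < b.-1)%N].
    by apply/setP => -[v j]; rewrite !inE.
  by rewrite cardsX cardsT !card_ord card_ord_lt // leq_pred.
by apply: subset_leq_card; apply/subsetP => -[v j]; rewrite !inE /= => ->.
Qed.

End PiecePath.

(** * Degrees of small sets, available connectors, and path covers *)

Section Preliminaries.
Context {R : realType}.
Variables (k l : nat).
Hypotheses (hl : (0 < l)%N) (hlk : (2 * l < k)%N).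
Notation csize := (csize k l).

(** A smaller set is first enlarged to an l-set; repetitions and overlaps cost at most half. It is
    used for the empty list, for vertices and for pairs, the last requiring l >= 2. *)
Lemma sub_density (V : finType) (H : kgraph k V) (theta : R) j p : 0 <= theta ->
  (4 * l ^ 2 <= #|V|)%N -> (j <= l)%N -> dense H l theta -> uniq p -> size p = j ->
  theta / 2 <= Av (k - j) (fun z => (ed H (p ++ z))%:R).
Proof.
move=> t0 hn hj hd up sp.
have n0 : (0 < #|V|)%N by apply: leq_trans hn; rewrite muln_gt0 expn_gt0 hl.
have nR : 0 < #|V|%:R :> R by rewrite ltr0n.
have -> : (k - j = (l - j) + (k - l))%N by lia.
rewrite Av_cat.
apply: le_trans (_ : _ <= Av (l - j) (fun z => (uniq (p ++ z))%:R * theta)) _; last first.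
  apply: ler_Av => z sz; case: (boolP (uniq (p ++ z))) => hu; last first.
    by rewrite mul0r; apply: Av_ge0 => s _; exact: ler0n.
  rewrite mul1r; have := hd (p ++ z) hu; rewrite size_cat sp sz subnKC // => /(_ erefl) h.
  by apply: le_trans h _; apply: ler_Av => s _; rewrite catA.
rewrite AvZr mulrC ler_wpM2r //.
have h1 : Av (l - j) (fun z => (has (mem [set x in p]) z)%:R) <= l%:R * l%:R / #|V|%:R :> R.
  apply: le_trans (Av_hit _ _ n0) _; rewrite ler_wpM2r ?invr_ge0 ?(ltW nR) //.
  by rewrite -!natrM ler_nat card_set_seq // sp leq_mul // leq_subr.
have h2 : Av (l - j) (fun z : seq V => (~~ uniq z)%:R) <= l%:R * l%:R / #|V|%:R :> R.
  apply: le_trans (Av_dup _ n0) _; rewrite ler_wpM2r ?invr_ge0 ?(ltW nR) //.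
  by rewrite expr2 -!natrM ler_nat leq_mul // leq_subr.
have h3 : l%:R * l%:R / #|V|%:R <= 1 / 4 :> R.
  rewrite ler_pdivrMr // -natrM; have : (4 * (l * l))%:R <= #|V|%:R :> R by rewrite ler_nat.
  rewrite natrM; lra.
have h4 : 1 - Av (l - j) (fun z => (has (mem [set x in p]) z)%:R) - Av (l - j) (fun z : seq V => (~~ uniq z)%:R)
    <= Av (l - j) (fun z => (uniq (p ++ z))%:R) :> R.
  rewrite -[X in X - _ - _](Av_const (l - j) (1 : R) n0) -!AvB; apply: ler_Av => z _.
  rewrite cat_uniq up /=; have -> : has (mem [set x in p]) z = has (mem p) z.
    by apply: eq_has => x /=; rewrite inE.
  by case: has; case: uniq; rewrite /=; lra.
lra.
Qed.

Lemma avoid_exists (V : finType) m (A : pred (seq V)) (beta : R) (Z : {set V}) : (0 < #|V|)%N ->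
  beta <= Av m (fun c => (A c)%:R) ->
  m%:R ^+ 2 + m%:R * #|Z|%:R < beta * #|V|%:R ->
  exists c, [/\ size c = m, A c, uniq c & [disjoint [set x in c] & Z]].
Proof.
move=> n0 hA hZ; have nR : 0 < #|V|%:R :> R by rewrite ltr0n.
have h1 := Av_hit (R := R) m Z n0; have h2 := Av_dup (R := R) m n0.
have h3 : beta - m%:R * #|Z|%:R / #|V|%:R - m%:R ^+ 2 / #|V|%:R <=
   Av m (fun c => [&& A c, uniq c & ~~ has (mem Z) c]%:R).
  apply: le_trans (_ : _ <= Av m (fun c => (A c)%:R - (has (mem Z) c)%:R - (~~ uniq c)%:R)) _.
    rewrite !AvB; lra.
  by apply: ler_Av => c _; case: (A c); case: uniq; case: has; rewrite /=; lra.
have h4 : 0 < beta - m%:R * #|Z|%:R / #|V|%:R - m%:R ^+ 2 / #|V|%:R.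
  rewrite -addrA -opprD subr_gt0 -mulrDl ltr_pdivrMr //; lra.
have [c sc hc] := Av_exists n0 h3.
have : [&& A c, uniq c & ~~ has (mem Z) c].
  by move: (lt_le_trans h4 hc); case: [&& _, _ & _] => //; rewrite ltxx.
move=> /and3P[Ac uc /hasPn dc]; exists c; split => //.
by apply/disjointP => x; rewrite inE => /dc /negP h.
Qed.

(** When [Y] omits few vertices, the density of connectors alone leaves one inside [Y] and outside
    [Z]. *)
Lemma oracle_direct (V : finType) (H : kgraph k V) (bc : R) (Y : {set V}) (z : nat) : (0 < #|V|)%N ->
  (forall s t, uniq s -> size s = l -> uniq t -> size t = l ->
    bc <= Av csize (fun c => (conn l H s t c)%:R)) ->
  csize%:R ^+ 2 + csize%:R * (#|~: Y| + z)%:R < bc * #|V|%:R ->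
  oracle l H Y z.
Proof.
move=> n0 hconn hn Z S T hZ cS cT dST dSY dTY.
have hc := hconn (enum S) (enum T) (enum_uniq _) (etrans (esym (cardE _)) cS) (enum_uniq _) (etrans (esym (cardE _)) cT).
have [|c [sc Ac uc dc]] := avoid_exists (Z := ~: Y :|: (Z :&: Y)) n0 hc.
  apply: le_lt_trans hn; rewrite lerD2l ler_wpM2l // ler_nat.
  by apply: leq_trans (leq_card_setU _ _) _; rewrite leq_add2l.
have cY x : x \in c -> x \in Y /\ x \notin Z.
  move=> hx; have hx' : x \in [set x in c] by rewrite inE.
  have := disjointFr dc hx'; rewrite !inE; case: (x \in Y) => //=; case: (x \in Z) => //.
exists [set x in c]; split.
- by apply/subsetP => x; rewrite inE => /cY[].
- by apply/disjointP => x; rewrite inE => /cY[_ /negP h].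
- by rewrite card_set_seq.
- apply: conn_lpath => //; apply/disjointP => x; rewrite !inE => /cY[hx _] /orP[h|h].
    by have /disjointP/(_ x h hx) := dSY.
  by have /disjointP/(_ x h hx) := dTY.
Qed.

Lemma count_hit (V : finType) (F : seq (seq V)) (Z : {set V}) : uniq (flatten F) ->
  (count (has (mem Z)) F <= #|Z :&: [set x in flatten F]|)%N.
Proof.
elim: F => [//|c F IH] /=; rewrite cat_uniq => /and3P[uc hd uF].
have -> : Z :&: [set x in c ++ flatten F] = (Z :&: [set x in c]) :|: (Z :&: [set x in flatten F]).
  by apply/setP => x; rewrite !inE mem_cat andb_orr.
rewrite cardsU (_ : _ :&: (Z :&: [set x in flatten F]) = set0); last first.
  apply/setP => x; rewrite !inE; apply/negP => /andP[/andP[_ h1] /andP[_ h2]].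
  by move/hasPn: hd => /(_ x h2); rewrite /= h1.
rewrite cards0 subn0 leq_add ?IH //; case: hasP => // -[x hx hZ].
by apply/card_gt0P; exists x; rewrite !inE hx andbT.
Qed.

(** In a small [Y], density is of no use. Instead h disjoint connectors are stored for every pair of
    ends, and z < h used vertices spoil at most z of them. *)
Lemma oracle_family (V : finType) (H : kgraph k V) (F : seq (seq V)) (Z0 : {set V}) (h z : nat) :
  valid csize Z0 F -> (z < h)%N ->
  (forall s t, uniq s -> size s = l -> uniq t -> size t = l -> (h <= count (conn l H s t) F)%N) ->
  oracle l H [set x in flatten F] z.
Proof.
move=> /and3P[/allP hs uF _] hz hcount Z S T hZ cS cT dST dSY dTY.
have hc := hcount (enum S) (enum T) (enum_uniq _) (etrans (esym (cardE _)) cS) (enum_uniq _) (etrans (esym (cardE _)) cT).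
have : has (fun c => conn l H (enum S) (enum T) c && ~~ has (mem Z) c) F.
  apply: contraT => hn; move: hz; rewrite ltnNge => /negP[].
  apply: leq_trans hc _; apply: leq_trans (leq_trans (count_hit Z uF) hZ).
  elim: (F) hn => [//|c F' IH] /=; rewrite negb_or negb_and negbK => /andP[h1 h2].
  by apply: leq_add (IH h2); case/orP: h1 => [/negbTE ->|->] //; rewrite leq_b1.
move=> /hasP[c cF /andP[Ac dc]].
have cY x : x \in c -> x \in [set x in flatten F].
  by move=> hx; rewrite inE; apply/flattenP; exists c.
have uc : uniq c.
  elim: (F) uF cF => [//|c' F' IH] /=; rewrite cat_uniq => /and3P[u1 _ u2].
  by rewrite inE => /orP[/eqP ->|] //; exact: IH.
exists [set x in c]; split.
- by apply/subsetP => x; rewrite inE => /cY.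
- by apply/disjointP => x; rewrite inE => hx hxZ; move/hasPn: dc => /(_ x hx); rewrite /= hxZ.
- by rewrite card_set_seq //; apply/eqP; exact: hs.
- apply: conn_lpath => //; first by apply/eqP; exact: hs.
  apply/disjointP => x; rewrite inE => /cY hx; rewrite inE => /orP[h'|h'].
    by have /disjointP/(_ x h' hx) := dSY.
  by have /disjointP/(_ x h' hx) := dTY.
Qed.

Lemma edge_lpath (V : finType) (H : kgraph k V) (z : seq V) : size z = k -> ed H z ->
  exists S T, lpath l H S [set x in z] T.
Proof.
move=> sz hz; pose s := take l z; pose m := take (k - 2 * l) (drop l z); pose t := drop (k - 2 * l) (drop l z).
have e : z = s ++ m ++ t by rewrite /s /m /t !cat_take_drop.
exists [set x in s], [set x in t]; rewrite e; apply: ed_lpath => //; rewrite -?e //.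
- by rewrite size_takel // sz; lia.
- by rewrite size_takel // size_drop sz; lia.
- by rewrite !size_drop sz; lia.
Qed.

(** Each vertex of [X] not yet covered lies in an edge that avoids [U0] and the earlier edges; a
    single edge counts as a path to be linked later. *)
Lemma cover_vertices (V : finType) (H : kgraph k V) (beta : R) (X U0 : {set V}) : (0 < #|V|)%N ->
  (forall x, beta <= Av k.-1 (fun z => (ed H (x :: z))%:R)) ->
  k%:R ^+ 2 + k%:R * (#|U0| + k * #|X| + 1)%:R < beta * #|V|%:R ->
  exists es Xs, [/\ paths_ok l H es Xs, pdisj Xs, all (fun A : {set V} => [disjoint A & U0]) Xs,
    X \subset U0 :|: Union Xs & (size es <= #|X|)%N /\ (#|Union Xs| <= k * #|X|)%N].
Proof.
move=> n0 hdens; have -> : X = [set x in enum X] by apply/setP => x; rewrite inE mem_enum.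
rewrite card_set_seq ?enum_uniq //.
elim: (enum X) => [|x s IH] hn.
  exists [::], [::]; split => //; first by apply/subsetP => x; rewrite inE.
  by rewrite /Union big_nil cards0.
have [|es [Xs [h1 h2 h3 h4 [h5 h6]]]] := IH.
  apply: le_lt_trans hn; rewrite lerD2l ler_wpM2l // ler_nat leq_add2r leq_add2l leq_mul2l leqnSn.
  by rewrite orbT.
have sub : [set y in x :: s] = x |: [set y in s] by apply/setP => y; rewrite !inE.
case: (boolP (x \in U0 :|: Union Xs)) => hx.
  exists es, Xs; split => //=.
    by rewrite sub subUset sub1set hx h4.
  by split; [exact: leqW|apply: leq_trans h6 _; rewrite leq_mul2l leqnSn orbT].
have [|z [sz Az uz dz]] := avoid_exists (Z := x |: (U0 :|: Union Xs)) n0 (hdens x).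
  apply: le_lt_trans hn; apply: lerD.
    by rewrite -!natrX ler_nat leq_sqr leq_pred.
  rewrite -!natrM ler_nat leq_mul ?leq_pred //.
  apply: leq_trans (leq_card_setU _ _) _; rewrite cards1 addnC leq_add2r.
  apply: leq_trans (leq_card_setU _ _) _; rewrite leq_add2l.
  by apply: leq_trans h6 _; rewrite leq_mul2l leqnSn orbT.
have k0 : (0 < k)%N by lia.
have [||S [T hp]] := @edge_lpath V H (x :: z) => //; first by rewrite /= sz prednK.
have dxz : [disjoint [set y in x :: z] & U0 :|: Union Xs].
  apply/disjointP => y; rewrite in_set inE => /orP[/eqP ->|hy hy']; first by move/negP: hx.
  have /disjointP/(_ y) := dz; apply; first by rewrite inE.
  by rewrite in_setU hy' orbT.
exists ((S, T) :: es), ([set y in x :: z] :: Xs); split => //=.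
- rewrite /pdisj /= -/(pdisj Xs) h2 andbT; apply/allP => A hA.
  apply: disjointWr dxz; apply: subset_trans (subsetUr _ _).
  by apply/subsetP => y hy; rewrite in_Union; apply/hasP; exists A.
- rewrite h3 andbT; apply: disjointWr dxz; exact: subsetUl.
- rewrite sub subUset sub1set; apply/andP; split.
    by rewrite in_setU in_Union /= in_set mem_head orbT.
  apply: subset_trans h4 _; apply: setUS; apply/subsetP => y; rewrite !in_Union /= => ->.
  by rewrite orbT.
- split; first exact: h5.
  rewrite /Union big_cons; apply: leq_trans (leq_card_setU _ _) _.
  rewrite mulnS leq_add // cardsE; apply: leq_trans (card_size _) _.
  by rewrite /= sz prednK.
Qed.

Lemma lpath_val (V : finType) (H : kgraph k V) (T : finType) (g : T -> V) S X S' : injective g ->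
  lpath l (sample H g) S X S' -> lpath l H (g @: S) (g @: X) (g @: S').
Proof.
move=> ginj; elim=> {S X S'} [S X S' hX hS hS' hd cS cS'|S X S' X' U h1 IH1 h2 IH2 hI].
  apply: lpath_edge; rewrite ?card_imset //.
  - by move: hX; rewrite inE => /andP[].
  - exact: imsetS.
  - exact: imsetS.
  - apply/disjointP => x /imsetP[a ha ->] /imsetP[b hb /ginj e].
    by have /disjointP/(_ a ha) := hd; rewrite e => /(_ hb).
rewrite imsetU; apply: lpath_cat IH1 IH2 _.
by rewrite -hI imsetI // => a b _ _; exact: ginj.
Qed.

Lemma card_Union (V : finType) (Xs : seq {set V}) : pdisj Xs -> #|Union Xs| = \sum_(X <- Xs) #|X|.
Proof.
elim: Xs => [|X Xs IH]; first by rewrite /Union !big_nil cards0.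
rewrite /pdisj /= => /andP[h1 h2]; rewrite /Union !big_cons cardsU -IH //.
by have := disj_Union h1; rewrite -setI_eq0 => /eqP ->; rewrite cards0 subn0.
Qed.

Lemma piece_tiling_card (V : finType) (H : kgraph k V) b X p :
  piece_tiling l H b X p -> (p * ((k + (k - 2 * l)) * b) <= #|X|)%N.
Proof.
move=> [Ps [<- h2 h3 /subset_leq_card h4]]; apply: leq_trans h4.
rewrite card_Union // big_map big_seq (eq_bigr (fun=> (k + (k - 2 * l)) * b)%N).
  by rewrite -big_seq big_const_seq count_predT iter_addn_0 mulnC.
move=> P /h2[[_ hd _] cP].
rewrite -sum1_card (partition_disjoint_bigcup addn (F := P) (fun=> 1%N) hd).
by under eq_bigr do rewrite sum1_card cP; rewrite sum_nat_const card_ord.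
Qed.

(** The cover by pieces is applied to the graph induced on [W], whose density drops by at most theta
    - theta1. A piece with parts of size b loses at most a 1/b share of its vertices to the end of
    its path. *)
Lemma path_cover (theta theta1 eps : R) (b : nat) : (0 < b)%N -> theta1 < theta ->
  pieces_cover k l theta1 (1 - eps) ->
  exists n0 : nat, forall (V : finType) (H : kgraph k V) (W : {set V}),
    (n0 <= #|W|)%N -> dense H l theta ->
    (k - l)%:R * (1 - #|W|%:R / #|V|%:R) <= theta - theta1 ->
    exists es Xs, [/\ paths_ok l H es Xs, pdisj Xs, Union Xs \subset W,
      (size es * b <= #|W|)%N &
      #|W :\: Union Xs|%:R <= eps * #|W|%:R + #|W|%:R / b%:R].
Proof.
move=> hb htt hclaim; have [n0 h0] := hclaim b hb.
exists n0.+1 => V H W hW hd hr.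
pose T := {x : V | x \in W}.
have cT : #|{: T}| = #|W| by rewrite card_sig; apply: eq_card => x; rewrite inE.
have ginj : injective (val : T -> V) := val_inj.
have T0 : (0 < #|{: T}|)%N by rewrite cT; exact: leq_trans hW.
have hdT : dense (sample H (val : T -> V)) l theta1.
  move=> s us ss.
  have hF (x : seq V) : 0 <= ((ed H (map val s ++ x))%:R : R) <= 1 by rewrite ler0n lern1 leq_b1.
  have := Av_inj (k - l) ginj T0 hF; rewrite cT.
  have := hd (map val s); rewrite map_inj_uniq // size_map => /(_ us ss) h1 h2.
  apply: le_trans (_ : _ <= Av (k - l) (fun z : seq T => (ed H (map val s ++ map val z))%:R)) _; first lra.
  apply: ler_Av => z sz; apply: lebR => h3; apply: ed_sample; last by rewrite map_cat.
  by rewrite size_cat ss sz; lia.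
have [p hp hTil] := h0 T (sample H val) (leq_trans (leqnSn _) (leq_trans hW (eq_leq (esym cT)))) hdT.
have hpb := piece_tiling_card hTil; rewrite cardsT cT in hpb.
move: hTil => [Ps [h1 h2 h3 _]]; rewrite cT in hp.
have key (Ps' : seq {ffun 'I_(k + (k - 2 * l)) -> {set T}}) :
  (forall P, P \in Ps' -> blowup (sample H val) b P /\ (forall v, #|P v| = b)) ->
  pdisj (map (@supp k l T) Ps') ->
  exists es Xs, [/\ paths_ok l H es Xs, pdisj Xs, Union Xs \subset val @: Union (map (@supp k l T) Ps'),
    size es = size Ps' & (size Ps' * ((k + (k - 2 * l)) * b.-1) <= #|Union Xs|)%N].
  elim: Ps' => [|P Ps' IH] hPs hds.
    by exists [::], [::]; split => //; rewrite /Union big_nil sub0set.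
  move: hds; rewrite /pdisj /= => /andP[hd1 hd2].
  have [|es [Xs [g1 g2 g3 g4 g5]]] := IH _ hd2.
    by move=> P' hP'; apply: hPs; rewrite inE hP' orbT.
  have [hP cP] := hPs P (mem_head _ _).
  have [S [X [S' [hX hXs cX]]]] := piece_path hl hlk hb hP cP.
  have hdX : [disjoint val @: X & Union Xs].
    apply/disjointP => x /imsetP[a ha ->] /(subsetP g3) /imsetP[c hc /val_inj e].
    have /disjointP/(_ a (subsetP hXs _ ha)) := disj_Union hd1; apply.
    by rewrite e.
  exists ((val @: S, val @: S') :: es), (val @: X :: Xs); split => //=.
  - by split => //; exact: lpath_val ginj hX.
  - rewrite /pdisj /= -/(pdisj Xs) g2 andbT; apply/allP => A hA.
    apply: disjointWr hdX; apply/subsetP => x hx; rewrite in_Union; apply/hasP; by exists A.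
  - rewrite /Union !big_cons imsetU; apply: setUSS => //; exact: imsetS.
  - by rewrite g4.
  - rewrite /Union big_cons cardsU (_ : _ :&: _ = set0); last by apply/eqP; rewrite setI_eq0.
    by rewrite cards0 subn0 mulSn leq_add // card_imset.
have [es [Xs [g1 g2 g3 g4 g5]]] := key Ps h2 h3.
have hXW : Union Xs \subset W.
  by apply: subset_trans g3 _; apply/subsetP => _ /imsetP[[x hx] _ ->].
exists es, Xs; rewrite h1 in g4 g5; set y := (k + (k - 2 * l))%N in hp g5.
have y0 : (0 < y)%N by rewrite /y; lia.
have hUW : (#|Union Xs| <= #|W|)%N by exact: subset_leq_card.
split => //.
  rewrite g4; apply: leq_trans hpb; rewrite leq_mul2l; apply/orP; right; exact: leq_pmull.
have bR : 0 < b%:R :> R by rewrite ltr0n.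
have hs : #|W :\: Union Xs| = (#|W| - #|Union Xs|)%N.
  by rewrite cardsD (setIidPr hXW).
rewrite hs natrB //.
have g5' : (p * (y * b))%:R <= #|Union Xs|%:R + (p * y)%:R :> R.
  rewrite -natrD ler_nat; apply: leq_trans (leq_add g5 (leqnn _)).
  by rewrite -{1}(prednK hb) mulnS mulnDr addnC.
have hpy : (p * y)%:R <= #|W|%:R / b%:R :> R.
  by rewrite ler_pdivlMr // -natrM ler_nat -mulnA.
move: hp g5' hpy; set A := (_ * (_ * b))%:R; set B := (p * y)%:R; lra.
Qed.

End Preliminaries.

(** * The absorbing path *)

Section States.
Variables (k l : nat) (V : finType) (H : kgraph k V).
Hypotheses (hl : (0 < l)%N) (hlk : (2 * l < k)%N).
Notation csize := (csize k l).
Notation gsize := (gsize k l).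
Notation asize := (asize k l).
Implicit Types (A W z c Q : seq V).

Definition sets (L : seq (seq V)) : seq {set V} := [seq [set x in s] | s : seq V <- L].

Lemma Union_sets L : Union (sets L) = [set x in flatten L].
Proof.
apply/setP => x; rewrite in_Union inE; elim: L => [//|s L IH] /=.
by rewrite mem_cat IH inE.
Qed.

Lemma pdisj_sets L : uniq (flatten L) -> pdisj (sets L).
Proof.
elim: L => [//|s L IH] /=; rewrite cat_uniq => /and3P[_ /hasPn h1 h2].
rewrite /pdisj /= -/(pdisj _) IH // andbT; apply/allP => _ /mapP[t ht ->].
apply/disjointP => x; rewrite !inE => hx hxt.
by have := h1 x; rewrite /= hx => /(_ _)/negP; apply => //; apply/flattenP; exists t.
Qed.

Fixpoint gadL z Q : seq (seq V) :=
  if z is x :: z' then (x :: take gsize Q) :: gadL z' (drop gsize Q) else [::].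

Fixpoint gad_ends n Q : seq ({set V} * {set V}) :=
  if n is n'.+1 then (gend1 k l (take gsize Q), gend2 k l (take gsize Q)) :: gad_ends n' (drop gsize Q)
  else [::].

Lemma perm_gadL z Q : size Q = (size z * gsize)%N -> perm_eq (flatten (gadL z Q)) (z ++ Q).
Proof.
elim: z Q => [|x z IH] Q /= hQ; first by rewrite (size0nil hQ).
rewrite perm_cons; have h : perm_eq (flatten (gadL z (drop gsize Q))) (z ++ drop gsize Q).
  by apply: IH; rewrite size_drop hQ mulSn addKn.
rewrite (perm_trans (perm_cat (perm_refl _) h)) //.
by rewrite perm_catCA cat_take_drop.
Qed.

Lemma gadL_ok z c Q : size z = size c -> size Q = (size c * gsize)%N -> uniq Q ->
  gads l H z c Q ->
  (~~ has (mem Q) c -> paths_ok l H (gad_ends (size c) Q) (sets (gadL c Q))) /\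
  (~~ has (mem Q) z -> paths_ok l H (gad_ends (size c) Q) (sets (gadL z Q))).
Proof.
elim: z c Q => [|x z IH] [|y c] Q //= [hs] hQ uQ /andP[hg hgs].
have sT : size (take gsize Q) = gsize by rewrite size_takel // hQ mulSn leq_addr.
have [|h1 h2] := IH c (drop gsize Q) hs _ (drop_uniq _ uQ) hgs.
  by rewrite size_drop hQ mulSn addKn.
have [h3 h4] := gad_lpath hl hlk sT (take_uniq _ uQ) hg.
have sub a : a \notin Q -> a \notin take gsize Q by apply: contra; exact: mem_take.
have sub' s : ~~ has (mem Q) s -> ~~ has (mem (drop gsize Q)) s.
  by apply: contra => /hasP[a ha haQ]; apply/hasP; exists a => //; exact: mem_drop haQ.
have E a : [set b in a :: take gsize Q] = a |: [set b in take gsize Q].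
  by apply/setP => b; rewrite !inE.
split; rewrite negb_or => /andP[/sub ha /sub' hb]; rewrite E; split.
- exact: h3.
- exact: h1.
- exact: h4.
- exact: h2.
Qed.

Let ps A := take l A.
Let pm A := take (k - 2 * l) (drop l A).
Let pt A := take l (drop (k - 2 * l) (drop l A)).
Let pr A := drop l (drop (k - 2 * l) (drop l A)).
Let pc A := take csize (pr A).
Let pQ A := drop csize (pr A).

(** One list of ends for both states, so that the connectors between the paths stay valid when an
    absorber switches. *)
Definition state_ends A := ([set x in ps A], [set x in pt A]) :: gad_ends csize (pQ A).
Definition idle_state A := (ps A ++ pm A ++ pt A) :: gadL (pc A) (pQ A).
Definition absorbing_state A W := (ps A ++ pc A ++ pt A) :: gadL (pm A ++ W) (pQ A).

Lemma split_A A : A = ps A ++ pm A ++ pt A ++ pc A ++ pQ A.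
Proof. by rewrite /ps /pm /pt /pc /pQ /pr !cat_take_drop. Qed.

Section Sizes.
Variable A : seq V.
Hypothesis sA : size A = asize.

Lemma size_parts : [/\ size (ps A) = l, size (pm A) = (k - 2 * l)%N, size (pt A) = l,
  size (pc A) = csize & size (pQ A) = (csize * gsize)%N].
Proof.
have s1 : size (drop l A) = ((k - 2 * l) + (l + (csize + csize * gsize)))%N.
  by rewrite size_drop sA /asize addKn.
have s2 : size (drop (k - 2 * l) (drop l A)) = (l + (csize + csize * gsize))%N.
  by rewrite size_drop s1 addKn.
have s3 : size (pr A) = (csize + csize * gsize)%N by rewrite /pr size_drop s2 addKn.
split.
- by rewrite size_takel // sA leq_addr.
- by rewrite size_takel // s1 leq_addr.
- by rewrite size_takel // s2 leq_addr.
- by rewrite size_takel // s3 leq_addr.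
- by rewrite /pQ size_drop s3 addKn.
Qed.

Lemma perm_idle_state : perm_eq (flatten (idle_state A)) A.
Proof.
have [_ _ _ s4 s5] := size_parts.
rewrite {2}(split_A A) /= -!catA !perm_cat2l; apply: perm_gadL.
by rewrite s4 s5.
Qed.

Lemma perm_absorbing_state W : size W = (k - l)%N -> perm_eq (flatten (absorbing_state A W)) (A ++ W).
Proof.
move=> sW; have [s1 s2 s3 s4 s5] := size_parts.
rewrite {2}(split_A A) /= -!catA perm_cat2l.
have : perm_eq (flatten (gadL (pm A ++ W) (pQ A))) ((pm A ++ W) ++ pQ A).
  by apply: perm_gadL; rewrite size_cat s2 sW s5 /csize; congr (_ * _)%N; lia.
move=> h; rewrite (perm_trans (perm_cat (perm_refl _) (perm_cat (perm_refl _) h))) //.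
apply/permP => a; rewrite !count_cat; lia.
Qed.

Lemma idle_state_ok W : size W = (k - l)%N -> uniq A -> absorber l H W A ->
  paths_ok l H (state_ends A) (sets (idle_state A)).
Proof.
move=> sW uA /and3P[h1 h2 h3]; have [s1 s2 s3 s4 s5] := size_parts.
split; first exact: ed_lpath.
move: uA; rewrite {1}(split_A A) !catA cat_uniq -!catA => /and3P[_ hd uQ].
rewrite -s4; have [||+ _] := gadL_ok _ _ uQ h3.
- by rewrite size_cat s2 sW s4 /csize; lia.
- by rewrite s5 s4.
apply; apply: contra hd => /hasP[x xc xQ]; apply/hasP; exists x => //=.
by rewrite !mem_cat xc !orbT.
Qed.

Lemma absorbing_state_ok W : size W = (k - l)%N -> uniq (A ++ W) -> absorber l H W A ->
  paths_ok l H (state_ends A) (sets (absorbing_state A W)).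
Proof.
move=> sW uAW /and3P[h1 h2 h3]; have [s1 s2 s3 s4 s5] := size_parts.
have /andP[uA hAW] : uniq A && ~~ has (mem A) W by move: uAW; rewrite cat_uniq => /and3P[-> ->].
have := uA; rewrite {1}(split_A A) => uA'.
split; last first.
  have : uniq (pQ A) by move: uA'; rewrite !catA cat_uniq => /and3P[].
  move=> uQ; rewrite -s4; have [||_] := gadL_ok _ _ uQ h3.
  - by rewrite size_cat s2 sW s4 /csize; lia.
  - by rewrite s5 s4.
  apply; apply/negP => /hasP[x xc /= xQ].
  move: xc; rewrite mem_cat => /orP[xm|xW].
    move: uA'; rewrite !catA cat_uniq -!catA => /and3P[_ /hasPn/(_ x xQ)].
    by rewrite /= !mem_cat xm !orbT.
  move/hasPn: hAW => /(_ x xW) /negP; apply.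
  by rewrite /= (split_A A) !mem_cat xQ !orbT.
have E : [set x in ps A ++ pc A ++ pt A] = [set x in ps A] :|: [set x in pc A] :|: [set x in pt A].
  by apply/setP => x; rewrite !inE !mem_cat orbA.
have uall : uniq (ps A ++ pt A ++ pc A).
  apply: subseq_uniq uA'; apply: cat_subseq => //.
  rewrite -[X in subseq X _]cat0s; apply: cat_subseq; first exact: sub0seq.
  by apply: cat_subseq => //; exact: prefix_subseq.
move: uall; rewrite !cat_uniq has_cat negb_or => /and3P[us /andP[hst hsc] /and3P[ut htc uc]].
rewrite E; apply: conn_lpath => //=.
- by rewrite card_set_seq.
- by rewrite card_set_seq.
- apply/disjointP => x; rewrite !inE => xs xt.
  by move/hasPn: hst => /(_ x xt); rewrite /= xs.
- apply/disjointP => x; rewrite !inE => xc /orP[xs|xt].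
    by move/hasPn: hsc => /(_ x xc); rewrite /= xs.
  by move/hasPn: htc => /(_ x xc); rewrite /= xt.
- move: h2; rewrite /conn.
  rewrite (_ : ed H (enum [set x in ps A] ++ _) = ed H (ps A ++ take l (pc A) ++ take (k - 2 * l) (drop l (pc A)))); last first.
    by apply: eq_ed => x; rewrite !mem_cat mem_enum inE.
  rewrite (_ : ed H (enum [set x in pt A] ++ _) = ed H (pt A ++ take l (pc A) ++ drop (k - 2 * l) (drop l (pc A)))) //.
  by apply: eq_ed => x; rewrite !mem_cat mem_enum inE.
Qed.

End Sizes.

(** A greedy matching: before each assignment fewer than h absorbers are occupied, so one of the h
    absorbers for the next [W] is free. An empty list marks an idle absorber. *)
Lemma assignment (F Ws : seq (seq V)) (h : nat) : (size Ws <= h)%N ->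
  (forall W, W \in Ws -> (h <= count (absorber l H W) F)%N) ->
  exists AW : seq (seq V * seq V),
    [/\ map fst AW = F, perm_eq (flatten (map snd AW)) (flatten Ws),
       (forall p, p \in AW -> p.2 = [::] \/ p.2 \in Ws /\ absorber l H p.2 p.1) &
       (count (fun p => p.2 != [::]) AW <= size Ws)%N].
Proof.
elim: Ws => [|W Ws IH] /= hs hc.
  exists [seq (A, [::]) | A <- F]; split.
  - by rewrite -map_comp map_id.
  - by rewrite -map_comp; elim: (F).
  - by move=> _ /mapP[A _ ->]; left.
  - by rewrite count_map; elim: (F).
have [||AW [h1 h2 h3 h4]] := IH.
- exact: ltnW.
- by move=> W' hW'; apply: hc; rewrite inE hW' orbT.
have : has (fun p => absorber l H W p.1 && (p.2 == [::])) AW.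
  apply: contraT => hn.
  have := hc W (mem_head _ _); rewrite -h1 count_map => h5.
  have : (count (preim fst (absorber l H W)) AW <= count (fun p => p.2 != [::]) AW)%N.
    elim: (AW) hn => [//|p AW' IH'] /=; rewrite negb_or negb_and => /andP[hp /IH' h'].
    by apply: leq_add h'; case/orP: hp => [/negbTE ->|->] //; rewrite leq_b1.
  by move=> h6; have := leq_trans h5 (leq_trans h6 h4); rewrite leqNgt hs.
move=> /hasP[[A W'] hp /= /andP[hA /eqP eW']]; rewrite {W'}eW' in hp.
case/splitPr: hp h1 h2 h3 h4 => AW1 AW2 h1 h2 h3 h4.
exists (AW1 ++ (A, W) :: AW2); split.
- by rewrite -h1 !map_cat.
- move: h2; rewrite !map_cat !flatten_cat /= => h2.
  by rewrite perm_catCA perm_cat2l.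
- move=> p; rewrite mem_cat inE => /or3P[hp|/eqP ->|hp].
  + have [|->|[h5 h6]] := h3 p; [by rewrite mem_cat hp|by left|right; by rewrite inE h5 orbT].
  + by right; rewrite inE eqxx.
  + have [|->|[h5 h6]] := h3 p; [by rewrite mem_cat inE hp !orbT|by left|right; by rewrite inE h5 orbT].
- move: h4; rewrite !count_cat /=; case: (W == [::]) => /=; lia.
Qed.

Lemma paths_ok_flatten (I : eqType) (f : I -> seq ({set V} * {set V})) (g : I -> seq {set V}) (s : seq I) :
  (forall i, i \in s -> paths_ok l H (f i) (g i)) -> paths_ok l H (flatten (map f s)) (flatten (map g s)).
Proof.
elim: s => [//|i s IH] h /=; apply: paths_ok_cat; first exact: h (mem_head _ _).
by apply: IH => j hj; apply: h; rewrite inE hj orbT.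
Qed.

Lemma sets_flatten (Ls : seq (seq (seq V))) : sets (flatten Ls) = flatten (map sets Ls).
Proof. by rewrite /sets map_flatten. Qed.

Lemma uniq_flatten_mem (L : seq (seq V)) s : uniq (flatten L) -> s \in L -> uniq s.
Proof.
elim: L => [//|t L IH] /=; rewrite cat_uniq => /and3P[h1 _ h2].
by rewrite inE => /orP[/eqP -> //|]; exact: IH.
Qed.

Section Family.
Variables (F : seq (seq V)) (Z : {set V}).
Hypotheses (vF : valid asize Z F)
  (hF : forall A, A \in F -> exists2 W, size W = (k - l)%N & absorber l H W A).
Let es := flatten (map state_ends F).

Lemma family_size A : A \in F -> size A = asize.
Proof. by move=> hA; case/and3P: vF => /allP/(_ A hA)/eqP. Qed.

Lemma family_uniq : uniq (flatten F).
Proof. by case/and3P: vF. Qed.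

Lemma idle_family : exists Xs, [/\ paths_ok l H es Xs, pdisj Xs & Union Xs = [set x in flatten F]].
Proof.
exists (sets (flatten (map idle_state F))).
have hp : perm_eq (flatten (flatten (map idle_state F))) (flatten F).
  elim: (F) family_size => [//|A F' IH] h.
  rewrite -[flatten (map _ _)]/(idle_state A ++ flatten (map idle_state F')) flatten_cat; apply: perm_cat; first by apply: perm_idle_state; apply: h; exact: mem_head.
  by apply: IH => A' hA'; apply: h; rewrite inE hA' orbT.
split.
- rewrite sets_flatten -map_comp; apply: paths_ok_flatten => A hA.
  have [W sW hW] := hF hA; apply: idle_state_ok hW => //; first exact: family_size.
  exact: uniq_flatten_mem family_uniq hA.
- by apply: pdisj_sets; rewrite (perm_uniq hp) family_uniq.
- by rewrite Union_sets; apply/setP => x; rewrite !inE (perm_mem hp).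
Qed.

(** The set [X] is cut into lists of length k - l, and each is assigned to its own absorber. *)
Lemma absorbing_family (X : {set V}) (h : nat) : (k - l %| #|X|)%N -> (#|X| <= h)%N ->
  [disjoint X & [set x in flatten F]] ->
  (forall W, size W = (k - l)%N -> {subset W <= X} -> (h <= count (absorber l H W) F)%N) ->
  exists Xs, [/\ paths_ok l H es Xs, pdisj Xs & Union Xs = [set x in flatten F] :|: X].
Proof.
move=> hdiv hX dX hc; have r0 : (0 < k - l)%N by lia.
pose Ws := reshape (nseq (#|X| %/ (k - l)) (k - l)%N) (enum X).
have sz : sumn (nseq (#|X| %/ (k - l)) (k - l)%N) = size (enum X).
  by rewrite sumn_nseq mulnC divnK // cardE.
have hfl : flatten Ws = enum X by apply: reshapeKr; rewrite sz.
have hsh : shape Ws = nseq (#|X| %/ (k - l)) (k - l)%N by apply: reshapeKl; rewrite sz.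
have hW W : W \in Ws -> size W = (k - l)%N /\ {subset W <= X}.
  move=> hWs; split.
    have : size W \in shape Ws by exact: map_f.
    by rewrite hsh => /nseqP[].
  by move=> x hx; rewrite -mem_enum -hfl; apply/flattenP; exists W.
have [||AW [h1 h2 h3 _]] := @assignment F Ws h.
- have -> : size Ws = (#|X| %/ (k - l))%N by rewrite -(size_map size) -/(shape Ws) hsh size_nseq.
  exact: leq_trans (leq_div _ _) hX.
- by move=> W /hW[]; exact: hc.
pose L (p : seq V * seq V) := if p.2 == [::] then idle_state p.1 else absorbing_state p.1 p.2.
have pF p : p \in AW -> p.1 \in F by move=> hp; rewrite -h1; exact: map_f.
have huniq : uniq (flatten F ++ flatten (map snd AW)).
  rewrite cat_uniq family_uniq (perm_uniq h2) hfl enum_uniq andbT /=.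
  apply/hasPn => x; rewrite (perm_mem h2) hfl mem_enum => hx; apply/negP => /= hxF.
  by have /disjointP/(_ x hx) := dX; rewrite inE; apply.
have pL p : p \in AW -> perm_eq (flatten (L p)) (p.1 ++ p.2).
  move=> hp; rewrite /L; case: eqP => [->|hne].
    by rewrite cats0; apply: perm_idle_state; apply: family_size; exact: pF.
  apply: perm_absorbing_state; first by apply: family_size; exact: pF.
  by have [//|[/hW[]]] := h3 p hp.
have hp : perm_eq (flatten (flatten (map L AW))) (flatten F ++ flatten (map snd AW)).
  rewrite -h1; elim: (AW) pL => [//|p AW' IH] hpL.
  rewrite -[flatten (map L _)]/(L p ++ flatten (map L AW')) flatten_cat /=.
  have := IH (fun q hq => hpL q (mem_behead (s := p :: AW') hq)) => IH'.
  rewrite (perm_trans (perm_cat (hpL p (mem_head _ _)) IH')) //.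
  by apply/permP => a; rewrite !count_cat addnACA.
exists (sets (flatten (map L AW))); split.
- have -> : es = flatten [seq state_ends p.1 | p <- AW] by rewrite /es -h1 -map_comp.
  rewrite sets_flatten -map_comp; apply: paths_ok_flatten => p hpAW /=.
  have sp := family_size (pF p hpAW).
  rewrite /L; case: eqP => [_|hne].
    have [W sW hA] := hF (pF p hpAW); apply: idle_state_ok hA => //.
    exact: uniq_flatten_mem family_uniq (pF p hpAW).
  have [//|[/hW[sW _] hA]] := h3 p hpAW; apply: absorbing_state_ok hA => //.
  rewrite cat_uniq (uniq_flatten_mem family_uniq (pF p hpAW)) /=.
  move: huniq; rewrite cat_uniq => /and3P[_ hd hu2].
  rewrite (uniq_flatten_mem hu2) ?andbT; last exact: map_f.
  apply/hasPn => x hx; apply/negP => /= hxA.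
  have hx2 : x \in flatten (map snd AW) by apply/flattenP; exists p.2 => //; exact: map_f.
  by move/hasPn: hd => /(_ x hx2)/negP; apply; apply/flattenP; exists p.1 => //; exact: pF.
- by apply: pdisj_sets; rewrite (perm_uniq hp).
- rewrite Union_sets; apply/setP => x.
  by rewrite !inE (perm_mem hp) mem_cat (perm_mem h2) hfl mem_enum.
Qed.

End Family.

End States.

Section Core.
Context {R : realType}.
Variables (k l : nat).
Hypotheses (hl : (0 < l)%N) (hlk : (2 * l < k)%N).
Notation csize := (csize k l).
Notation asize := (asize k l).

Lemma eventually_lt (a b : R) : 0 < b -> exists n0 : nat, forall n, (n0 <= n)%N -> a < b * n%:R.
Proof.
move=> b0; exists (Num.truncn (a / b)).+1 => n hn.
rewrite mulrC -ltr_pdivrMr //; apply: lt_le_trans (truncnS_gt _) _; by rewrite ler_nat.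
Qed.

Lemma valid_filter (V : finType) m (Z : {set V}) (a : pred (seq V)) (F : seq (seq V)) :
  valid m Z F -> valid m Z [seq A <- F | a A].
Proof.
rewrite /valid; elim: F => [//|A F IH] /= /and3P[/andP[h1 h2]].
rewrite cat_uniq has_cat negb_or => /and3P[h3 h4 h5] /andP[h6 h7].
have /and3P[g1 g2 g3] := IH (introT and3P (And3 h2 h5 h7)).
case: ifP => _ /=; rewrite ?h1 g1 ?cat_uniq ?has_cat ?negb_or ?h3 ?h6 g2 g3 //= ?andbT.
apply: contra h4 => /hasP[x hx hxA]; apply/hasP; exists x => //.
by move/flattenP: hx => [B]; rewrite mem_filter => /andP[_ hB] hx; apply/flattenP; exists B.
Qed.

Lemma valid_size (V : finType) m (Z : {set V}) (F : seq (seq V)) :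
  valid m Z F -> size (flatten F) = (m * size F)%N.
Proof.
move=> /and3P[h _ _]; elim: F h => [|A F IH] /=; first by rewrite muln0.
by move=> /andP[/eqP hA hF]; rewrite size_cat hA IH // mulnS.
Qed.

Lemma pdisj_cat (V : finType) (Xs Ys : seq {set V}) : pdisj Xs -> pdisj Ys ->
  [disjoint Union Xs & Union Ys] -> pdisj (Xs ++ Ys).
Proof.
move=> h1 h2 hd; rewrite /pdisj pairwise_cat; apply/and3P; split => //.
apply/allrelP => A B hA hB; apply: disjointWl (disjointWr _ hd).
  by apply/subsetP => x hx; rewrite in_Union; apply/hasP; exists A.
by apply/subsetP => x hx; rewrite in_Union; apply/hasP; exists B.
Qed.

Lemma Union_disjoint (V : finType) (Xs : seq {set V}) (Y : {set V}) :
  [disjoint Union Xs & Y] -> all (fun X : {set V} => [disjoint X & Y]) Xs.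
Proof.
move=> h; apply/allP => A hA; apply: disjointWl h.
by apply/subsetP => x hx; rewrite in_Union; apply/hasP; exists A.
Qed.

Lemma Union_cat (V : finType) (Xs Ys : seq {set V}) : Union (Xs ++ Ys) = Union Xs :|: Union Ys.
Proof. by rewrite /Union big_cat. Qed.

Lemma size_gad_ends (V : finType) n (Q : seq V) : size (gad_ends k l n Q) = n.
Proof. by elim: n Q => [//|n IH] Q /=; rewrite IH. Qed.

Lemma size_family_ends (V : finType) (F : seq (seq V)) :
  size (flatten [seq state_ends k l A | A <- F]) = (size F * csize.+1)%N.
Proof. by elim: F => [//|A F IH] /=; rewrite size_cat IH size_gad_ends mulSn. Qed.

Lemma link_count (u j x c s a : nat) : (u <= a * s ->
  u + j * x + c * (s * c.+1 + x) <= s * (a + c * c.+1) + (j + c) * x)%N.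
Proof. by move=> h; rewrite mulnDl !mulnDr (mulnC s a) (mulnCA c s); lia. Qed.

(** The bad vertices, which no absorber is guaranteed to serve, are put on the path through single
    edges. Every set outside the path then consists of good vertices only. *)
Lemma absorbing_path (theta mu : R) : (1 < l)%N -> 0 < theta -> theta <= 1 ->
  (1 / 2) ^+ (k - l) < theta ^+ l -> 0 < mu ->
  exists2 alpha : R, 0 < alpha & exists n0 : nat, forall (V : finType) (H : kgraph k V),
    (n0 <= #|V|)%N -> dense H l theta ->
    exists S P T, [/\ lpath l H S P T, #|P|%:R <= mu * #|V|%:R &
      forall X : {set V}, (k - l %| #|X|)%N -> #|X|%:R <= alpha * #|V|%:R -> [disjoint X & P] ->
        lpath l H S (P :|: X) T].
Proof.
move=> l2 t0 t1 ht m0.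
have [bc b0 hbc] := conn_density hl hlk t0 t1 ht.
pose cs : R := csize%:R; have cs0 : 0 <= cs by rewrite ler0n.
have k0 : 0 < k%:R :> R by rewrite ltr0n; lia.
(* Bad pairs may cost cs * gamma <= theta bc/4, half of the density theta/2 * bc of an edge with a
   connector. *)
pose gamma := theta * bc / (4 * (cs + 1)).
have g0 : 0 < gamma by rewrite /gamma !(mulr_gt0, invr_gt0) // ltr_wpDl.
have hg : cs * gamma <= theta * bc / 4.
  have : gamma * (4 * (cs + 1)) = theta * bc by rewrite /gamma divfK // gt_eqF // mulr_gt0 // ltr_wpDl.
  move: g0; nra.
(* The bounds on [mu0] serve in turn the length of the path, the cover of bad vertices, the search
   for connectors, and the existence of a vertex that is not bad. *)
have [mu0 [m1 m2 m3 m4 m5]] : exists mu0 : R, [/\ 0 < mu0, mu0 <= mu, k%:R * mu0 <= theta / 4,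
    cs * mu0 <= bc / 2 & mu0 <= 1 / 2].
  exists (Num.min (Num.min mu (1 / 2)) (Num.min (theta / 4 / k%:R) (bc / 2 / (cs + 1)))); split.
  - by rewrite !lt_min m0 !divr_gt0 // ltr_wpDl.
  - by rewrite !ge_min lexx.
  - by rewrite mulrC -ler_pdivlMr // !ge_min lexx !orbT.
  - set z := Num.min _ _; have z0 : 0 <= z by rewrite !le_min (ltW m0) !divr_ge0 ?ltW // ltr_wpDl.
    have : z <= bc / 2 / (cs + 1) by rewrite !ge_min lexx !orbT.
    rewrite ler_pdivlMr ?ltr_wpDl // mulrDr mulr1 mulrC; lra.
  - by rewrite !ge_min lexx !orbT.
have kc : 0 < k%:R + cs by rewrite ltr_pwDl.
pose g1 := mu0 / 2 / (k%:R + cs).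
have g10 : 0 < g1 by rewrite !divr_gt0.
have hg1 : (k%:R + cs) * g1 = mu0 / 2 by rewrite mulrC divfK // gt_eqF.
have g11 : g1 < 1.
  have : 1 <= k%:R :> R by rewrite ler1n -(ltr0n R).
  move=> h1; have h2 : 1 <= k%:R + cs by apply: le_trans h1 _; rewrite lerDl.
  have := ler_wpM2r (ltW g10) h2; rewrite mul1r hg1; move: m5; lra.
have [br br0 [n1 hbr]] := gadget_density hl hlk (mulr_gt0 g0 g10) (divr_gt0 t0 (ltr0Sn R 1)).
pose ba := Num.min 1 ((theta / 2 * bc - cs * gamma) * br ^+ csize).
have ba0 : 0 < ba.
  rewrite lt_min ltr01 mulr_gt0 ?exprn_gt0 // subr_gt0; apply: le_lt_trans hg _.
  have := mulr_gt0 t0 b0; lra.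
have ba1 : ba <= 1 by rewrite ge_min lexx.
have [p [K0 hsel]] := selection asize (k - l) ba0 ba1.
(* Vertices consumed per absorber: its own, and a connector for each of its csize + 1 paths. *)
pose D := (asize + csize * csize.+1)%N.
have [K1 hK1] := eventually_lt (p%:R * D%:R) (divr_gt0 m1 (ltr0Sn R 1)).
pose K := (maxn K0 K1).+1.
have K0R : 0 < K%:R :> R by rewrite ltr0n.
have hpD : p%:R * D%:R < mu0 / 2 * K%:R by apply: hK1; rewrite /K leqW // leq_maxr.
have [n2 hF] := hsel K (leqW (leq_maxl K0 K1)).
have [n3 hn3] := eventually_lt (k%:R ^+ 2 + k%:R) (divr_gt0 t0 (ltr0Sn R 3)).
have [n4 hn4] := eventually_lt (cs ^+ 2) (divr_gt0 b0 (ltr0Sn R 1)).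
exists K%:R^-1; first by rewrite invr_gt0.
exists (maxn n1 (maxn n2 (maxn n3 (maxn n4 (maxn (4 * l ^ 2) K))))) => V H.
rewrite !geq_max => /andP[hv1 /andP[hv2 /andP[hv3 /andP[hv4 /andP[hv5 hv6]]]]] hd.
have n0 : (0 < #|V|)%N by apply: leq_trans hv6.
have nR : 0 < #|V|%:R :> R by rewrite ltr0n.
have hpair q : size q = 2 -> uniq q -> theta / 2 <= Av (k - 2) (fun z => (ed H (q ++ z))%:R).
  by move=> sq uq; apply: (sub_density hl hlk (ltW t0) hv5 _ hd uq).
have hed : theta / 2 <= Av k (fun z => (ed H z)%:R).
  have := sub_density hl hlk (ltW t0) hv5 (leq0n l) hd (p := [::]) isT erefl.
  by rewrite subn0.
have hed1 x : theta / 2 <= Av k.-1 (fun z => (ed H (x :: z))%:R).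
  have := sub_density hl hlk (ltW t0) hv5 hl hd (p := [:: x]) isT erefl.
  by rewrite subn1.
have hbad := hbr V H hv1 hpair.
have hbad' : Av 2 (fun p : seq V => (gdens l H p < br)%R%:R) <= gamma.
  by apply: le_trans hbad _; rewrite ger_pMr // ltW.
pose X := [set x | (gamma < badness l H br x)%R].
have cX : #|X|%:R <= g1 * #|V|%:R by apply: (card_bad n0 g0 hbad).
(* Tuples with a bad vertex accept every list, so that the density hypothesis of [selection] holds
   for all indices. *)
pose A (i : (k - l).-tuple V) := [pred a : seq V | has (mem X) (i : seq V) || absorber l H i a].
have [||i|F0 [v0 s0 c0]] := hF V _ A set0 hv2.
- by rewrite card_tuple.
- by rewrite cards0 mulr0 mulr_ge0 // divr_ge0 // ltW.
- case: (boolP (has (mem X) (i : seq V))) => hi.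
    apply: Av_ge => // s _; by rewrite /= hi.
  apply: le_trans (_ : _ <= (theta / 2 * bc - cs * gamma) * br ^+ csize) _; first by rewrite ge_min lexx orbT.
  apply: le_trans (_ : _ <= Av asize (fun a => (absorber l H i a)%:R)) _.
    apply: (absorber_density hl hlk n0 (ltW b0) (ltW br0) (ltW g0) (hbc V H n0 hd) hed) hbad' => //.
      by rewrite size_tuple.
    by move=> w hw; move/hasPn: hi => /(_ w hw); rewrite /= inE -leNgt.
  by apply: ler_Av => s _; apply: lebR => h; rewrite /= h orbT.
(* Lists selected only for the sake of such tuples need not be absorbers. Dropping them keeps the
   counts of all tuples of good vertices. *)
pose F := [seq a <- F0 | [exists i : (k - l).-tuple V, absorber l H i a]].
have vF : valid asize set0 F by exact: valid_filter.
have hFm a : a \in F -> exists2 W, size W = (k - l)%N & absorber l H W a.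
  rewrite mem_filter => /andP[/existsP[i hi] _]; exists i => //; by rewrite size_tuple.
have sF : (size F <= p * (#|V| %/ K))%N by rewrite size_filter; exact: leq_trans (count_size _ _) s0.
have cF W : size W = (k - l)%N -> ~~ has (mem X) W -> (#|V| %/ K <= count (absorber l H W) F)%N.
  move=> sW hW; have eW : size W == (k - l)%N by apply/eqP.
  apply: leq_trans (c0 (Tuple eW)) _; rewrite count_filter; apply: eq_leq; apply: eq_count => a.
  rewrite /= (negbTE hW) /=; case h: (absorber _ _ _ _) => //=; apply/esym/existsP.
  by exists (Tuple eW).
(* Linking starts from a first path, so the family must be nonempty; a constant tuple at a good
   vertex shows this. *)
have F0n : F != [::].
  have [x hx] : exists x, x \notin X.
    apply/existsP; rewrite -negb_forall; apply/negP => /forallP hall.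
    have : #|X| = #|V| by apply: eq_card => x; rewrite hall.
    by move=> e; move: cX; rewrite e -[X in X <= _]mul1r ler_pM2r // leNgt g11.
  apply/negP => /eqP e; have := cF (nseq (k - l) x) (size_nseq _ _).
  rewrite e /= leqn0 -leqn0 leqNgt divn_gt0 // => /(_ _)/negP; apply.
    by apply/hasPn => y /nseqP[-> _].
  by [].
pose U0 := [set x in flatten F].
have cU0 : (#|U0| <= asize * size F)%N.
  by rewrite cardsE; apply: leq_trans (card_size _) _; rewrite (valid_size vF).
have hsum : (#|U0| + k * #|X| + csize * (size F * csize.+1 + #|X|))%:R <= mu0 * #|V|%:R :> R.
  apply: le_trans (_ : _ <= (size F * D)%:R + (k%:R + cs) * #|X|%:R) _.
    rewrite /cs -natrD -natrM -natrD ler_nat.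
    exact: link_count.
  have h1 : (k%:R + cs) * #|X|%:R <= mu0 / 2 * #|V|%:R.
    by rewrite -hg1 -mulrA ler_wpM2l // ltW.
  suff h2 : (size F * D)%:R <= mu0 / 2 * #|V|%:R :> R by move: h1 h2; lra.
  apply: le_trans (_ : _ <= p%:R * D%:R * (#|V| %/ K)%:R) _.
    by rewrite -!natrM ler_nat mulnAC leq_mul2r sF orbT.
  apply: le_trans (_ : _ <= mu0 / 2 * K%:R * (#|V| %/ K)%:R) _; first by rewrite ler_wpM2r // ltW.
  rewrite -mulrA ler_wpM2l ?divr_ge0 ?(ltW m1) // -natrM ler_nat mulnC; exact: leq_trunc_div.
have hmuX (N : nat) : (N <= #|U0| + k * #|X| + csize * (size F * csize.+1 + #|X|))%N -> N%:R <= mu0 * #|V|%:R :> R.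
  by move=> h; apply: le_trans hsum; rewrite ler_nat.
have [|esx [Xsx [x1 x2 x3 x4 [x5 x6]]]] := cover_vertices hl hlk (X := X) (U0 := U0) n0 hed1.
  have h1 := hn3 _ hv3; have h2 := hmuX _ (leq_addr _ _).
  rewrite natrD mulrDr mulr1.
  have h3 : k%:R * (mu0 * #|V|%:R) <= theta / 4 * #|V|%:R by rewrite mulrA ler_wpM2r // ltW.
  have h4 : k%:R * (#|U0| + k * #|X|)%:R <= k%:R * (mu0 * #|V|%:R) by rewrite ler_wpM2l // ltW.
  move: h1 h3 h4; rewrite !mulrA; lra.
have [Xs0 [y1 y2 y3]] := idle_family hl hlk vF hFm.
have [e [es' ees]] : exists e es', flatten [seq state_ends k l a | a <- F] ++ esx = e :: es'.
  by case: (F) F0n => [//|a F' _]; eexists; eexists; reflexivity.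
have ses : (size es' <= size F * csize.+1 + #|X|)%N.
  have : size (e :: es') = (size F * csize.+1 + size esx)%N by rewrite -ees size_cat size_family_ends.
  by move=> /= h; apply: leq_trans (leqnSn _) _; rewrite h leq_add2l.
have dX : [disjoint U0 & Union Xsx].
  by apply: disj_Union; apply: sub_all x3 => B; rewrite disjoint_sym.
pose Y1 := ~: (U0 :|: Union Xsx).
have [||||C [C1 C2 C3]] := @link_paths k l V H e es' (Xs0 ++ Xsx) Y1.
- by rewrite -ees; apply: paths_ok_cat.
- by apply: pdisj_cat => //; rewrite y3.
- apply: Union_disjoint; rewrite Union_cat y3; apply/disjointP => z hz.
  by rewrite in_setC hz.
- apply: (oracle_direct hl hlk n0 (hbc V H n0 hd)); have -> : ~: Y1 = U0 :|: Union Xsx by apply/setP => z; rewrite in_setC in_setC negbK.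
  have h1 := hn4 _ hv4.
  have h2 : (#|U0 :|: Union Xsx| + csize * size es')%:R <= mu0 * #|V|%:R :> R.
    apply: hmuX; apply: leq_add; last by rewrite leq_mul2l ses orbT.
    by apply: leq_trans (leq_card_setU _ _) _; rewrite leq_add2l.
  have h3 : cs * (mu0 * #|V|%:R) <= bc / 2 * #|V|%:R by rewrite mulrA ler_wpM2r // ltW.
  have h4 := ler_wpM2l cs0 h2; rewrite -/cs; lra.
have hlink Xs : paths_ok l H (flatten [seq state_ends k l a | a <- F]) Xs -> pdisj Xs ->
    [disjoint Union Xs & C :|: Union Xsx] ->
    lpath l H e.1 (C :|: (Union Xs :|: Union Xsx)) (last e es').2.
  move=> q1 q2 q3; rewrite -Union_cat; apply: C3.
  - by rewrite -ees; apply: paths_ok_cat.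
  - by apply: pdisj_cat => //; apply: disjointWr q3; exact: subsetUr.
  - apply: Union_disjoint; rewrite Union_cat; apply/disjointP => z; rewrite inE => /orP[h|h] hC.
      by have /disjointP/(_ z h) := q3; apply; rewrite inE hC.
    by move: (subsetP C1 _ hC); rewrite !inE h orbT.
have dCU : [disjoint U0 & C].
  by apply/disjointP => z hz hC; move: (subsetP C1 _ hC); rewrite in_setC in_setU hz.
exists e.1, (C :|: (U0 :|: Union Xsx)), (last e es').2; split.
- rewrite /U0 -y3; apply: hlink => //; rewrite y3; apply/disjointP => z hz; rewrite inE => /orP[h|h].
    by have /disjointP/(_ z hz h) := dCU.
  by have /disjointP/(_ z hz h) := dX.
- apply: le_trans (_ : _ <= mu0 * #|V|%:R) _; last by rewrite ler_wpM2r.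
  apply: hmuX; rewrite addnC; apply: leq_trans (leq_card_setU _ _) _; apply: leq_add.
    by apply: leq_trans C2 _; rewrite leq_mul2l ses orbT.
  by apply: leq_trans (leq_card_setU _ _) _; rewrite leq_add2l.
move=> W hdiv hW dW.
have dWP z : z \in W -> [/\ z \notin C, z \notin U0 & z \notin Union Xsx].
  move=> hz; have /disjointP/(_ z hz) := dW; rewrite !inE => h.
  by split; apply/negP => h'; apply: h; rewrite h' ?orbT.
have [|||Xs1 [z1 z2 z3]] := absorbing_family hl hlk vF hFm (X := W) (h := (#|V| %/ K)%N) hdiv.
- by rewrite leq_divRL // -(ler_nat R) natrM -ler_pdivlMr // mulrC.
- by apply/disjointP => z /dWP[_ + _] h'; rewrite h'.
- move=> w sw hw; apply: cF => //; apply/hasPn => z /hw /dWP[_ h1 h2].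
  apply/negP => /= /(subsetP x4); by rewrite inE (negbTE h1) (negbTE h2).
have -> : C :|: (U0 :|: Union Xsx) :|: W = C :|: (Union Xs1 :|: Union Xsx).
  by rewrite z3 -!setUA; congr (_ :|: (_ :|: _)); rewrite setUC.
apply: hlink => //; rewrite z3; apply/disjointP => z; rewrite inE => /orP[hz|/dWP[h1 h2 h3]].
  rewrite inE => /orP[h|h]; first by have /disjointP/(_ z hz h) := dCU.
  by have /disjointP/(_ z hz h) := dX.
by rewrite inE (negbTE h1) (negbTE h3).
Qed.

End Core.

(** * Hamilton l-cycles *)

Section Assembly.
Context {R : realType}.
Variables (k l : nat).
Hypotheses (hl : (0 < l)%N) (hlk : (2 * l < k)%N).
Notation csize := (csize k l).

Lemma half_count (n K z : nat) : (2 * K * z <= n -> 2 * K <= n -> z.+1 * K <= n)%N.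
Proof. by rewrite -mulnA mulnC [(z.+1 * K)%N]mulSn (mulnC z); lia. Qed.

(** The bound [c] on the set to be avoided is fixed before the size [alpha] of the reservoir: that
    set will be the absorbing path, whose capacity determines how small the reservoir must be. *)
Lemma reservoir (theta : R) : 0 < theta -> theta <= 1 -> (1 / 2) ^+ (k - l) < theta ^+ l ->
  exists2 c : R, 0 < c & forall alpha : R, 0 < alpha -> exists2 rho : R, 0 < rho &
  exists n0 : nat, forall (V : finType) (H : kgraph k V) (Z : {set V}), (n0 <= #|V|)%N ->
    dense H l theta -> #|Z|%:R <= c * #|V|%:R ->
    exists Y : {set V}, [/\ [disjoint Y & Z], #|Y|%:R <= alpha * #|V|%:R &
      forall z : nat, z%:R <= rho * #|V|%:R -> oracle l H Y z].
Proof.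
move=> t0 t1 ht; have [bc b0 hbc] := conn_density hl hlk t0 t1 ht.
pose beta := Num.min 1 bc.
have be0 : 0 < beta by rewrite lt_min ltr01.
have be1 : beta <= 1 by rewrite ge_min lexx.
have cs0 : 0 < csize%:R :> R by rewrite ltr0n /csize; lia.
have [p [K0 hsel]] := selection csize (2 * l) be0 be1.
exists (beta / 4 / csize%:R); first by rewrite !divr_gt0.
move=> alpha a0; have [K1 hK1] := eventually_lt (csize%:R * p%:R) a0.
pose K := (maxn K0 K1).+1.
have K0R : 0 < K%:R :> R by rewrite ltr0n.
have hpK : csize%:R * p%:R < alpha * K%:R by apply: hK1; rewrite /K leqW // leq_maxr.
have [n2 hF] := hsel K (leqW (leq_maxl K0 K1)).
exists ((2 * K%:R)^-1); first by rewrite invr_gt0 mulr_gt0.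
exists (maxn n2 (2 * K)) => V H Z; rewrite geq_max => /andP[hv1 hv2] hd hZ.
have n0 : (0 < #|V|)%N by apply: leq_trans hv2.
(* The indices are all pairs of l-tuples; those with repetitions do not list l-sets and impose no
   condition. *)
pose A (i : l.-tuple V * l.-tuple V) :=
  [pred c : seq V | (uniq i.1 && uniq i.2) ==> conn l H i.1 i.2 c].
have [|||F [v0 s0 c0]] := hF V _ A Z hv1.
- by rewrite card_prod !card_tuple -expnD addnn mul2n.
- by rewrite mulrC -ler_pdivlMr // mulrAC.
- move=> i; case: (boolP (uniq i.1 && uniq i.2)) => [/andP[u1 u2]|hi].
    apply: le_trans (_ : _ <= bc) _; first by rewrite ge_min lexx orbT.
    apply: le_trans (hbc V H n0 hd i.1 i.2 u1 (size_tuple _) u2 (size_tuple _)) _.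
    by apply: ler_Av => s _; apply: lebR => h; rewrite /= h implybT.
  apply: le_trans be1 _; apply: Av_ge => // s _; by rewrite /= (negbTE hi).
exists [set x in flatten F]; split.
- apply/disjointP => x; rewrite inE => hx hxZ; case/and3P: v0 => _ _ /hasPn/(_ x hx).
  by rewrite /= hxZ.
- apply: le_trans (_ : _ <= (csize * size F)%:R) _.
    by rewrite ler_nat cardsE -(valid_size v0); exact: card_size.
  apply: le_trans (_ : _ <= csize%:R * p%:R * (#|V| %/ K)%:R) _.
    by rewrite -natrM -natrM ler_nat -mulnA leq_mul2l s0 orbT.
  apply: le_trans (_ : _ <= alpha * K%:R * (#|V| %/ K)%:R) _; first by rewrite ler_wpM2r // ltW.
  by rewrite -mulrA ler_wpM2l ?(ltW a0) // -natrM ler_nat mulnC leq_trunc_div.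
- move=> z hz; apply: (oracle_family hl hlk (h := (#|V| %/ K)%N) v0).
    rewrite leq_divRL //; apply: half_count hv2.
    by rewrite -(ler_nat R) natrM natrM mulrC -ler_pdivlMr ?mulr_gt0 // mulrC.
  move=> s t us ss ut st; have es : size s == l by apply/eqP.
  have et : size t == l by apply/eqP.
  apply: leq_trans (c0 (Tuple es, Tuple et)) _; apply: eq_leq; apply: eq_count => c.
  by rewrite /= us ut.
Qed.

Lemma Union_disjoint_r (V : finType) (Xs : seq {set V}) (Y : {set V}) :
  [disjoint Y & Union Xs] -> all (fun X : {set V} => [disjoint Y & X]) Xs.
Proof.
by rewrite disjoint_sym => /Union_disjoint; apply: sub_all => X; rewrite disjoint_sym.
Qed.

Lemma last_end_Union (V : finType) (H : kgraph k V) e es Xs : paths_ok l H (e :: es) Xs ->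
  (last e es).2 \subset Union Xs.
Proof.
elim: es e Xs => [|e' es IH] e [|X Xs] //= [hX h]; rewrite /Union big_cons.
  by apply: subset_trans (subsetUl _ _); case: (lpath_facts hX).
by apply: subset_trans (IH e' Xs h) (subsetUr _ _).
Qed.

(** The cycle is first linked and closed with the absorbing path idle. The vertices it misses are
    then absorbed, while all connectors remain in place. *)
Lemma hamilton_core (theta theta1 : R) : (1 < l)%N -> 0 < theta -> theta <= 1 ->
  (1 / 2) ^+ (k - l) < theta ^+ l -> theta1 < theta ->
  (forall eps, 0 < eps -> pieces_cover k l theta1 (1 - eps)) ->
  exists n0 : nat, forall (V : finType) (H : kgraph k V),
    (n0 <= #|V|)%N -> (k - l %| #|V|)%N -> dense H l theta -> has_hamilton_cycle l H.
Proof.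
move=> l2 t0 t1 ht htt hclaim.
have r0 : 0 < (k - l)%:R :> R by rewrite ltr0n; lia.
have cs0 : 0 < csize%:R :> R by rewrite ltr0n /csize; lia.
(* A path has l vertices modulo k - l, so by this identity closing it with a connector makes the
   number of vertices a multiple of k - l. *)
have clE : (csize + l = 2 * (k - l))%N by rewrite /csize; lia.
have [c c0 hres] := reservoir t0 t1 ht.
(* The absorbing path and the reservoir together occupy at most 2 d n vertices: at least half of the
   vertices remain, and the density on them stays above [theta1]. *)
pose d := Num.min (1 / 4) ((theta - theta1) / 2 / (k - l)%:R).
have d0 : 0 < d by rewrite lt_min !divr_gt0 // subr_gt0.
have d1 : d <= 1 / 4 by rewrite ge_min lexx.
have d2 : (k - l)%:R * (2 * d) <= theta - theta1.
  rewrite mulrCA mulrC -ler_pdivlMr // mulrC -ler_pdivlMr //.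
  by rewrite ge_min lexx orbT.
have m0 : 0 < Num.min c d by rewrite lt_min c0.
have [alpha a0 [n1 habs]] := absorbing_path hl hlk l2 t0 t1 ht m0.
have a'0 : 0 < Num.min (alpha / 2) d by rewrite lt_min divr_gt0.
have [rho rho0 [n2 hY]] := hres _ a'0.
have e0 : 0 < alpha / 4 by rewrite divr_gt0.
(* Large [b] makes the share 1/b lost at the ends of pieces at most alpha/4, and the at most n/b
   paths few enough for the reservoir. *)
have [b [b0 hb1 hb2]] : exists b : nat, [/\ (0 < b)%N, 1 <= alpha / 4 * b%:R & csize%:R <= rho * b%:R :> R].
  have [N1 h1] := eventually_lt 1 e0; have [N2 h2] := eventually_lt csize%:R rho0.
  exists (maxn N1 N2).+1; split => //.
    by apply/ltW/h1; rewrite leqW // leq_maxl.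
  by apply/ltW/h2; rewrite leqW // leq_maxr.
have bR : 0 < b%:R :> R by rewrite ltr0n.
have [n3 hcov] := path_cover hl hlk b0 htt (hclaim _ e0).
exists (maxn n1 (maxn n2 (maxn (2 * n3) (3 * (k - l))))) => V H.
rewrite !geq_max => /andP[hv1 /andP[hv2 /andP[hv3 hv4]]] hdiv hd.
have n0 : (0 < #|V|)%N by apply: leq_trans hv4; rewrite muln_gt0 /= -(ltr0n R).
have nR : 0 < #|V|%:R :> R by rewrite ltr0n.
have [S [P [T [hP cP hX]]]] := habs V H hv1 hd.
have cPc : #|P|%:R <= c * #|V|%:R by apply: le_trans cP _; rewrite ler_wpM2r // ge_min lexx.
have cPd : #|P|%:R <= d * #|V|%:R by apply: le_trans cP _; rewrite ler_wpM2r // ge_min lexx orbT.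
have [Y [dYP cY horacle]] := hY V H P hv2 hd cPc.
have cYa : #|Y|%:R <= alpha / 2 * #|V|%:R by apply: le_trans cY _; rewrite ler_wpM2r // ge_min lexx.
have cYd : #|Y|%:R <= d * #|V|%:R by apply: le_trans cY _; rewrite ler_wpM2r // ge_min lexx orbT.
pose W := ~: (P :|: Y).
have cW : #|V|%:R - #|W|%:R <= 2 * d * #|V|%:R.
  have h1 : #|V|%:R = #|P :|: Y|%:R + #|W|%:R :> R by rewrite -natrD cardsC.
  have h2 : #|P :|: Y|%:R <= #|P|%:R + #|Y|%:R :> R by rewrite -natrD ler_nat leq_card_setU.
  rewrite h1 addrK -h1; lra.
have [||es [Xs [p1 p2 p3 p4 p5]]] := hcov V H W _ hd.
- rewrite -(leq_pmul2l (isT : (0 < 2)%N)) -(ler_nat R) !natrM.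
  have : (2 * n3)%:R <= #|V|%:R :> R by rewrite ler_nat.
  have : d * #|V|%:R <= 1 / 4 * #|V|%:R by rewrite ler_wpM2r.
  rewrite natrM; lra.
- apply: le_trans d2; rewrite ler_wpM2l ?(ltW r0) //.
  by rewrite -{1}(divff (lt0r_neq0 nR)) -mulrBl ler_pdivrMr.
have dUY : [disjoint P :|: Union Xs & Y].
  apply/disjointP => x; rewrite inE => /orP[hx|/(subsetP p3) hx] hY'.
    by have /disjointP/(_ x hY' hx) := dYP.
  by move: hx; rewrite in_setC in_setU hY' orbT.
have dPU : [disjoint P & Union Xs].
  apply/disjointP => x hx /(subsetP p3); by rewrite /W in_setC in_setU hx.
have hz : (csize * size es)%:R <= rho * #|V|%:R :> R.
  have h1 : (size es * b)%:R <= #|V|%:R :> R by rewrite ler_nat (leq_trans p4) // max_card.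
  rewrite natrM in h1; rewrite natrM; apply: le_trans (_ : _ <= rho * b%:R * (size es)%:R) _.
    by rewrite ler_wpM2r.
  by rewrite -mulrA ler_wpM2l ?(ltW rho0) // mulrC.
have hok : paths_ok l H ((S, T) :: es) (P :: Xs) by split.
have hpd : pdisj (P :: Xs) by rewrite /pdisj /= -/(pdisj Xs) p2 andbT; exact: Union_disjoint_r.
have UE A : Union (A :: Xs) = A :|: Union Xs by rewrite /Union big_cons.
have [|C [C1 C2 C3]] := link_paths hok hpd _ (horacle _ hz).
  by apply: Union_disjoint; rewrite UE.
have hT := last_end_Union hok; rewrite UE in hT.
have hC x : x \in C -> [/\ x \in Y, x \notin P & x \notin Union Xs].
  move=> hx; have hxY := subsetP C1 _ hx.
  by split=> //; apply/negP => h; have /disjointP/(_ x) := dUY; rewrite inE h ?orbT; apply.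
have h1 : lpath l H S (C :|: (P :|: Union Xs)) (last (S, T) es).2.
  rewrite -UE; apply: C3 => //; apply: Union_disjoint; rewrite UE; apply/disjointP => x.
  by rewrite inE => /orP[h|h] /hC[_ h2 h3]; [rewrite h in h2|rewrite h in h3].
have [f1 f2 f3 f4 f5] := lpath_facts h1.
have [SP _ _ _ _] := lpath_facts hP.
(* The closing connector comes from the same reservoir, now avoiding the connectors [C]. *)
have [||||D [D1 D2 D3 D4]] := horacle _ hz C (last (S, T) es).2 S _ f5 f4.
- by apply: leq_trans C2; exact: subset_leq_card (subsetIl _ _).
- by rewrite disjoint_sym.
- exact: disjointWl hT dUY.
- by apply: disjointWl dUY; apply: subset_trans SP (subsetUl _ _).
set T' := (last (S, T) es).2 in hT h1 f2 f3 f5 D4.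
have hD x : x \in D -> [/\ x \notin C, x \notin P & x \notin Union Xs].
  move=> hx; have hxY := subsetP D1 _ hx; split.
  - by apply/negP => h; have /disjointP/(_ x hx h) := D2.
  - by apply/negP => h; have /disjointP/(_ x) := dUY; rewrite inE h; apply.
  - by apply/negP => h; have /disjointP/(_ x) := dUY; rewrite inE h orbT; apply.
pose X0 := ~: (C :|: (P :|: Union Xs) :|: D).
have X0P x : x \in X0 -> [/\ x \notin C, x \notin P, x \notin Union Xs & x \notin D].
  by rewrite !inE !negb_or -!andbA => /and4P[].
have cX0 : (#|C :|: (P :|: Union Xs)| + csize + #|X0| = #|V|)%N.
  rewrite -D3 -(cardsC (C :|: (P :|: Union Xs) :|: D)) (cardsU (C :|: (P :|: Union Xs)) D) (_ : _ :&: D = set0) ?cards0 ?subn0 //.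
  apply/setP => x; rewrite !inE; apply/negP => /andP[hx /hD[q1 q2 q3]].
  by move: hx; rewrite (negbTE q1) (negbTE q2) (negbTE q3).
have h2 : lpath l H S (P :|: X0) T.
  apply: hX.
  - have [e he] := lpath_card hl hlk h1.
    move: hdiv; rewrite -cX0 he.
    have -> : (e.+1 * (k - l) + l + csize = (e.+1 + 2) * (k - l))%N.
      by rewrite -addnA (addnC l) clE -mulnDl.
    by rewrite dvdn_addr // dvdn_mull.
  - have : (#|X0| <= #|Y| + #|W :\: Union Xs|)%N.
      apply: leq_trans (leq_card_setU _ _); apply: subset_leq_card; apply/subsetP => x /X0P[_ hp hu _].
      by rewrite !inE hu (negbTE hp) orbN.
    rewrite -(ler_nat R) natrD => h2.
    have h3 : #|W|%:R / b%:R <= alpha / 4 * #|W|%:R.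
      by rewrite ler_pdivrMr // mulrAC ler_peMl.
    have h4 : alpha / 4 * #|W|%:R <= alpha / 4 * #|V|%:R by rewrite ler_wpM2l ?(ltW e0) // ler_nat max_card.
    lra.
  - by apply/disjointP => x /X0P[_ /negP].
(* The same connectors [C] link the paths when the absorbing path has been replaced by one on P and
   X0 with the same ends. *)
have h3 : lpath l H S (C :|: (P :|: X0 :|: Union Xs)) T'.
  rewrite -UE; apply: C3.
  - by split.
  - rewrite /pdisj /= -/(pdisj Xs) p2 andbT; apply: Union_disjoint_r.
    apply/disjointP => x; rewrite inE => /orP[hx|/X0P[_ _ /negP //]] hu.
    by have /disjointP/(_ x hx hu) := dPU.
  - apply: Union_disjoint; rewrite UE; apply/disjointP => x hx /[dup] hxC /hC[_ q2 q3].
    move: hx; rewrite !in_setU (negbTE q2) (negbTE q3) orbF /= => /X0P[/negP] //.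
apply: (lpath_hamilton hl hlk h3 D4 _ _ hv4).
- apply/setP => x; apply/idP/idP; last first.
    rewrite inE => /orP[hx|hx]; rewrite !in_setI !in_setU hx ?orbT ?andbT.
      by rewrite (subsetP SP _ hx) !orbT.
    by move: (subsetP hT _ hx); rewrite in_setU => /orP[] ->; rewrite !orbT.
  rewrite in_setI => /andP[hx]; rewrite !in_setU => /orP[/orP[->|/[dup] hxD /hD[q1 q2 q3]]|->] //; rewrite ?orbT //.
  by move: hx; rewrite !in_setU (negbTE q1) (negbTE q2) (negbTE q3) /= orbF => /X0P[_ _ _]; rewrite hxD.
- apply/setP => x; rewrite in_setT; case: (boolP (x \in X0)) => [hx|]; first by rewrite !in_setU hx !orbT.
  rewrite in_setC negbK !in_setU => /orP[/or3P[]|] -> ; by rewrite ?orbT.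
Qed.

End Assembly.

(** * From densities back to degrees and thresholds *)

Lemma binomial_lower n j : (n - j <= 'C(n, j.+1))%N.
Proof.
elim: n => [//|n IH]; rewrite binS.
have [h|h] := leqP j n; last by rewrite (eqP (_ : n.+1 - j == 0)%N) // subn_eq0.
by rewrite subSn // -addn1 leq_add // bin_gt0.
Qed.

Lemma hamilton_degree (R : realType) (k l : nat) (eta : R) : (2 <= l)%N -> (2 * l < k)%N -> 0 < eta ->
  exists n0 : nat, forall (V : finType) (H : kgraph k V),
      (n0 <= #|V|)%N -> (k - l %| #|V|)%N ->
      ((Order.max (((1 / 2) `^ ((k - l)%:R / l%:R))%:E) (t_lim R k l l)
          + eta%:E) * ('C(#|V|, k - l)%:R)%:E
        <= ((min_degree H l)%:R)%:E)%E ->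
      has_hamilton_cycle l H.
Proof.
move=> l2 hlk e0; have hl : (0 < l)%N by exact: ltnW.
have hlk' : (l <= k)%N by lia.
have C0 n : (k <= n)%N -> 0 < 'C(n, k - l)%:R :> R.
  by move=> h; rewrite ltr0n bin_gt0; apply: leq_trans h; exact: leq_subr.
set x := (1 / 2) `^ _; have x0 : 0 < x by rewrite powR_gt0.
have xl : x ^+ l = (1 / 2) ^+ (k - l).
  rewrite -powR_mulrn ?(ltW x0) // -powRrM divfK ?powR_mulrn //.
  by rewrite pnatr_eq0 -lt0n.
set M := Order.max _ _; have hxM : (x%:E <= M)%E by rewrite le_max lexx.
have htM : (t_lim R k l l <= M)%E by rewrite le_max lexx orbT.
case: M hxM htM => [m| |] //; last first.
  move=> _ _; exists k => V H hV _; rewrite addye //.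
  by rewrite mulyr gtr0_sg ?C0 // mul1e leye_eq.
rewrite lee_fin => hxm htm.
(* Above 1 the degree condition contradicts the trivial upper bound on degrees; an infinite maximum
   was excluded likewise. *)
have [hm|hm] := ltP 1 (m + eta).
  exists k => V H hV _; rewrite -EFinD -EFinM lee_fin => h.
  have := le_trans h (_ : _ <= 'C(#|V|, k - l)%:R); rewrite ler_nat min_degree_le => /(_ isT).
  by rewrite ger_pMl ?C0 // leNgt hm.
have m0 : 0 < m by exact: lt_le_trans hxm.
have theta0 : 0 < m + eta / 2 by rewrite addr_gt0 // divr_gt0.
have theta1 : m + eta / 2 <= 1 by lra.
have hth : (1 / 2) ^+ (k - l) < (m + eta / 2) ^+ l.
  by rewrite -xl ltrXn2r ?nnegrE ?(ltW x0) ?(ltW theta0) -?lt0n //; lra.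
(* The slack [eta] is spent in layers: m + eta/4 exceeds the tiling threshold, 3/8 is the density
   kept after removing the absorbing path and the reservoir, and 1/2 is the density of the graph
   itself. The other half pays for replacing binomials by powers. *)
have hlt : m + 3 / 8 * eta < m + eta / 2 by lra.
have hcl eps : 0 < eps -> pieces_cover k l (m + 3 / 8 * eta) (1 - eps).
  move=> eps0; apply: (@tiling_pieces_cover R k l (m + eta / 4)) => //; [lia|lra|lra|].
  by apply: le_lt_trans htm _; rewrite lte_fin; lra.
have [n1 h1] := hamilton_core hl hlk l2 theta0 theta1 hth hlt hcl.
have [n2 h2] := eventually_lt ((k - l)%:R ^+ 2) (divr_gt0 e0 (ltr0Sn R 1)).
exists (maxn n1 (maxn n2 1)) => V H; rewrite !geq_max => /andP[hv1 /andP[hv2 n0]] hdiv.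
rewrite -EFinD -EFinM lee_fin => hdeg; apply: h1 => //.
apply: min_degree_dense hdeg => //; first by lra.
have nR : 0 < #|V|%:R :> R by rewrite ltr0n.
have : (k - l)%:R ^+ 2 / #|V|%:R <= eta / 2 by rewrite ler_pdivrMr // ltW // h2.
have : 0 <= (k - l)%:R ^+ 2 / #|V|%:R :> R by rewrite divr_ge0 ?exprn_ge0.
set u := _ / _ => u0 u1; have : (m + eta) * u <= u by rewrite ler_piMl.
lra.
Qed.

(** The integer threshold exceeds (m + e/2) times the binomial coefficient by at most 1. This
    coefficient tends to infinity by [binomial_lower], so the remaining e/2 covers the rounding. *)
Lemma h_lim_le (R : realType) (k l : nat) (m : R) : (l < k)%N -> 0 <= m ->
  (forall eta : R, 0 < eta -> exists n0 : nat, forall (V : finType) (H : kgraph k V),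
      (n0 <= #|V|)%N -> (k - l %| #|V|)%N ->
      (m + eta) * 'C(#|V|, k - l)%:R <= (min_degree H l)%:R -> has_hamilton_cycle l H) ->
  (h_lim R l l k <= m%:E)%E.
Proof.
move=> hlk m0 hyp; apply/lee_addgt0Pr => e e0; have e2 : 0 < e / 2 by rewrite divr_gt0.
have [n1 h1] := hyp _ e2; have [n2 h2] := eventually_lt 1 e2.
rewrite -EFinD.
pose N := maxn n1 (n2 + k).
apply: ge_ereal_inf; eexists; first exists [set n | (N <= n)%N /\ (k - l %| n)%N]%classic => //.
  by exists N => // n hn hd; split.
apply: ge_ereal_sup => _ [n [+ hdiv] <-]; rewrite geq_max => /andP[hn1 hn2].
rewrite lee_fin; set C := 'C(n, k - l).
have hC : (n2 <= C)%N.
  have := binomial_lower n (k - l).-1; rewrite prednK ?subn_gt0 // -/C => h.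
  by apply: leq_trans h; lia.
have C0 : 0 < C%:R :> R.
  by rewrite ltr0n bin_gt0; lia.
rewrite ler_pdivrMr //.
have := h2 _ hC => h3.
apply: le_trans (_ : _ <= (m + e / 2) * C%:R + 1) _; last lra.
have p0 : 0 <= (m + e / 2) * C%:R by rewrite mulr_ge0 // addr_ge0 // ltW.
apply: le_trans (_ : _ <= (Num.truncn ((m + e / 2) * C%:R)).+1%:R) _; last first.
  by rewrite -natr1 lerD2r truncn_le.
rewrite ler_nat /hamilton_threshold /threshold; case: ex_minnP => t _; apply.
apply/asboolP => V H cV hdeg; apply: h1; rewrite ?cV //.
apply: le_trans (ltW (truncnS_gt _)) _; by rewrite ler_nat.
Qed.

Theorem theorem1p5 (R : realType) (k l : nat) (hl : (2 <= l)%N)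
    (hlk : (2 * l < k)%N) :
  (forall eta : R, 0 < eta ->
    exists n0 : nat, forall (V : finType) (H : kgraph k V),
      (n0 <= #|V|)%N -> (k - l %| #|V|)%N ->
      ((Order.max (((1 / 2) `^ ((k - l)%:R / l%:R))%:E) (t_lim R k l l)
          + eta%:E) * ('C(#|V|, k - l)%:R)%:E
        <= ((min_degree H l)%:R)%:E)%E ->
      has_hamilton_cycle l H)
  /\ (h_lim R l l k
        <= Order.max (((1 / 2) `^ ((k - l)%:R / l%:R))%:E) (t_lim R k l l))%E.
Proof.
have h1 eta := @hamilton_degree R k l eta hl hlk; split; first exact: h1.
move: h1; set M := Order.max _ _; have : (0%:E <= M)%E.
  by rewrite le_max lee_fin powR_ge0.
case: M => [m| |] //; last by rewrite !leey.
rewrite lee_fin => m0 h1; apply: h_lim_le m0 _ => [|eta /h1[n0 h2]]; first by lia.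
exists n0 => V H hV hdiv hdeg; exact: h2.
Qed.
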